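(* Let $g\colon\mathbb{R}^n\times\mathbb{R}^m\to\mathbb{R}$ be a continuously differentiable function satisfying the exponential growth condition at $\bar{x}\in\mathbb{R}^n$. Assume that $g$ is convex in the second argument and that $\bar{x}$ is a $\mathfrak{z}$-uniform Slater point. Then there exists a neighborhood $U'$ of $\bar{x}$ such that the probability function $\Phi$ is continuously differentiable on $U'$, and $$\nabla\Phi(x)=\int_{\mathbb{S}^{m-1}\times\mathcal{C}}\nabla_x e_c(x,v)\,d\zeta_\Theta(v)\,d\mathfrak{m}(c)\quad\text{for all }x\in U',$$ where for each $x\in U'$ the gradient $\nabla_x e_c(x,v)$ of $e_c(\cdot,v)$ at $x$ exists for $\zeta_\Theta\otimes\mathfrak{m}$-almost every $(v,c)$, its value on the exceptional null set being taken as $0$.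
   Context: Setting. $\mathcal{C}\subset\mathbb{R}^p$ is a Borel set with Borel $\sigma$-algebra $\mathcal{F}$, and $\mathfrak{m}$ is a probability measure on $(\mathcal{C},\mathcal{F})$ (the law of a random parameter $C$). The maps $\mathfrak{z}\colon\mathcal{C}\to\mathbb{R}^m$ and $\mathfrak{L}\colon\mathcal{C}\to\mathbb{R}^{m\times m}$ are measurable; $\Sigma(c)$ is a positive definite $m\times m$ matrix and $\mathfrak{L}(c)$ is its Cholesky factor, i.e. the lower triangular matrix with positive diagonal such that $\mathfrak{L}(c)\mathfrak{L}(c)^\top=\Sigma(c)$. There exists $\eta_0>0$ with $\|\mathfrak{z}(c)\|_2+\|\mathfrak{L}(c)\|_M\le\eta_0$ for all $c\in\mathcal{C}$ ($\|\cdot\|_2$ Euclidean norm, $\|\cdot\|_M$ the induced operator norm). Conditionally on $C=c$, the random vector $\xi$ has law $\mathcal{N}(\mathfrak{z}(c),\Sigma(c))$, with density $$h_c(z)=\frac{1}{\sqrt{(2\pi)^m\det\Sigma(c)}}\exp\left(-\tfrac12(z-\mathfrak{z}(c))^\top\Sigma(c)^{-1}(z-\mathfrak{z}(c))\right).$$ Probability function. $\varphi_c(x)=\int_{\{z:\,g(x,z)\le0\}}h_c(z)\,dz$ and $\Phi(x)=\int_{\mathcal{C}}\varphi_c(x)\,d\mathfrak{m}(c)$, which equals $\mathbb{P}(g(x,\xi)\le 0)$. Radial probability function. $\mathbb{S}^{m-1}$ is the Euclidean unit sphere of $\mathbb{R}^m$ and $\zeta_\Theta$ the uniform probability measure on it.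 Let $\chi(r)=\frac{1}{2^{m/2-1}\Gamma(m/2)}r^{m-1}e^{-r^2/2}$ for $r\ge0$ (density of the $\chi$-distribution with $m$ degrees of freedom), and $$e_c(x,v)=\int_{\{r\ge0:\,g(x,r\mathfrak{L}(c)v+\mathfrak{z}(c))\le0\}}\chi(r)\,dr,\qquad (x,v,c)\in\mathbb{R}^n\times\mathbb{S}^{m-1}\times\mathcal{C}.$$ $\nabla_x e_c(x,v)$ is the gradient with respect to $x$. Uniform Slater point. $\bar{x}\in\mathbb{R}^n$ is a $\mathfrak{z}$-uniform Slater point if there exist an open neighborhood $U$ of $\bar{x}$ and $\gamma_0>0$ such that $g(x,\mathfrak{z}(c))<-\gamma_0$ for all $x\in U$ and $\mathfrak{m}$-almost all $c\in\mathcal{C}$. Exponential growth condition. $g$ satisfies it at $\bar{x}$ if there are $\varepsilon,a,b>0$ with $\|\nabla_x g(x,z)\|\le a\exp(b\|z\|)$ for all $(x,z)\in\mathbb{B}_\varepsilon(\bar{x})\times\mathbb{R}^m$, where $\mathbb{B}_\varepsilon(\bar{x})$ is the ball of radius $\varepsilon$ centered at $\bar{x}$. *)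

(* Defs.v *)
From HB Require Import structures.
From mathcomp Require Import all_boot all_order all_algebra.
From mathcomp Require Import all_classical all_reals all_analysis.
From mathcomp Require Import measurable_realfun.

Set Implicit Arguments.
Unset Strict Implicit.
Unset Printing Implicit Defensive.

Import Order.TTheory GRing.Theory Num.Theory.
Import numFieldNormedType.Exports.

Local Open Scope classical_set_scope.
Local Open Scope ring_scope.

Definition mx_borel_display : measure_display. Proof. exact: default_measure_display. Qed.

Section mx_borel.
Variables (R : realType) (m n : nat).

Definition mx_borel : set (set 'M[R]_(m, n)) := <<s open >>.

Let mx_borel0 : mx_borel set0. Proof. exact: sigma_algebra0. Qed.

Let mx_borelC A : mx_borel A -> mx_borel (~` A).
Proof. exact: sigma_algebraC. Qed.

Let mx_borel_bigcup (F : (set 'M[R]_(m, n))^nat) :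
  (forall i, mx_borel (F i)) -> mx_borel (\bigcup_i F i).
Proof. exact: sigma_algebra_bigcup. Qed.

HB.instance Definition _ := @isMeasurable.Build mx_borel_display
  'M[R]_(m, n) mx_borel mx_borel0 mx_borelC mx_borel_bigcup.

End mx_borel.

Section mx_measurable.
Variable R : realType.

Lemma open_measurable_mx m n (U : set 'M[R]_(m, n)) : open U -> measurable U.
Proof. by move=> oU; exact: sub_sigma_algebra. Qed.

Lemma continuous_measurable_fun_mx m n (f : 'M[R]_(m, n) -> R) :
  continuous f -> measurable_fun setT f.
Proof.
move=> cf; apply: (measurability _ (RGenOpens.measurableE R)) => _ [_ [a [b ->]] <-].
rewrite setTI; apply: open_measurable_mx.
by apply: open_comp; [move=> A _; exact: cf|exact: interval_open].
Qed.

Lemma measurable_coord m n i j :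
  measurable_fun setT (fun A : 'M[R]_(m, n) => A i j).
Proof. by apply: continuous_measurable_fun_mx; exact: coord_continuous. Qed.

Lemma mx_rat_ball m n (U : set 'M[R]_(m, n)) (x : 'M[R]_(m, n)) :
  open U -> U x ->
  exists q : 'M[rat]_(m, n) * rat,
    ball (map_mx ratr q.1 : 'M[R]_(m, n)) (ratr q.2) x /\
    ball (map_mx ratr q.1 : 'M[R]_(m, n)) (ratr q.2) `<=` U.
Proof.
rewrite openE => /(_ x) /[apply]; rewrite /interior => /nbhs_ballP[e /= e0 xeU].
have [r] := rat_in_itvoo (divr_gt0 e0 (ltr0Sn _ 1) : 0 < e / 2).
rewrite in_itv/= => /andP[r0 re].
have H i j : exists q : rat, `|ratr q - x i j| < ratr r.
  have xr : x i j < x i j + ratr r by rewrite ltrDl.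
  have [q] := rat_in_itvoo xr.
  rewrite in_itv/= => /andP[q1 q2]; exists q.
  by rewrite ger0_norm ?subr_ge0 ?ltW// ltrBlDl.
pose q := \matrix_(i, j) projT1 (cid (H i j)).
have qx : ball (map_mx ratr q : 'M[R]_(m, n)) (ratr r) x.
  by split=> // i j; rewrite !mxE/= /ball/=; case: cid.
exists (q, r); split => //= y qy; apply: xeU.
have er : ratr r <= e / 2 by exact: ltW.
rewrite (splitr e); apply: (@ball_triangle _ _ (map_mx ratr q : 'M[R]_(m, n))).
- by apply: (le_ball er); exact: ball_sym.
- exact: (le_ball er).
Qed.

Lemma measurable_fun_mx d (T : measurableType d) m n (f : T -> 'M[R]_(m, n)) :
  (forall i j, measurable_fun setT (fun t => f t i j)) -> measurable_fun setT f.
Proof.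
move=> mf.
apply: (@measurability _ _ _ _ _ _ (@open 'M[R]_(m, n))) => // _ [U oU <-].
rewrite setTI.
pose B (q : 'M[rat]_(m, n) * rat) : set 'M[R]_(m, n) :=
  [set y | ball (map_mx ratr q.1 : 'M[R]_(m, n)) (ratr q.2) `<=` U /\
           0 < ratr q.2 :> R /\
           forall i j, ball (ratr (q.1 i j) : R) (ratr q.2) (y i j)].
have -> : f @^-1` U = \bigcup_q f @^-1` B q.
  apply/seteqP; split=> t /=.
    move=> /(mx_rat_ball oU)[q [[q0 qt] qU]]; exists q => //; split => //.
    by split=> // i j; have := qt i j; rewrite mxE.
  by move=> [q _ [qU [q0 qt]]]; apply: qU; split=> // i j; rewrite mxE.
apply: countable_bigcupT_measurable => // q.
have [qU|] := pselect
    (ball (map_mx ratr q.1 : 'M[R]_(m, n)) (ratr q.2) `<=` U); last first.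
  by move=> qU; rewrite (_ : _ @^-1` _ = set0)//; apply/seteqP; split=> t []. 
have [q0|q0] := ltP 0 (ratr q.2 : R); last first.
  rewrite (_ : _ @^-1` _ = set0)//; apply/seteqP; split=> t // [_ []].
  by rewrite ltNge q0.
rewrite (_ : _ @^-1` _ = \bigcap_(ij in [set: 'I_m * 'I_n])
    ((fun t => f t ij.1 ij.2) @^-1` ball (ratr (q.1 ij.1 ij.2) : R) (ratr q.2))).
  apply: fin_bigcap_measurable; first exact: finite_finset.
  move=> [i j] _ /=; rewrite -[X in measurable X]setTI.
  by apply: mf => //; apply: open_measurable; exact: ball_open.
apply/seteqP; split=> t /=.
  by move=> [_ [_ qt]] [i j] _; exact: qt.
by move=> qt; split=> //; split=> // i j; exact: (qt (i, j)).
Qed.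

End mx_measurable.

(* Lebesgue measure on 'cV[R]_k: the image of the (k-1)-st power times one more
   factor under the identification of R * R^k with R^(k+1). *)
Section lebesgue_cV.
Variable R : realType.

Definition cons_cV k (xv : R * 'cV[R]_k) : 'cV[R]_k.+1 :=
  col_mx (xv.1)%:M xv.2.

Lemma measurable_cons_cV k : measurable_fun setT (@cons_cV k).
Proof.
apply: measurable_fun_mx => i j; rewrite /cons_cV.
have [i' ->|i' ->] := split_ordP (i : 'I_(1 + k)).
- rewrite [X in measurable_fun _ X](_ : _ = fst); first exact: measurable_fst.
  by apply/funext => -[x v] /=; rewrite (@col_mxEu _ 1) mxE !ord1 eqxx mulr1n.
- rewrite [X in measurable_fun _ X](_ : _ = (fun v : 'cV[R]_k => v i' j) \o snd).
    by apply: measurableT_comp; [exact: measurable_coord|exact: measurable_snd].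
  by apply/funext => -[x v] /=; rewrite (@col_mxEd _ 1).
Qed.

Definition uncons_cV k (v : 'cV[R]_k.+1) : R * 'cV[R]_k :=
  (v ord0 ord0, dsubmx (v : 'M[R]_(1 + k, 1))).

Lemma cons_cVK k : cancel (@cons_cV k) (@uncons_cV k).
Proof.
move=> [x v]; rewrite /cons_cV /uncons_cV col_mxKd; congr (_, _).
rewrite /=; transitivity (col_mx x%:M v (lshift k ord0) ord0).
  by congr (col_mx _ _ _ _); exact/val_inj.
by rewrite col_mxEu mxE eqxx mulr1n.
Qed.

Lemma uncons_cVK k : cancel (@uncons_cV k) (@cons_cV k).
Proof.
move=> v; rewrite /cons_cV /uncons_cV/=.
transitivity (col_mx (usubmx (v : 'M[R]_(1 + k, 1))) (dsubmx (v : 'M[R]_(1 + k, 1)))).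
  f_equal; apply/matrixP => i j; rewrite !mxE !ord1/= mulr1n.
  by congr (v _ _); exact/val_inj.
exact: (@vsubmxK _ 1 k 1 v).
Qed.

Lemma measurable_uncons_cV k : measurable_fun setT (@uncons_cV k).
Proof.
apply/measurable_fun_pairP; split; first exact: measurable_coord.
apply: measurable_fun_mx => i j.
by under eq_fun do rewrite /= mxE; exact: measurable_coord.
Qed.

Section step.
Variables (k : nat) (mu : {sigma_finite_measure set 'cV[R]_k -> \bar R}).

Definition lebesgue_cV_step : set 'cV[R]_k.+1 -> \bar R :=
  pushforward (lebesgue_measure \x mu)%E (@cons_cV k).

Let step : {measure set 'cV[R]_k.+1 -> \bar R} :=
  measure_function_pushforward__canonical__measure_function_Measure
    (lebesgue_measure \x mu)%E (@measurable_cons_cV k).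

HB.instance Definition _ := isMeasure.Build _ _ _ lebesgue_cV_step
  (measure0 step) (measure_ge0 step) (@measure_semi_sigma_additive _ _ _ step).

Let sigma_finite_step : sigma_finite setT lebesgue_cV_step.
Proof.
have /sigma_finiteP[F [TF ndF Foo]] := sigma_finiteT (@lebesgue_measure R).
have /sigma_finiteP[G [TG ndG Goo]] := sigma_finiteT mu.
exists (fun i => @uncons_cV k @^-1` (F i `*` G i)).
  apply/esym; rewrite -subTset => v _.
  have [i _ Fi] : (\bigcup_i F i) (uncons_cV v).1 by rewrite -TF.
  have [j _ Gj] : (\bigcup_i G i) (uncons_cV v).2 by rewrite -TG.
  exists (maxn i j) => //; split.
    by move: Fi; exact/subsetPset/ndF/leq_maxl.
  by move: Gj; exact/subsetPset/ndG/leq_maxr.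
move=> i; have [mF Fi] := Foo i; have [mG Gi] := Goo i; split.
  rewrite -[X in measurable X]setTI.
  by apply: measurable_uncons_cV => //; exact: measurableX.
rewrite /lebesgue_cV_step /pushforward.
rewrite (_ : _ @^-1` _ = F i `*` G i); last first.
  rewrite -comp_preimage (_ : _ \o _ = id) ?preimage_id//.
  by apply/funext => xv; exact: cons_cVK.
by rewrite product_measure1E// lte_mul_pinfty// ge0_fin_numE.
Qed.

HB.instance Definition _ :=
  Measure_isSigmaFinite.Build _ _ _ lebesgue_cV_step sigma_finite_step.

End step.

Fixpoint lebesgue_cV k : {sigma_finite_measure set 'cV[R]_k -> \bar R} :=
  match k with
  | 0 => dirac (0 : 'cV[R]_0)
  | k'.+1 => lebesgue_cV_step (lebesgue_cV k')
  end.

End lebesgue_cV.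

Section euclidean.
Variable R : realType.

Definition norm2 k (v : 'cV[R]_k) : R := Num.sqrt (\sum_i v i 0 ^+ 2).

Definition opnorm2 k l (A : 'M[R]_(k, l)) : R :=
  sup [set norm2 (A *m v) | v in [set v | norm2 v <= 1]].

Definition sphere2 k : set 'cV[R]_k := [set v | norm2 v = 1].

Lemma measurable_norm2 k : measurable_fun setT (@norm2 k).
Proof.
apply: (@measurableT_comp _ _ _ _ _ _ (@Num.sqrt R)).
  by apply: continuous_measurable_fun; exact: sqrt_continuous.
apply: measurable_sum => i; apply: measurable_funX; exact: measurable_coord.
Qed.

Lemma measurable_ball2 k : measurable [set v : 'cV[R]_k | norm2 v <= 1].
Proof.
rewrite (_ : mkset _ = setT `&` @norm2 k @^-1` `]-oo, 1]); last first.
  by rewrite setTI; apply/seteqP; split=> v /=; rewrite in_itv.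
exact: measurable_norm2.
Qed.

(* 0 is sent to 0 *)
Definition normalize2 k (v : 'cV[R]_k) : 'cV[R]_k := (norm2 v)^-1 *: v.

Lemma measurable_normalize2 k : measurable_fun setT (@normalize2 k).
Proof.
apply: measurable_fun_mx => i j.
rewrite (_ : (fun _ => _) = (fun v => norm2 v `^ (-1) * v i j)); last first.
  by apply/funext => v; rewrite mxE powR_inv1// sqrtr_ge0.
apply: measurable_funM; last exact: measurable_coord.
by apply: (measurableT_comp (measurable_powR _)); exact: measurable_norm2.
Qed.

Definition radial_proj_ball k : set 'cV[R]_k -> \bar R :=
  pushforward (mrestr (lebesgue_cV R k) (@measurable_ball2 k)) (@normalize2 k).

Section radial_proj_ball.
Variable k : nat.

Let rpb : {measure set 'cV[R]_k -> \bar R} :=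
  measure_function_pushforward__canonical__measure_function_Measure
    (mrestr (lebesgue_cV R k) (@measurable_ball2 k)) (@measurable_normalize2 k).

HB.instance Definition _ := isMeasure.Build _ _ _ (@radial_proj_ball k)
  (measure0 rpb) (measure_ge0 rpb) (@measure_semi_sigma_additive _ _ _ rpb).

End radial_proj_ball.

(* Uniform probability measure on the unit sphere, as a measure on R^k carried
   by sphere2 (k > 0): the mass of A is the proportion of the unit ball lying
   in the cone spanned by A. The unit ball has positive finite volume, so
   that the default probability [dirac 0] is never selected. *)
Definition uniform_sphere k : probability 'cV[R]_k R :=
  mnormalize (@radial_proj_ball k) (dirac (0 : 'cV[R]_k)).

End euclidean.

Section differential_calculus.
Variable R : realType.

(* In finite dimension, continuity of y |-> 'd f y in operator norm is
   continuity of y |-> 'd f y v for every v. *)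
Definition C1_on (V : normedModType R) (A : set V) (f : V -> R) : Prop :=
  forall x, A x ->
    differentiable f x /\ forall v, {for x, continuous (fun y => 'd f y v)}.

(* Set to 0 where the (Frechet) derivative does not exist. *)
Definition grad n (f : 'cV[R]_n -> R) (x : 'cV[R]_n) : 'cV[R]_n :=
  if `[< differentiable f x >] then \col_i 'd f x (delta_mx i 0) else 0.

End differential_calculus.

Section vector_integral.
Context d (T : measurableType d) (R : realType).

Definition int_cV n (mu : {measure set T -> \bar R}) (D : set T)
    (F : T -> 'cV[R]_n) : 'cV[R]_n :=
  \col_i \int[mu]_(t in D) F t i 0.

(* Integrability with respect to the completion of mu: F is only required to be
   measurable after modification on a mu-negligible set. *)
Definition ae_integrable_cV n (mu : {measure set T -> \bar R}) (D : set T)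
    (F : T -> 'cV[R]_n) : Prop :=
  exists G : T -> 'cV[R]_n,
    (forall i, mu.-integrable D (fun t => (G t i 0)%:E)) /\
    {ae mu, forall t, D t -> F t = G t}.

End vector_integral.

Section probability_functions.
Variable R : realType.

Definition posdef m (S : 'M[R]_m) : Prop :=
  S^T = S /\ forall v : 'cV[R]_m, v != 0 -> 0 < (v^T *m S *m v) 0 0.

Definition cholesky_factor m (L S : 'M[R]_m) : Prop :=
  [/\ is_trig_mx L, forall i, 0 < L i i & L *m L^T = S].

Definition mvnormal_pdf m (mu : 'cV[R]_m) (S : 'M[R]_m) (z : 'cV[R]_m) : R :=
  (Num.sqrt ((2 * pi) ^+ m * \det S))^-1 *
  expR (- (2^-1 * ((z - mu)^T *m invmx S *m (z - mu)) 0 0)).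

Definition Gamma (s : R) : R :=
  \int[lebesgue_measure]_(t in `]0, +oo[) (t `^ (s - 1) * expR (- t)).

Definition chi_pdf (m : nat) (r : R) : R :=
  (2 `^ (m%:R / 2 - 1) * Gamma (m%:R / 2))^-1 *
  r ^+ m.-1 * expR (- (r ^+ 2 / 2)).

Variables (n m p : nat) (g : 'cV[R]_n * 'cV[R]_m -> R).
Variables (C : set 'cV[R]_p) (P : probability 'cV[R]_p R).
Variables (z : 'cV[R]_p -> 'cV[R]_m) (Sigma L : 'cV[R]_p -> 'M[R]_m).

Definition cond_prob_fun (c : 'cV[R]_p) (x : 'cV[R]_n) : R :=
  \int[lebesgue_cV R m]_(y in [set y | g (x, y) <= 0])
    mvnormal_pdf (z c) (Sigma c) y.

Definition prob_fun (x : 'cV[R]_n) : R :=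
  \int[P]_(c in C) cond_prob_fun c x.

Definition radial_prob_fun (c : 'cV[R]_p) (x : 'cV[R]_n) (v : 'cV[R]_m) : R :=
  \int[lebesgue_measure]_(r in
      [set r : R | 0 <= r /\ g (x, r *: (L c *m v) + z c) <= 0])
    chi_pdf m r.

Definition uniform_slater_point (xbar : 'cV[R]_n) : Prop :=
  exists (U : set 'cV[R]_n) (gamma0 : R),
    [/\ open U, U xbar, 0 < gamma0 &
      forall x, U x -> {ae P, forall c, C c -> g (x, z c) < - gamma0}].

Definition exponential_growth (xbar : 'cV[R]_n) : Prop :=
  exists eps a b : R, [/\ 0 < eps, 0 < a, 0 < b &
    forall x y, norm2 (x - xbar) < eps ->
      norm2 (grad (fun x' => g (x', y)) x) <= a * expR (b * norm2 y)].

Definition convex_snd : Prop :=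
  forall x, convex_function (setT : set (convex_lmodType 'cV[R]_m))
    (fun y => g (x, y)).

End probability_functions.

(* Main.v *)
From HB Require Import structures.
Require Import Defs.
From mathcomp Require Import all_boot all_order all_algebra.
From mathcomp Require Import all_classical all_reals all_analysis.
From mathcomp Require Import measurable_realfun ring lra.

Set Implicit Arguments.
Unset Strict Implicit.
Unset Printing Implicit Defensive.

Import Order.TTheory GRing.Theory Num.Theory.
Import numFieldNormedType.Exports.

Local Open Scope classical_set_scope.
Local Open Scope ring_scope.

(* In polar coordinates the standard Gaussian splits into the uniform law on the
   sphere and the chi law on rays, so pushing it through y = L(c) w + z(c) gives
   Phi(x) as the integral of e_c(x, v) over the sphere and C. Along a fixed ray,
   convexity and the Slater point make the feasible radii an interval [0, rho(x)],
   where rho is C^1 where it is finite because the slope of g at the exit radius is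
   at least gamma / rho; thus e = F(rho) for the chi distribution function F.
   Where rho is infinite, e is 1: the growth condition forces exp(- b rho(y)) =
   O(|y - x|) for y close to such an x, so the Gaussian tail makes both 1 - e and
   the derivative of e negligible. The resulting bound on the derivative of e_c is
   uniform in (v, c), and dominated convergence differentiates under the integral. *)

(** * Lebesgue measure on column vectors *)

(** Rays that never exit are the obstacle: at points near such a ray's parameter x the exit radius
    may blow up, and the only bound on its differential grows like rho exp (b rho), so the implicit
    function argument does not reach x. Differentiability there is proved by size alone. It then
    holds for every ray satisfying the Slater bound, with a neighborhood and a constant common to
    all of them; null sets enter only through the Slater condition and through the supports of the
    two laws. The rate b of the ray argument is the growth rate of g enlarged by the dimension and
    by [eta0], which bounds both |L(c) v| and |z(c)|; this is what makes the constants independent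
    of (v, c). The law on the sphere is a radial projection of the unit ball, so polar coordinates
    come from evaluating one integral over a vector and a radius in two ways, and the resulting
    constants are eliminated by testing with the function 1. Linear substitution is reduced to one
    coordinate at a time by the triangular shape of L(c). *)

Lemma ge0_integral_affine (R : realType) (f : R -> \bar R) (a b : R) : 0 < a ->
  measurable_fun setT f -> (forall x, 0 <= f x)%E ->
  (\int[lebesgue_measure]_x f x =
   a%:E * \int[lebesgue_measure]_x f (a * x + b)%R)%E.
Proof.
move=> a0 mf f0.
pose phi : measurableTypeR R -> measurableTypeR R := fun x => a * x + b.
have mphi : measurable_fun setT phi.
  by apply: measurable_funD => //; exact: measurable_funM.
have a0' : 0 <= a by exact: ltW.
pose nu : {measure set (measurableTypeR R) -> \bar R} :=
  measure_function_pushforward__canonical__measure_function_Measure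
    (mscale (NngNum a0') (@lebesgue_measure R)) mphi.
(* Lebesgue measure is determined by its values on half-open intervals, and the image of [a] times
   it under [phi] has the same values. *)
have nuE A : measurable A -> lebesgue_measure A = nu A.
  apply: lebesgue_measure_unique => _ [[u v] _ <-].
  rewrite /nu /= /pushforward /mscale /= (_ : phi @^-1` _ =
      `](u - b) / a, (v - b) / a]%classic); last first.
    apply/seteqP; split => x; rewrite /phi /= !in_itv /=.
      by move=> /andP[h1 h2]; rewrite ltr_pdivrMr// ler_pdivlMr// ltrBlDr lerBrDr mulrC h1 h2.
    by rewrite ltr_pdivrMr// ler_pdivlMr// ltrBlDr lerBrDr mulrC.
  rewrite !lebesgue_measure_itv /= !lte_fin ltr_pM2r ?invr_gt0// ltrD2r.
  case: ifP => _; last by rewrite mule0.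
  by rewrite -!EFinB -EFinM; congr EFin; field; rewrite gt_eqF.
rewrite (@eq_measure_integral _ _ _ setT nu lebesgue_measure f); last first.
  by move=> A mA _; exact: nuE.
rewrite ge0_integral_pushforward// preimage_setT ge0_integral_mscale//=.
by apply: measurableT_comp.
Qed.

Section measurable_matrices.
Context d (T : measurableType d) (R : realType).

Lemma measurable_mxE m n (f : T -> 'M[R]_(m, n)) i j :
  measurable_fun setT f -> measurable_fun setT (fun t => f t i j).
Proof. by move=> mf; exact: (measurableT_comp (measurable_coord i j) mf). Qed.

Lemma measurable_addmx m n (f g : T -> 'M[R]_(m, n)) :
  measurable_fun setT f -> measurable_fun setT g ->
  measurable_fun setT (fun t => f t + g t).
Proof.
move=> mf mg; apply: measurable_fun_mx => i j.
under eq_fun do rewrite mxE.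
by apply: measurable_funD; exact: measurable_mxE.
Qed.

Lemma measurable_scalemx m n (a : T -> R) (f : T -> 'M[R]_(m, n)) :
  measurable_fun setT a -> measurable_fun setT f ->
  measurable_fun setT (fun t => a t *: f t).
Proof.
move=> ma mf; apply: measurable_fun_mx => i j.
under eq_fun do rewrite mxE.
by apply: measurable_funM => //; exact: measurable_mxE.
Qed.

Lemma measurable_mulmx m n p (f : T -> 'M[R]_(m, n)) (g : T -> 'M[R]_(n, p)) :
  measurable_fun setT f -> measurable_fun setT g ->
  measurable_fun setT (fun t => f t *m g t).
Proof.
move=> mf mg; apply: measurable_fun_mx => i j.
under eq_fun do rewrite mxE.
by apply: measurable_sum => k; apply: measurable_funM; exact: measurable_mxE.
Qed.

End measurable_matrices.

Section lebesgue_cV_integral.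
Variable R : realType.
Local Open Scope ereal_scope.

Lemma ge0_integral_lebesgue_cVS k (f : 'cV[R]_k.+1 -> \bar R) :
  measurable_fun setT f -> (forall v, 0 <= f v) ->
  \int[lebesgue_cV R k.+1]_v f v =
  \int[lebesgue_measure]_x \int[lebesgue_cV R k]_w f (cons_cV (x, w)).
Proof.
move=> mf f0.
transitivity (\int[pushforward (lebesgue_measure \x lebesgue_cV R k)
    (@cons_cV R k)]_v f v).
  by [].
have mc := @measurable_cons_cV R k.
rewrite ge0_integral_pushforward// preimage_setT.
by rewrite fubini_tonelli1//; [exact: (measurableT_comp mf mc)|move=> x; exact: f0].
Qed.

Lemma measurable_integral_cons_cV k (f : 'cV[R]_k.+1 -> \bar R) :
  measurable_fun setT f -> (forall v, 0 <= f v) ->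
  measurable_fun setT (fun x => \int[lebesgue_cV R k]_w f (cons_cV (x, w))).
Proof.
move=> mf f0; apply: (@measurable_fun_fubini_tonelli_F _ _ _ _ _ (lebesgue_cV R k)
  (fun xw => f (cons_cV xw))); last by move=> x; exact: f0.
by apply: measurableT_comp => //; exact: measurable_cons_cV.
Qed.

(** Triangularity drives the induction: the upper right block of [L] vanishes, so the first
    coordinate of L w + z is affine in the first coordinate of w alone, and once that one is fixed
    the others undergo a triangular affine map with a shifted translation. Each step contributes one
    diagonal entry to the determinant. *)
Lemma ge0_integral_affine_cV k (f : 'cV[R]_k -> \bar R) (L : 'M[R]_k)
    (z : 'cV[R]_k) : is_trig_mx L -> (forall i, 0 < L i i)%R ->
  measurable_fun setT f -> (forall v, 0 <= f v) ->
  \int[lebesgue_cV R k]_v f v =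
  (\det L)%:E * \int[lebesgue_cV R k]_w f (L *m w + z)%R.
Proof.
elim: k f L z => [|k IH] f L z trL L0 mf f0.
  rewrite det_mx00 mul1e; apply: eq_integral => v _; congr f.
  by rewrite [RHS]flatmx0 [LHS]flatmx0.
rewrite !ge0_integral_lebesgue_cVS//; last first.
  apply: measurableT_comp => //; apply: measurable_addmx => //.
  exact: measurable_mulmx.
have detL : \det L = (L ord0 ord0 * \det (@drsubmx R 1 k 1 k L))%R.
  rewrite det_trig// big_ord_recl; congr (_ * _)%R.
  rewrite det_trig; first by apply: eq_bigr => i _; rewrite !mxE; congr (L _ _); exact/val_inj.
  apply/is_trig_mxP => i j ij; rewrite !mxE.
  by apply: (is_trig_mxP trL); rewrite /= ltn_add2l.
pose a := L ord0 ord0; pose L' := @drsubmx R 1 k 1 k L.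
pose z0 := z ord0 ord0; pose z' := @dsubmx R 1 k 1 z.
pose l := @dlsubmx R 1 k 1 k L.
have consE x w : (L *m cons_cV (x, w) + z =
    cons_cV (a * x + z0, L' *m w + (l *m x%:M + z')))%R.
  have := @mul_block_col R 1 k 1 k 1 (@ulsubmx R 1 k 1 k L)
    (@ursubmx R 1 k 1 k L) l L' x%:M w.
  rewrite submxK => E.
  have := @add_col_mx R 1 k 1 (@ulsubmx R 1 k 1 k L *m x%:M +
    @ursubmx R 1 k 1 k L *m w) (l *m x%:M + L' *m w) (@usubmx R 1 k 1 z) z'.
  rewrite vsubmxK -E => {}E.
  apply: (etrans E); rewrite /cons_cV /=.
  congr col_mx; last by rewrite addrAC addrC.
  have -> : @ursubmx R 1 k 1 k L = 0%R.
    apply/matrixP => i j; rewrite !mxE.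
    by apply: (is_trig_mxP trL); rewrite ord1.
  rewrite mul0mx addr0; apply/matrixP => i j; rewrite !ord1 !mxE big_ord1 !mxE/=.
  have e0 : lshift k (0 : 'I_1)%R = ord0 :> 'I_k.+1 by exact: val_inj.
  by rewrite !mulr1n !e0.
have trL'' : is_trig_mx L'.
  apply/is_trig_mxP => i j ij; rewrite !mxE.
  by apply: (is_trig_mxP trL); rewrite /= ltn_add2l.
have L'0 i : (0 < L' i i)%R by rewrite !mxE.
transitivity (a%:E * \int[lebesgue_measure]_x
     \int[lebesgue_cV R k]_w f (cons_cV (a * x + z0, w))%R).
  rewrite -(@ge0_integral_affine _
    (fun y => \int[lebesgue_cV R k]_w f (cons_cV (y, w))) a z0)//.
  - exact: L0.
  - exact: measurable_integral_cons_cV.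
  - by move=> x; exact: integral_ge0.
rewrite detL EFinM -muleA; congr (_ * _).
have mfc x : measurable_fun setT (fun w => f (cons_cV (x, w))).
  apply: measurableT_comp => //.
  by apply: measurableT_comp; [exact: measurable_cons_cV|exact: pair1_measurable].
have detL'0 : (0 <= \det L')%R.
  by rewrite det_trig//; apply: prodr_ge0 => i _; exact: ltW.
rewrite -ge0_integralZl//; first last.
- by move=> x _; exact: integral_ge0.
- apply: (@measurable_integral_cons_cV _ (fun v => f (L *m v + z)%R)) => //.
  apply: measurableT_comp => //; apply: measurable_addmx => //.
  exact: measurable_mulmx.
- apply: eq_integral => x _; under [in RHS]eq_integral do rewrite consE.
  exact: IH.
Qed.

End lebesgue_cV_integral.

(** * Polar coordinates for the Gaussian measure *)

Section gaussian_and_scaling.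
Variable R : realType.
Local Open Scope ereal_scope.

Lemma integral_expR_sqr_half :
  \int[lebesgue_measure]_x (expR (- (x ^+ 2 / 2)))%:E =
  (Num.sqrt (2 * pi))%:E :> \bar R.
Proof.
have s2 : (0 < Num.sqrt 2 :> R)%R by rewrite sqrtr_gt0.
rewrite (@ge0_integral_affine _ _ (Num.sqrt 2) 0%R)//; first last.
  apply/measurable_EFinP; apply: measurableT_comp => //.
  by apply: measurableT_comp => //; apply: measurable_funM.
rewrite sqrtrM// EFinM -integralT_gauss; congr (_ * _).
apply: eq_integral => x _; rewrite /gauss_fun addr0 exprMn sqr_sqrtr//.
by rewrite mulrC mulKf.
Qed.

Definition gauss_cV k (v : 'cV[R]_k) : R := expR (- (norm2 v ^+ 2 / 2)).

Lemma measurable_gauss_cV k : measurable_fun setT (@gauss_cV k).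
Proof.
apply: measurableT_comp => //; apply: measurableT_comp => //.
by apply: measurable_funM => //; apply: measurable_funX; exact: measurable_norm2.
Qed.

Lemma norm2_sqr k (v : 'cV[R]_k) : (norm2 v ^+ 2 = \sum_i v i 0 ^+ 2)%R.
Proof. by rewrite sqr_sqrtr// sumr_ge0// => i _; exact: sqr_ge0. Qed.

Lemma cons_cVE0 k (x : R) (w : 'cV[R]_k) : cons_cV (x, w) ord0 ord0 = x.
Proof. by have /(congr1 fst) := cons_cVK (x, w). Qed.

Lemma cons_cVES k (x : R) (w : 'cV[R]_k) i :
  cons_cV (x, w) (lift ord0 i) ord0 = w i ord0.
Proof.
have /(congr1 (fun u : R * 'cV[R]_k => u.2 i ord0)) := cons_cVK (x, w).
by rewrite /= mxE => <-; congr (cons_cV _ _ _); exact: val_inj.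
Qed.

Lemma gauss_cV_cons k x (w : 'cV[R]_k) :
  gauss_cV (cons_cV (x, w)) = (expR (- (x ^+ 2 / 2)) * gauss_cV w)%R.
Proof.
rewrite /gauss_cV -expRD -opprD -mulrDl !norm2_sqr big_ord_recl cons_cVE0.
by under eq_bigr do rewrite cons_cVES.
Qed.

Lemma integral_gauss_cV k :
  \int[lebesgue_cV R k]_v (gauss_cV v)%:E = (Num.sqrt (2 * pi) ^+ k)%:E.
Proof.
have mg j : measurable_fun setT (fun v : 'cV[R]_j => (gauss_cV v)%:E).
  by apply/measurable_EFinP; exact: measurable_gauss_cV.
have g0 j (v : 'cV[R]_j) : 0 <= (gauss_cV v)%:E by rewrite lee_fin expR_ge0.
elim: k => [|k IH].
  rewrite integral_dirac; last 2 first.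
  - exact: measurableT.
  - exact: mg.
  rewrite diracE in_setT mul1e.
  by rewrite expr0 /gauss_cV norm2_sqr big_ord0 mul0r oppr0 expR0.
rewrite ge0_integral_lebesgue_cVS// exprS EFinM -integral_expR_sqr_half.
rewrite -ge0_integralZr//.
- apply: eq_integral => x _; under eq_integral do rewrite gauss_cV_cons EFinM.
  rewrite ge0_integralZl; [by rewrite IH|by []|exact: mg|by move=> w _; exact: g0|].
  by rewrite lee_fin expR_ge0.
- apply/measurable_EFinP; apply: measurableT_comp => //.
  by apply: measurableT_comp => //; apply: measurable_funM.
Qed.

Lemma norm2_eq0 k (v : 'cV[R]_k) : (norm2 v == 0%R) = (v == 0%R).
Proof.
apply/idP/eqP => [/eqP v0|->]; last first.
  by rewrite /norm2 big1 ?sqrtr0// => i _; rewrite mxE expr0n.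
apply/matrixP => i j; rewrite ord1 mxE; apply/eqP; rewrite -sqrf_eq0.
have /eqP := norm2_sqr v; rewrite v0 expr0n eq_sym psumr_eq0//=.
  by move=> /allP /(_ i); rewrite mem_index_enum => /(_ isT).
by move=> l _; exact: sqr_ge0.
Qed.

Lemma norm2_ge0 k (v : 'cV[R]_k) : (0 <= norm2 v)%R.
Proof. exact: sqrtr_ge0. Qed.

Lemma norm2Z k a (v : 'cV[R]_k) : norm2 (a *: v) = (`|a| * norm2 v)%R.
Proof.
rewrite /norm2 -sqrtr_sqr -sqrtrM ?sqr_ge0// mulr_sumr.
by congr Num.sqrt; apply: eq_bigr => i _; rewrite mxE exprMn.
Qed.

Lemma measurable_set1_cV k : measurable [set (0%R : 'cV[R]_k)].
Proof.
rewrite (_ : [set _] = setT `&` @norm2 R k @^-1` [set 0%R]).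
  exact: measurable_norm2.
rewrite setTI; apply/seteqP; split => v /= /eqP; rewrite -?norm2_eq0 => /eqP//.
by move=> /eqP; rewrite norm2_eq0 => /eqP.
Qed.

(** Only the slice with first coordinate 0 meets the origin, and a single coordinate value is
    Lebesgue-null. The successor matters: in dimension 0 the measure is a Dirac mass at 0. *)
Lemma lebesgue_cV_set1 k : lebesgue_cV R k.+1 [set 0%R] = 0.
Proof.
have m1 := @measurable_set1_cV k.+1.
transitivity (\int[lebesgue_cV R k.+1]_v (\1_[set (0%R : 'cV[R]_k.+1)] v)%:E).
  by rewrite integral_indic// setIT.
rewrite ge0_integral_lebesgue_cVS//; last first.
  exact/measurable_EFinP/measurable_indic.
rewrite (_ : (fun _ => _) = (fun x => \int[lebesgue_cV R k]_w
    (\1_[set 0%R] (cons_cV (x, w)))%:E) \_ [set 0%R]).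
  by rewrite -integral_mkcond integral_set1.
apply/funext => x; rewrite patchE; case: ifPn => // /negP x0.
apply: integral0_eq => w _; rewrite indicE memNset// => /= cv0; apply: x0.
by rewrite inE /= -(cons_cVE0 x w) cv0 mxE.
Qed.

Lemma ge0_integral_scale k (r : R) (f : 'cV[R]_k -> \bar R) : (0 < r)%R ->
  measurable_fun setT f -> (forall v, 0 <= f v) ->
  \int[lebesgue_cV R k]_v f v =
  (r ^+ k)%:E * \int[lebesgue_cV R k]_w f (r *: w)%R.
Proof.
move=> r0 mf f0; rewrite (@ge0_integral_affine_cV _ _ _ r%:M 0%R)//.
- rewrite det_scalar; congr (_ * _).
  by apply: eq_integral => w _; rewrite mul_scalar_mx addr0.
- by move=> i; rewrite mxE eqxx mulr1n.
Qed.

(** [normalize2] has norm 1 only away from the origin, so polar identities between integrands hold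
    pointwise for v != 0 only. *)
Lemma ge0_integral_eq_off0 k (f g : 'cV[R]_k.+1 -> \bar R) :
  measurable_fun setT f -> measurable_fun setT g ->
  (forall v, 0 <= f v) -> (forall v, 0 <= g v) ->
  (forall v, v != 0%R -> f v = g v) ->
  \int[lebesgue_cV R k.+1]_v f v = \int[lebesgue_cV R k.+1]_v g v.
Proof.
move=> mf mg f0 g0 fg; apply: ge0_ae_eq_integral => //.
exists [set 0%R]; split; [exact: measurable_set1_cV|exact: lebesgue_cV_set1|].
move=> v /= nfg; apply: contrapT => v0; apply: nfg => _; apply: fg.
exact/eqP.
Qed.

End gaussian_and_scaling.

(** Inversion is discontinuous at 0; the product formula used instead stays true there because both
    sides are 0. *)
Lemma measurable_invr (R : realType) : measurable_fun setT (@GRing.inv R).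
Proof.
rewrite (_ : GRing.inv = fun x : R => x * (x ^+ 2) `^ (-1)); last first.
  apply/funext => x; rewrite powR_inv1 ?sqr_ge0//.
  by have [->|x0] := eqVneq x 0; [rewrite invr0 mul0r|field].
apply: measurable_funM => //; apply: (measurableT_comp (measurable_powR _)).
exact: measurable_funX.
Qed.

Section polar_coordinates.
Variables (R : realType) (k : nat).
Local Open Scope ereal_scope.

Let lam := lebesgue_cV R k.+1.
Let leb := @lebesgue_measure R.
Let pos : set R := `]0%R, +oo[%classic.
Let B : set 'cV[R]_k.+1 := [set v | norm2 v <= 1]%R.

Let measurable_pos : measurable pos. Proof. exact: measurable_itv. Qed.

Let measurable_1pos : measurable_fun setT (\1_pos : R -> R).
Proof. exact: measurable_indic. Qed.

Let measurable_1B : measurable_fun setT (\1_B : 'cV[R]_k.+1 -> R).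
Proof. by apply: measurable_indic; exact: measurable_ball2. Qed.

(* The sphere enters only through the projection of the unit ball B. Both sides are
   the integral over (v, r) of 1_B(v) |v|^(k+1) r^k f(r v), r > 0: the substitution
   r -> |v| r leads to the left-hand side, v -> r^-1 v followed by r = |v| s to the
   right-hand side. *)
Lemma polar_substitution (f : 'cV[R]_k.+1 -> \bar R) :
  measurable_fun setT f -> (forall v, 0 <= f v) ->
  \int[lam]_v ((\1_B v)%:E *
    \int[leb]_r ((\1_pos r * r ^+ k)%:E * f (r *: normalize2 v)%R)) =
  \int[leb]_s (\1_`[1%R, +oo[ s * s^-1 ^+ k.+2)%:E * \int[lam]_v f v.
Proof.
move=> mf f0.
pose Psi1 (vr : 'cV[R]_k.+1 * R) : \bar R :=
  (\1_B vr.1 * norm2 vr.1 ^+ k.+1 * (\1_pos vr.2 * vr.2 ^+ k))%:E *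
  f (vr.2 *: vr.1)%R.
pose Psi2 (vr : 'cV[R]_k.+1 * R) : \bar R :=
  (\1_B (vr.2^-1 *: vr.1)%R * norm2 vr.1 ^+ k.+1 *
   (\1_pos vr.2 * vr.2^-1 ^+ k.+2))%:E * f vr.1.
have mfst : measurable_fun setT (fst : 'cV[R]_k.+1 * R -> _) by exact: measurable_fst.
have msnd : measurable_fun setT (snd : 'cV[R]_k.+1 * R -> _) by exact: measurable_snd.
have mn : measurable_fun setT (fun vr : 'cV[R]_k.+1 * R => norm2 vr.1).
  by apply: measurableT_comp => //; exact: measurable_norm2.
have mpos : measurable_fun setT (fun vr : 'cV[R]_k.+1 * R => \1_pos vr.2 : R).
  exact: (measurableT_comp measurable_1pos).
have mV : measurable_fun setT (fun vr : 'cV[R]_k.+1 * R => vr.2^-1%R).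
  by apply: measurableT_comp => //; exact: measurable_invr.
have mPsi1 : measurable_fun setT Psi1.
  apply: emeasurable_funM.
    apply/measurable_EFinP; apply: measurable_funM; apply: measurable_funM.
    - exact: (measurableT_comp measurable_1B).
    - exact: measurable_funX.
    - exact: mpos.
    - exact: measurable_funX.
  by apply: measurableT_comp => //; exact: measurable_scalemx.
have mPsi2 : measurable_fun setT Psi2.
  apply: emeasurable_funM; last exact: measurableT_comp.
  apply/measurable_EFinP; apply: measurable_funM; apply: measurable_funM.
  - by apply: (measurableT_comp measurable_1B); exact: measurable_scalemx.
  - exact: measurable_funX.
  - exact: mpos.
  - exact: measurable_funX.
have posP r : r \in pos -> (0 < r)%R by rewrite inE /pos /= in_itv /= andbT.
have Psi1_ge0 vr : 0 <= Psi1 vr.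
  apply: mule_ge0; last exact: f0.
  rewrite lee_fin.
  have [r0|r0] := boolP (vr.2 \in pos); last first.
    by rewrite !indicE (negbTE r0) mul0r mulr0.
  have {}r0 := ltW (posP _ r0).
  rewrite !indicE; apply: mulr_ge0; apply: mulr_ge0; rewrite ?ler0n//.
    exact/exprn_ge0/norm2_ge0.
  exact: exprn_ge0.
have Psi2_ge0 vr : 0 <= Psi2 vr.
  apply: mule_ge0; last exact: f0.
  rewrite lee_fin.
  have [r0|r0] := boolP (vr.2 \in pos); last first.
    by rewrite !indicE (negbTE r0) mul0r mulr0.
  have {}r0 := ltW (posP _ r0).
  rewrite !indicE; apply: mulr_ge0; apply: mulr_ge0; rewrite ?ler0n//.
    exact/exprn_ge0/norm2_ge0.
  by apply: exprn_ge0; rewrite invr_ge0.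
pose h (v : 'cV[R]_k.+1) := \int[leb]_r ((\1_pos r * r ^+ k)%:E * f (r *: v)%R).
have mhr : measurable_fun setT (fun vr : 'cV[R]_k.+1 * R =>
    (\1_pos vr.2 * vr.2 ^+ k)%:E * f (vr.2 *: vr.1)%R).
  apply: emeasurable_funM.
    by apply/measurable_EFinP; apply: measurable_funM => //; exact: measurable_funX.
  by apply: measurableT_comp => //; exact: measurable_scalemx.
have hr0 v r : 0 <= (\1_pos r * r ^+ k)%:E * f (r *: v)%R.
  apply: mule_ge0; last exact: f0.
  rewrite lee_fin.
  have [r0|r0] := boolP (r \in pos); last by rewrite indicE (negbTE r0) mul0r.
  by rewrite mulr_ge0// exprn_ge0// ltW// posP.
have mh : measurable_fun setT h.
  apply: (@measurable_fun_fubini_tonelli_F _ _ _ _ _ leb _ mhr).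
  by move=> [v r]; exact: hr0.
have h0 v : 0 <= h v by apply: integral_ge0 => r _; exact: hr0.
have pair1 v : measurable_fun setT (fun r : R => (v, r) : 'cV[R]_k.+1 * R).
  exact: pair1_measurable.
have pair2 r : measurable_fun setT (fun v : 'cV[R]_k.+1 => (v, r) : 'cV[R]_k.+1 * R).
  exact: pair2_measurable.
transitivity (\int[lam]_v \int[leb]_r Psi1 (v, r)).
  apply: ge0_integral_eq_off0.
  - apply: emeasurable_funM; first exact/measurable_EFinP.
    by apply: (measurableT_comp mh); exact: measurable_normalize2.
  - exact: (@measurable_fun_fubini_tonelli_F _ _ _ _ _ leb _ mPsi1).
  - by move=> v; apply: mule_ge0 => //; exact: h0.
  - by move=> v; exact: integral_ge0.
  - move=> v v0.
    have nv0 : (0 < norm2 v)%R by rewrite lt_neqAle norm2_ge0 eq_sym norm2_eq0 v0.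
    have hE : h (normalize2 v) = (norm2 v)%:E *
        \int[leb]_r ((\1_pos r * (norm2 v * r) ^+ k)%:E * f (r *: v)%R).
      rewrite /h (@ge0_integral_affine _ _ (norm2 v) 0%R)//; last first.
        exact: (measurableT_comp mhr (pair1 _)).
      congr (_ * _); apply: eq_integral => r _.
      rewrite addr0 scalerA mulrAC mulfV ?gt_eqF// mul1r; congr (_ * _).
      congr ((_ * _)%:E); rewrite !indicE; congr ((nat_of_bool _)%:R).
      by apply/idP/idP; rewrite !inE /pos /= !in_itv /= !andbT pmulr_rgt0.
    rewrite -/(h _) hE muleA -EFinM -ge0_integralZl//; first last.
    - by rewrite lee_fin mulr_ge0 ?norm2_ge0// indicE ler0n.
    - move=> r _; apply: mule_ge0; last exact: f0.
      rewrite lee_fin exprMn mulrCA mulr_ge0 ?exprn_ge0 ?norm2_ge0//.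
      have [r0|r0] := boolP (r \in pos); last by rewrite indicE (negbTE r0) mul0r.
      by rewrite indicE mulr_ge0 ?ler0n// exprn_ge0// ltW// posP.
    - apply: emeasurable_funM.
        apply/measurable_EFinP; apply: measurable_funM => //.
        by apply: measurable_funX; exact: measurable_funM.
      by apply: measurableT_comp => //; exact: measurable_scalemx.
    apply: eq_integral => r _; rewrite muleA -EFinM /Psi1 /=.
    by congr (_%:E * _); rewrite exprMn [(norm2 v ^+ k.+1)%R]exprS; ring.
rewrite (@fubini_tonelli _ _ _ _ _ lam leb Psi1)//.
(* Origin of the exponent k + 2: scaling v by 1 / r costs r^-(k+1), the factor |v|^(k+1) gives
   another r^-(k+1), and r^k is already present. *)
transitivity (\int[leb]_r \int[lam]_v Psi2 (v, r)).
  apply: eq_integral => r _.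
  have [r0|r0] := boolP (r \in pos); last first.
    rewrite !integral0_eq// => v _;
      by rewrite /Psi1 /Psi2 /= !indicE (negbTE r0) mul0r mulr0 mul0e.
  have {}r0 := posP _ r0.
  have mPsi1r : measurable_fun setT (fun v : 'cV[R]_k.+1 => Psi1 ((r^-1 *: v)%R, r)).
    apply: (measurableT_comp mPsi1) => /=.
    apply/measurable_fun_pairP; split; last exact: measurable_cst.
    exact: measurable_scalemx.
  have rE : (r ^- k.+1)%:E * (r ^+ k.+1)%:E = 1 :> \bar R.
    by rewrite -EFinM mulVf// expf_neq0// gt_eqF.
  transitivity ((r ^- k.+1)%:E * \int[lam]_v Psi1 ((r^-1 *: v)%R, r)).
    have -> : \int[lam]_v Psi1 ((r^-1 *: v)%R, r) =
        (r ^+ k.+1)%:E * \int[lam]_v Psi1 (v, r).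
      rewrite (ge0_integral_scale r0 mPsi1r); last by move=> v; exact: Psi1_ge0.
      under eq_integral do rewrite scalerA mulVf ?gt_eqF// scale1r.
      by [].
    by rewrite muleA rE mul1e.
  rewrite -ge0_integralZl//; last by rewrite lee_fin invr_ge0 exprn_ge0// ltW.
  apply: eq_integral => v _; rewrite /Psi1 /Psi2 /= muleA -EFinM.
  rewrite scalerA mulfV ?gt_eqF// scale1r norm2Z gtr0_norm ?invr_gt0//.
  congr (_%:E * _); rewrite exprMn !exprVn !exprS.
  have rk0 : (r ^+ k != 0)%R by rewrite expf_neq0// gt_eqF.
  have rn0 : (r != 0)%R by rewrite gt_eqF.
  move: (r ^+ k)%R rk0 (norm2 v ^+ k)%R => rk rk0 nk.
  by field; rewrite rn0 rk0.
rewrite -(@fubini_tonelli _ _ _ _ _ lam leb Psi2)//.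
have mK : measurable_fun setT
    (fun s : R => (\1_`[1%R, +oo[ s * s^-1 ^+ k.+2)%:E).
  apply/measurable_EFinP; apply: measurable_funM.
    by apply: measurable_indic; exact: measurable_itv.
  by apply: measurable_funX; exact: measurable_invr.
have K0 (s : R) : 0 <= (\1_`[1%R, +oo[ s * s^-1 ^+ k.+2)%:E.
  rewrite lee_fin indicE; have [|_] := boolP (s \in _); last by rewrite mul0r.
  rewrite inE /= in_itv /= andbT => s1.
  by rewrite mul1r exprn_ge0// invr_ge0 (le_trans ler01).
rewrite -ge0_integralZl//; last exact: integral_ge0.
apply: ge0_integral_eq_off0 => //.
- exact: (@measurable_fun_fubini_tonelli_F _ _ _ _ _ leb _ mPsi2).
- exact: emeasurable_funM.
- by move=> v; exact: integral_ge0.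
- by move=> v; apply: mule_ge0 => //; exact: integral_ge0.
- move=> v v0.
  have nv0 : (0 < norm2 v)%R by rewrite lt_neqAle norm2_ge0 eq_sym norm2_eq0 v0.
  rewrite (@ge0_integral_affine _ _ (norm2 v) 0%R)//; last first.
    exact: (measurableT_comp mPsi2 (pair1 _)).
  rewrite -ge0_integralZl//; first last.
  - by rewrite lee_fin ltW.
  - apply: (measurableT_comp mPsi2); apply: (measurableT_comp (pair1 v)).
    by apply: measurable_funD => //; exact: measurable_funM.
  rewrite muleC -ge0_integralZl//.
  apply: eq_integral => s _; rewrite /Psi2 /= muleA -EFinM [RHS]muleC.
  congr (_%:E * _); rewrite addr0.
  rewrite !indicE.
  have nv1 : (norm2 v != 0)%R by rewrite gt_eqF.
  have normE : (0 < s)%R -> norm2 ((norm2 v * s)^-1 *: v) = s^-1%R.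
    move=> s0; rewrite norm2Z gtr0_norm ?invr_gt0 ?mulr_gt0//.
    by rewrite invfM mulrAC mulVf// mul1r.
  (* After r = |v| s the vector v / r has norm 1 / s, so it lies in the ball exactly when s >= 1;
     the powers of |v| cancel. *)
  have [s1|s1] := lerP 1%R s.
    have s0 : (0 < s)%R by rewrite (lt_le_trans ltr01).
    rewrite (@mem_set _ B); last by rewrite /B /= normE// invf_le1.
    rewrite (@mem_set _ pos); last by rewrite /pos /= in_itv /= andbT mulr_gt0.
    rewrite (@mem_set _ `[1%R, +oo[%classic); last by rewrite /= in_itv /= s1.
    rewrite !mul1r invfM exprMn mulrA -exprS mulrA -exprMn mulfV//.
    by rewrite expr1n mul1r.
  rewrite [in RHS]memNset ?mul0r; last by rewrite /= in_itv /= leNgt s1.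
  have [s0|s0] := ltP 0%R s.
    rewrite (@memNset _ B) ?mul0r ?mulr0// /B /= normE//.
    by apply/negP; rewrite -ltNge invf_gt1.
  rewrite (@memNset _ pos) ?mul0r ?mulr0// /pos /= in_itv /= andbT.
  by apply/negP; rewrite pmulr_rgt0// -leNgt.
Qed.

End polar_coordinates.

(** * The chi density: normalizing constant and exponential moments *)

Section chi_normalization.
Variable R : realType.

(** Since r <= 1 + r <= exp r, the power is at most exp (k r), and (k + c - r)^2 >= 0 bounds the
    exponent. The free rate [c] lets the Gaussian factor absorb any exponential. *)
Lemma pow_gauss_le k (c r : R) : 0 <= r ->
  r ^+ k * expR (- (r ^+ 2 / 2)) <=
  expR ((k%:R + c) ^+ 2 / 2) * expR (- (c * r)).
Proof.
move=> r0; apply: (@le_trans _ _ (expR (k%:R * r) * expR (- (r ^+ 2 / 2)))).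
  rewrite ler_wpM2r ?expR_ge0// expRM_natl lerXn2r ?nnegrE ?expR_ge0//.
  by rewrite (le_trans _ (expR_ge1Dx r))// lerDr.
rewrite -!expRD ler_expR; have := sqr_ge0 (k%:R + c - r).
by rewrite !expr2; lra.
Qed.

Let F (t : R) := Num.sqrt 2 * t `^ 2^-1.

Let is_derive_F (t : R) : 0 < t ->
  is_derive t 1 F (Num.sqrt 2 * (2^-1 * t `^ (2^-1 - 1))).
Proof.
move=> t0; have H := is_derive1_powR 2^-1 t0.
exact: is_deriveZ.
Qed.

Let derive1_F (t : R) : 0 < t -> derive1 F t = Num.sqrt 2 * (2^-1 * t `^ (2^-1 - 1)).
Proof. by move=> t0; rewrite derive1E; have [_ ->] := is_derive_F t0. Qed.

Let G k (r : R) := r ^+ k * expR (- (r ^+ 2 / 2)).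

Let continuous_G k : continuous (G k).
Proof.
move=> r; apply: (@continuousM _ R^o (fun r => r ^+ k)
  (fun r => expR (- (r ^+ 2 / 2)))); first exact: exprn_continuous.
apply: (@continuous_comp _ _ _ (fun r : R => - (r ^+ 2 / 2)) expR); last first.
  exact: continuous_expR.
apply: (@continuousN _ R^o _ (fun r : R => r ^+ 2 / 2)).
apply: (@continuousM _ R^o (fun r => r ^+ 2) (fun=> 2^-1)); last exact: cvg_cst.
exact: exprn_continuous.
Qed.

Let GF k (t : R) : 0 < t ->
  G k (F t) * derive1 F t =
  2 `^ (k.+1%:R / 2 - 1) * (t `^ (k.+1%:R / 2 - 1) * expR (- t)).
Proof.
move=> t0; rewrite derive1_F// /G /F.
have -> : (Num.sqrt 2 * t `^ 2^-1) ^+ 2 / 2 = t.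
  rewrite exprMn sqr_sqrtr// -powR_mulrn ?powR_ge0// -powRrM mulVf//.
  by rewrite powRr1 ?ltW// mulrAC divff// mul1r.
rewrite -powR12_sqrt// exprMn -!powR_mulrn ?powR_ge0// -!powRrM.
have e : k.+1%:R / 2 - 1 = (2^-1 * k%:R + 2^-1) - 1 :> R.
  by rewrite -natr1; field.
have pD (x a b : R) : 0 < x -> x `^ (a + b) = x `^ a * x `^ b.
  by move=> x0; rewrite powRD// (gt_eqF x0) implybT.
rewrite e (pD 2 _ (-1))// (pD 2)// powR_inv1// -addrA (pD t (2^-1 * k%:R))//.
move: (2 `^ _) (2 `^ _) (t `^ _) (t `^ _) (expR _) => A B X D E.
by field.
Qed.

(* Substitution r = sqrt (2 t), carried out on [1/n, +oo[ because it is not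
   differentiable at 0. *)
Lemma integral_chi_Gamma k :
  (\int[lebesgue_measure]_(r in `]0%R, +oo[) (G k r)%:E =
   (2 `^ (k.+1%:R / 2 - 1))%:E *
   \int[lebesgue_measure]_(t in `]0%R, +oo[)
      (t `^ (k.+1%:R / 2 - 1) * expR (- t))%:E)%E.
Proof.
pose a (n : nat) : R := n.+1%:R^-1.
have a0 n : 0 < a n by rewrite invr_gt0.
have homoF (x y : R) : 0 <= x -> x < y -> F x < F y.
  move=> x0 xy; rewrite /F ltr_pM2l ?sqrtr_gt0// gt0_ltr_powR// ?nnegrE//.
  by rewrite (le_trans x0)// ltW.
have F0 : F 0 = 0 by rewrite /F powR0// mulr0.
have Fa0 n : 0 < F (a n) by rewrite -F0 homoF.
have cvgF (x : R) : 0 < x -> F y @[y --> x] --> F x.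
  move=> x0; apply: differentiable_continuous; apply/derivable1_diffP.
  by have [] := is_derive_F x0.
have Fy : F x @[x --> +oo] --> +oo.
  apply/cvgryPge => A; near=> x.
  have x0 : 0 < x by near: x; exact: nbhs_pinfty_gt.
  have Ax : A ^+ 2 <= x by near: x; apply: nbhs_pinfty_ge; exact: num_real.
  apply: (le_trans (ler_norm A)).
  rewrite -sqrtr_sqr /F (powR12_sqrt (ltW x0)).
  apply: (le_trans (ler_wsqrtr Ax)); rewrite ler_peMl ?sqrtr_ge0//.
  by rewrite -[leLHS]sqrtr1 ler_wsqrtr// ler1n.
(* F^2 = 2 t gives F' = 1 / F, which turns the continuity and limit conditions on F' in the
   substitution rule into statements about F. *)
have dF (x : R) : 0 < x -> derive1 F x = (F x)^-1.
  move=> x0; rewrite derive1_F// /F -[in RHS]powR12_sqrt//.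
  have -> : 2^-1 - 1 = - 2^-1 :> R by field.
  rewrite powRN invfM mulrA -powR12_sqrt//; congr (_ / _).
  have s0 : 2 `^ 2^-1 != 0 :> R by rewrite gt_eqF// powR_gt0.
  apply: (mulIf s0); rewrite mulVf// mulrAC -expr2 powR12_sqrt// sqr_sqrtr//.
  by rewrite divff.
have aa n m : (n <= m)%N -> a m <= a n.
  by move=> nm; rewrite /a lef_pV2 ?posrE// ler_nat ltnS.
have cvgdF (x : R) : 0 < x -> derive1 F y @[y --> x] --> (F x)^-1.
  move=> x0; have Fx0 : F x != 0 by rewrite gt_eqF// -F0 homoF.
  apply: (cvg_trans _ (cvgV Fx0 (cvgF x x0))); apply: near_eq_cvg; near=> y.
  rewrite dF//; near: y; exact: lt_nbhsr.
have mG' : measurable_fun setT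
    (fun t : R => (t `^ (k.+1%:R / 2 - 1) * expR (- t))%:E).
  apply/measurable_EFinP; apply: measurable_funM.
    exact: measurable_powR.
  by apply: measurableT_comp => //; exact: measurableT_comp.
have step n : (\int[lebesgue_measure]_(r in `[F (a n), +oo[) (G k r)%:E =
   (2 `^ (k.+1%:R / 2 - 1))%:E * \int[lebesgue_measure]_(t in `[a n, +oo[)
      (t `^ (k.+1%:R / 2 - 1) * expR (- t))%:E)%E.
  have ge0t (t : R) : `[a n, +oo[%classic t -> 0 < t.
    by rewrite /= in_itv /= andbT; exact: lt_le_trans.
  rewrite increasing_ge0_integration_by_substitutiony//.
  - rewrite -ge0_integralZl//.
    + apply: eq_integral => t; rewrite inE => /ge0t t0.
      by rewrite -EFinM -GF// mulrC.
    + exact: measurable_funTS.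
    + by move=> t _; rewrite lee_fin mulr_ge0 ?powR_ge0 ?expR_ge0.
  - move=> x y; rewrite !in_itv /= !andbT => ax _; apply: homoF.
    exact: le_trans (ltW (a0 n)) ax.
  - move=> x; rewrite in_itv /= andbT => ax.
    have x0 := lt_trans (a0 n) ax.
    by rewrite /continuous_at dF//; exact: cvgdF.
  - apply/cvg_ex; exists (F (a n))^-1; apply: cvg_at_right_filter.
    exact: cvgdF.
  - apply/cvg_ex; exists 0.
    have Fpos : \forall x \near +oo, 0 < F x.
      near=> x; rewrite -F0 homoF//; near: x; exact: nbhs_pinfty_gt.
    apply: (cvg_trans _ ((gtr0_cvgV0 Fpos).2 Fy)); apply: near_eq_cvg; near=> y.
    by rewrite dF//; near: y; exact: nbhs_pinfty_gt.
  - split.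
      move=> x; rewrite in_itv /= andbT => ax.
      by have [] := is_derive_F (lt_trans (a0 n) ax).
    by apply: cvg_at_right_filter; exact: cvgF.
  - exact: continuous_subspaceT.
  - move=> x; rewrite in_itv /= andbT => Fx.
    by rewrite mulr_ge0 ?expR_ge0// exprn_ge0// ltW// (lt_trans (Fa0 n)).
have mG : measurable_fun setT (fun r : R => (G k r)%:E).
  apply/measurable_EFinP; exact: continuous_measurable_fun.
have bigcupE (u : nat -> R) : (forall n, 0 < u n) -> u n @[n --> \oo] --> 0 ->
    \bigcup_n `[u n, +oo[%classic = `]0, +oo[%classic.
  move=> u0 cu; apply/seteqP; split => x.
    move=> [n _] /=; rewrite !in_itv /= !andbT; exact: lt_le_trans.
  rewrite /= in_itv /= andbT => x0.
  have /cvgrPdist_lt/(_ _ x0) [N _ /(_ N (leqnn N)) /=] := cu.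
  rewrite sub0r normrN gtr0_norm// => uNx; exists N => //=.
  by rewrite in_itv /= andbT ltW.
have ca : a n @[n --> \oo] --> 0 by exact: cvg_harmonic.
have cFa : F (a n) @[n --> \oo] --> 0.
  rewrite -[X in _ --> X](mulr0 (Num.sqrt 2)) /F.
  under eq_fun do rewrite powR12_sqrt ?ltW//.
  apply: cvgMl_tmp; rewrite -[X in _ --> X](sqrtr0 R).
  by apply: continuous_cvg => //; exact: sqrt_continuous.
have homo_itv (u : nat -> R) : (forall n m, (n <= m)%N -> u m <= u n) ->
    nondecreasing_seq (fun n => `[u n, +oo[%classic).
  move=> uu n m nm; apply/subsetPset => x /=; rewrite !in_itv /= !andbT.
  by apply: le_trans; exact: uu.
(* The endpoints [a n] and [F (a n)] decrease to 0, so both sides of [step] converge monotonically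
   to the integrals over ]0, +oo[. *)
have cL : (\int[lebesgue_measure]_(r in `[F (a n), +oo[) (G k r)%:E)%E
    @[n --> \oo] --> (\int[lebesgue_measure]_(r in `]0%R, +oo[) (G k r)%:E)%E.
  rewrite -(bigcupE _ Fa0 cFa); apply: ge0_nondecreasing_set_cvg_integral => //.
  - apply: homo_itv => n m nm; rewrite /F ler_wpM2l ?sqrtr_ge0//.
    by apply: ge0_ler_powR; rewrite ?nnegrE ?(ltW (a0 _)) ?aa ?invr_ge0.
  - by move=> n; exact: measurable_funTS.
  - move=> n x; rewrite /= in_itv /= andbT => Fx.
    by rewrite lee_fin mulr_ge0 ?expR_ge0// exprn_ge0// ltW// (lt_le_trans (Fa0 n)).
rewrite (funext step) in cL; apply: (cvg_unique _ cL) => //.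
apply: cvgeZl => //; rewrite -(bigcupE _ a0 ca).
apply: ge0_nondecreasing_set_cvg_integral => //.
- exact: homo_itv.
- by move=> n; exact: measurable_funTS.
- by move=> n x _; rewrite lee_fin mulr_ge0 ?powR_ge0 ?expR_ge0.
Unshelve. all: by end_near.
Qed.

End chi_normalization.

Section chi_distribution.
Variable R : realType.

(** [pow_gauss_le] at rate c + 1 instead of c leaves a factor exp (- r), the density of an
    exponential law. *)
Lemma chi_integral_lt_pinfty k (c : R) :
  (\int[lebesgue_measure]_(r in `]0%R, +oo[)
     (r ^+ k * expR (- (r ^+ 2 / 2)) * expR (c * r))%:E < +oo)%E.
Proof.
have mf : measurable_fun setT
    (fun r : R => r ^+ k * expR (- (r ^+ 2 / 2)) * expR (c * r)).
  apply: measurable_funM; last first.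
    by apply: measurableT_comp => //; exact: measurable_funM.
  apply: measurable_funM; first exact: measurable_funX.
  apply: measurableT_comp => //; apply: measurableT_comp => //.
  by apply: measurable_funM => //; exact: measurable_funX.
pose M := expR ((k%:R + (c + 1)) ^+ 2 / 2).
apply: (@le_lt_trans _ _ (M%:E * \int[lebesgue_measure]_r (exponential_pdf 1 r)%:E)%E).
  have mexp : measurable_fun setT (fun r : R => (exponential_pdf 1 r)%:E).
    by apply/measurable_EFinP; exact: measurable_exponential_pdf.
  rewrite -ge0_integralZl//; last 2 first.
  - by move=> r _; rewrite lee_fin exponential_pdf_ge0.
  - by rewrite lee_fin expR_ge0.
  rewrite [leLHS]integral_mkcond; apply: ge0_le_integral => //.
  - move=> r _; apply: erestrict_ge0 => {}r /=; rewrite in_itv /= andbT => r0.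
    by rewrite lee_fin !mulr_ge0 ?expR_ge0// exprn_ge0// ltW.
  - apply/(measurable_restrictT _ _).1 => //.
    by apply: measurable_funTS; exact/measurable_EFinP.
  - by apply: measurable_funeM.
  move=> r _; rewrite patchE; case: ifPn => [|_]; last first.
    by rewrite mule_ge0// lee_fin ?expR_ge0 ?exponential_pdf_ge0.
  rewrite inE /= in_itv /= andbT => r0; rewrite -EFinM lee_fin.
  rewrite (exponential_pdfE _ (ltW r0)) mul1r.
  apply: (le_trans (ler_wpM2r (expR_ge0 _) (pow_gauss_le k (c + 1) (ltW r0)))).
  rewrite -mulrA -expRD -/M ler_wpM2l ?expR_ge0//.
  by rewrite ler_expR; lra.
by rewrite integral_exponential_pdf// mule1 ltry.
Qed.

Lemma measurable_chi_pdf m : measurable_fun setT (@chi_pdf R m).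
Proof.
rewrite /chi_pdf; apply: measurable_funM.
  by apply: measurable_funM => //; exact: measurable_funX.
apply: measurableT_comp => //; apply: measurableT_comp => //.
by apply: measurable_funM => //; exact: measurable_funX.
Qed.

Lemma ge0_chi_integral k : (0 <= \int[lebesgue_measure]_(r in `]0%R, +oo[)
     (r ^+ k * expR (- (r ^+ 2 / 2)) : R)%:E)%E.
Proof.
apply: integral_ge0 => r /=; rewrite in_itv /= andbT => r0.
by rewrite lee_fin mulr_ge0 ?expR_ge0// exprn_ge0// ltW.
Qed.

Lemma chi_integral_fin_num k : (\int[lebesgue_measure]_(r in `]0%R, +oo[)
     (r ^+ k * expR (- (r ^+ 2 / 2)) : R)%:E)%E \is a fin_num.
Proof.
rewrite ge0_fin_numE ?ge0_chi_integral//.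
have := chi_integral_lt_pinfty k 0; congr (_ < _)%E.
by apply: eq_integral => r _; rewrite mul0r expR0 mulr1.
Qed.

(** Eliminates [Gamma]: by [integral_chi_Gamma] the constant is the mass of the unnormalized
    density, the form in which it cancels later. *)
Lemma chi_pdfE k (r : R) : chi_pdf k.+1 r =
  (fine (\int[lebesgue_measure]_(r in `]0%R, +oo[)
     (r ^+ k * expR (- (r ^+ 2 / 2)))%:E)%E)^-1 * (r ^+ k * expR (- (r ^+ 2 / 2))).
Proof.
rewrite /chi_pdf -mulrA; congr (_^-1 * _).
have := chi_integral_fin_num k; rewrite integral_chi_Gamma /Gamma /Rintegral.
set J := (\int[_]_(_ in _) _)%E => fJ.
have J0 : (0 <= J)%E.
  by apply: integral_ge0 => t _; rewrite lee_fin mulr_ge0 ?powR_ge0 ?expR_ge0.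
have c0 : 0 < 2 `^ (k.+1%:R / 2 - 1) :> R by rewrite powR_gt0.
(* [Gamma] is [fine] of an extended integral and would be 0 if that integral were infinite;
   finiteness of [J] is read off the finite left-hand side of [integral_chi_Gamma]. *)
suff /fineK <- : J \is a fin_num by [].
rewrite ge0_fin_numE// ltNge leye_eq; apply/negP => /eqP Jy.
by move: fJ; rewrite Jy gt0_muley ?lte_fin.
Qed.

End chi_distribution.

Lemma measurable_ray_integral (R : realType) k (phi : R -> R)
    (F : 'cV[R]_k -> \bar R) :
  measurable_fun setT phi -> (forall r, 0 <= phi r) ->
  measurable_fun setT F -> (forall v, 0 <= F v)%E ->
  measurable_fun setT
    (fun v : 'cV[R]_k => \int[lebesgue_measure]_r ((phi r)%:E * F (r *: v)%R))%E.
Proof.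
move=> mphi phi0 mF F0.
apply: (@measurable_fun_fubini_tonelli_F _ _ _ _ _ lebesgue_measure (fun vr : 'cV[R]_k * R =>
  (phi vr.2)%:E * F (vr.2 *: vr.1)%R)%E).
  apply: emeasurable_funM.
    by apply/measurable_EFinP; apply: (measurableT_comp mphi); exact: measurable_snd.
  apply: measurableT_comp => //.
  by apply: measurable_scalemx; [exact: measurable_snd|exact: measurable_fst].
by move=> [v r]; apply: mule_ge0 => //; rewrite lee_fin.
Qed.

(** * The Gaussian measure as the uniform law on the sphere times the chi law *)

Section uniform_sphere_decomposition.
Variables (R : realType) (k : nat).
Local Open Scope ereal_scope.

Let lam := lebesgue_cV R k.+1.
Let leb := @lebesgue_measure R.
Let pos : set R := `]0%R, +oo[%classic.
Let B : set 'cV[R]_k.+1 := [set v | norm2 v <= 1]%R.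
(** [V], [I] and [K] are the volume of the ball, the chi mass and the constant produced by
    [polar_substitution]. They are tied together by [ball_chi] rather than evaluated. *)
Let V := lam B.
Let I := \int[leb]_(r in pos) (r ^+ k * expR (- (r ^+ 2 / 2)))%:E.
Let K := \int[leb]_s (\1_`[1%R, +oo[ s * s^-1 ^+ k.+2)%:E.
Let cst_gauss : R := (Num.sqrt (2 * pi) ^+ k.+1)%R.

Lemma ge0_integral_radial_proj_ball (H : 'cV[R]_k.+1 -> \bar R) :
  measurable_fun setT H -> (forall v, 0 <= H v) ->
  \int[@radial_proj_ball R k.+1]_v H v =
  \int[lam]_v ((\1_B v)%:E * H (normalize2 v)).
Proof.
move=> mH H0; have mB : measurable B := @measurable_ball2 R k.+1.
have mHn : measurable_fun setT (H \o @normalize2 R k.+1).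
  by apply: measurableT_comp => //; exact: measurable_normalize2.
pose nu : {measure set 'cV[R]_k.+1 -> \bar R} := mrestr lam (@measurable_ball2 R k.+1).
transitivity (\int[nu]_v (H \o @normalize2 R k.+1) v).
  rewrite -[in RHS](preimage_setT (@normalize2 R k.+1)).
  exact: (@ge0_integral_pushforward _ _ _ _ _ _ (@measurable_normalize2 R k.+1)
    nu setT H measurableT mH (fun y _ => H0 y)).
have nuC : nu (~` B) = 0 by rewrite /nu /= /mrestr setICl measure0.
rewrite (@ge0_negligible_integral _ _ _ nu setT (~` B) (H \o @normalize2 R k.+1)
  (measurableC mB) measurableT mHn (fun v _ => H0 _) nuC) setTD setCK.
transitivity (\int[lam]_(v in B) H (normalize2 v)).
  by apply: eq_measure_integral => A mA AB; congr (lam _); exact: setIidl.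
rewrite integral_mkcond; apply: eq_integral => v _.
by rewrite patchE indicE; case: ifPn; rewrite ?mul1e ?mul0e.
Qed.

Let gauss0 (v : 'cV[R]_k.+1) : 0 <= (gauss_cV v)%:E.
Proof. by rewrite lee_fin expR_ge0. Qed.

Let mgauss : measurable_fun setT (fun v : 'cV[R]_k.+1 => (gauss_cV v)%:E).
Proof. by apply/measurable_EFinP; exact: measurable_gauss_cV. Qed.

Let mchi : measurable_fun setT
  (fun r : R => (\1_pos r * (r ^+ k * expR (- (r ^+ 2 / 2))))%R).
Proof.
apply: measurable_funM; first by apply: measurable_indic; exact: measurable_itv.
apply: measurable_funM; first exact: measurable_funX.
apply: measurableT_comp => //; apply: measurableT_comp => //.
by apply: measurable_funM => //; exact: measurable_funX.
Qed.

Let chi0 (r : R) : (0 <= \1_pos r * (r ^+ k * expR (- (r ^+ 2 / 2))))%R.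
Proof.
rewrite indicE; have [|_] := boolP (r \in pos); last by rewrite mul0r.
rewrite inE /pos /= in_itv /= andbT => r0.
by rewrite mul1r mulr_ge0 ?expR_ge0// exprn_ge0// ltW.
Qed.

Let mpow : measurable_fun setT (fun r : R => (\1_pos r * r ^+ k)%R).
Proof.
apply: measurable_funM; first by apply: measurable_indic; exact: measurable_itv.
exact: measurable_funX.
Qed.

Let pow0 (r : R) : (0 <= \1_pos r * r ^+ k)%R.
Proof.
rewrite indicE; have [|_] := boolP (r \in pos); last by rewrite mul0r.
by rewrite inE /pos /= in_itv /= andbT => r0; rewrite mul1r exprn_ge0// ltW.
Qed.

Let I_indic : I = \int[leb]_r (\1_pos r * (r ^+ k * expR (- (r ^+ 2 / 2))))%:E.
Proof.
rewrite /I integral_mkcond; apply: eq_integral => r _.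
by rewrite patchE indicE; case: ifPn; rewrite ?mul1r ?mul0r.
Qed.

Let radial (F : 'cV[R]_k.+1 -> \bar R) (v : 'cV[R]_k.+1) :=
  \int[leb]_r ((\1_pos r * (r ^+ k * expR (- (r ^+ 2 / 2))))%:E * F (r *: v)%R).

Let measurable_radial F : measurable_fun setT F -> (forall v, 0 <= F v) ->
  measurable_fun setT (radial F).
Proof. by move=> mF F0; exact: measurable_ray_integral. Qed.

Let radial_ge0 F v : (forall v, 0 <= F v) -> 0 <= radial F v.
Proof.
by move=> F0; apply: integral_ge0 => r _; apply: mule_ge0 => //; rewrite lee_fin.
Qed.

Lemma norm2_normalize2 (v : 'cV[R]_k.+1) : v != 0%R -> norm2 (normalize2 v) = 1%R.
Proof.
move=> v0; have nv0 : (0 < norm2 v)%R by rewrite lt_neqAle norm2_ge0 eq_sym norm2_eq0 v0.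
by rewrite norm2Z gtr0_norm ?invr_gt0// mulVf// gt_eqF.
Qed.

(** [polar_substitution] applied to the Gaussian times F: along a ray through a unit vector the
    Gaussian depends on r only and combines with r^k into the chi weight. *)
Let polar_gauss F : measurable_fun setT F -> (forall v, 0 <= F v) ->
  \int[@radial_proj_ball R k.+1]_v radial F v =
  K * \int[lam]_v ((gauss_cV v)%:E * F v).
Proof.
move=> mF F0; rewrite ge0_integral_radial_proj_ball; first last.
- by move=> v; exact: radial_ge0.
- exact: measurable_radial.
have mGF : measurable_fun setT (fun v : 'cV[R]_k.+1 => (gauss_cV v)%:E * F v).
  exact: emeasurable_funM.
have GF0 (v : 'cV[R]_k.+1) : 0 <= (gauss_cV v)%:E * F v by apply: mule_ge0.
rewrite -(polar_substitution mGF GF0).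
have mB : measurable B := @measurable_ball2 R k.+1.
have m1B : measurable_fun setT (fun v => (\1_B v : R)%:E).
  by apply/measurable_EFinP; exact: measurable_indic.
apply: ge0_integral_eq_off0.
- apply: emeasurable_funM => //.
  by apply: (measurableT_comp (measurable_radial mF F0)); exact: measurable_normalize2.
- apply: emeasurable_funM => //.
  exact: (measurableT_comp (measurable_ray_integral mpow pow0 mGF GF0)
    (@measurable_normalize2 R k.+1)).
- by move=> v; apply: mule_ge0; [rewrite lee_fin|exact: radial_ge0].
- move=> v; apply: mule_ge0; first by rewrite lee_fin.
  by apply: integral_ge0 => r _; apply: mule_ge0 => //; rewrite lee_fin.
- move=> v v0; congr (_ * _); apply: eq_integral => r _.
  rewrite [RHS]muleA -EFinM -[in RHS]mulrA; congr ((_ * (_ * _))%R%:E * _).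
  by rewrite /gauss_cV norm2Z norm2_normalize2// mulr1 real_normK// num_real.
Qed.

Let radial_proj_ballT : @radial_proj_ball R k.+1 setT = V.
Proof. exact: (congr1 lam (setTI B)). Qed.

(** [polar_gauss] for F = 1, where the radial integral is the constant [I]. *)
Let ball_chi : V * I = K * cst_gauss%:E.
Proof.
have mc : measurable_fun setT (fun _ : 'cV[R]_k.+1 => 1 : \bar R).
  exact: measurable_cst.
have c0 : 'cV[R]_k.+1 -> 0 <= 1 :> \bar R by rewrite lee_fin.
have := polar_gauss mc c0.
have -> : \int[lam]_v ((gauss_cV v)%:E * 1) = cst_gauss%:E.
  by rewrite -integral_gauss_cV; apply: eq_integral => v _; rewrite mule1.
move=> <-.
have -> : radial (fun=> 1) = cst I.
  by apply/funext => v; rewrite I_indic; apply: eq_integral => r _; rewrite mule1.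
rewrite integral_cst// muleC; congr (_ * _).
exact/esym/radial_proj_ballT.
Qed.

(** On the unit ball the Gaussian is at least exp (- 1 / 2), so the finite Gaussian mass controls
    the volume. *)
Let V_lt_pinfty : V < +oo.
Proof.
apply: (@le_lt_trans _ _ (\int[lam]_v ((expR 2^-1)%:E * (gauss_cV v)%:E))).
  have mB : measurable B := @measurable_ball2 R k.+1.
  rewrite /V -[leLHS]/(lam B) -(setIT B) -integral_indic//.
  apply: ge0_le_integral => //.
  - exact/measurable_EFinP/measurable_indic.
  - by apply: measurable_funeM.
  move=> v _; rewrite -EFinM lee_fin indicE.
  have [|_] := boolP (v \in B); last by rewrite mulr_ge0 ?expR_ge0.
  rewrite inE /B /= => v1; rewrite /gauss_cV -expRD -[leLHS]expR0 ler_expR.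
  have : (norm2 v ^+ 2 <= 1)%R by rewrite expr_le1// norm2_ge0.
  by move: (norm2 v ^+ 2)%R => x; lra.
rewrite ge0_integralZl//.
by rewrite integral_gauss_cV -EFinM ltry.
Qed.

Let K_gt0 : 0 < K.
Proof.
have mJ : measurable (`[1%R, 2%R] : set R) by exact: measurable_itv.
have mK : measurable_fun setT
    (fun s : R => (\1_`[1%R, +oo[ s * s^-1 ^+ k.+2)%:E).
  apply/measurable_EFinP; apply: measurable_funM.
    by apply: measurable_indic; exact: measurable_itv.
  by apply: measurable_funX; exact: measurable_invr.
apply: (@lt_le_trans _ _ (\int[leb]_(s in `[1%R, 2%R]) (2^-1 ^+ k.+2)%:E)).
  have l12 : @lebesgue_measure R `[1%R, 2%R]%classic = 1.
    by rewrite lebesgue_measure_itv /= lte_fin ltr1n -EFinB; congr EFin; ring.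
  rewrite integral_cst// [X in _ * X]l12 mule1 lte_fin.
  by rewrite exprn_gt0// invr_gt0.
apply: (@le_trans _ _ (\int[leb]_(s in `[1%R, 2%R])
    (\1_`[1%R, +oo[ s * s^-1 ^+ k.+2)%:E)).
  apply: ge0_le_integral => //.
  - exact: measurable_funTS.
  move=> s /=; rewrite in_itv /= => /andP[s1 s2].
  have s0 : (0 < s)%R by rewrite (lt_le_trans ltr01).
  rewrite lee_fin indicE mem_set ?mul1r; last by rewrite /= in_itv /= s1.
  have s20 : (2^-1 <= s^-1)%R by rewrite lef_pV2 ?posrE.
  by apply: lerXn2r => //; rewrite nnegrE invr_ge0 ltW.
apply: ge0_subset_integral => //.
move=> s _; rewrite lee_fin indicE; have [|_] := boolP (s \in _); last by rewrite mul0r.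
rewrite inE /= in_itv /= andbT => s1.
by rewrite mul1r exprn_ge0// invr_ge0 (le_trans ler01).
Qed.

Let gauss_gt0 : (0 < cst_gauss)%R.
Proof. by rewrite exprn_gt0// sqrtr_gt0 mulr_gt0// pi_gt0. Qed.

Let I_ge0 : 0 <= I. Proof. exact: ge0_chi_integral. Qed.

Let I_fin : I \is a fin_num. Proof. exact: chi_integral_fin_num. Qed.

Let V_fin : V \is a fin_num. Proof. by rewrite ge0_fin_numE// measure_ge0. Qed.

(** The right-hand side of [ball_chi] is positive, so neither the volume nor the chi mass can
    vanish; both facts are read off the product. *)
Let VI_gt0 : 0 < V * I.
Proof. by rewrite ball_chi mule_gt0// lte_fin. Qed.

Let V_neq0 : V != 0.
Proof. by apply: contraTneq VI_gt0 => ->; rewrite mul0e ltxx. Qed.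

Lemma chi_integral_gt0 : 0 < I.
Proof.
rewrite lt_neqAle I_ge0 andbT eq_sym.
by apply: contraTneq VI_gt0 => I0; rewrite I0 mule0 ltxx.
Qed.

Lemma integral_uniform_sphere (H : 'cV[R]_k.+1 -> \bar R) :
  measurable_fun setT H -> (forall v, 0 <= H v) ->
  \int[uniform_sphere R k.+1]_v H v =
  ((fine V)^-1)%:E * \int[@radial_proj_ball R k.+1]_v H v.
Proof.
move=> mH H0.
have V0 : (0 <= (fine V)^-1)%R by rewrite invr_ge0 fine_ge0// measure_ge0.
transitivity (\int[mscale (NngNum V0) (@radial_proj_ball R k.+1)]_v H v).
  apply: eq_measure_integral => A mA _.
  (* The fallback of [mnormalize] does not occur, as the mass [V] is neither 0 nor infinite. *)
  rewrite /uniform_sphere /= /mnormalize ifF; last first.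
    apply/negP => /orP[] /eqP e.
      by have := V_neq0; rewrite (etrans (esym radial_proj_ballT) e) eqxx.
    by have := V_lt_pinfty; rewrite (etrans (esym radial_proj_ballT) e) ltxx.
  rewrite muleC; congr (_%:E * _); congr ((fine _)^-1%R).
  exact: radial_proj_ballT.
exact: (@ge0_integral_mscale _ _ _ _ _ measurableT (NngNum V0) H mH (fun v _ => H0 v)).
Qed.

Lemma integral_gauss_uniform_sphere (F : 'cV[R]_k.+1 -> \bar R) :
  measurable_fun setT F -> (forall v, 0 <= F v) ->
  \int[lam]_v ((gauss_cV v)%:E * F v) =
  cst_gauss%:E * \int[uniform_sphere R k.+1]_v
    \int[leb]_r ((\1_pos r * chi_pdf k.+1 r)%:E * F (r *: v)%R).
Proof.
move=> mF F0.
have I0 : (0 < fine I)%R by rewrite fine_gt0// chi_integral_gt0 -ge0_fin_numE.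
have E v : \int[leb]_r ((\1_pos r * chi_pdf k.+1 r)%:E * F (r *: v)%R) =
    ((fine I)^-1)%:E * radial F v.
  rewrite -ge0_integralZl//; first last.
  - by rewrite lee_fin invr_ge0 ltW.
  - by move=> r _; apply: mule_ge0 => //; rewrite lee_fin.
  - apply: emeasurable_funM; first exact/measurable_EFinP.
    by apply: measurableT_comp => //; exact: measurable_scalemx.
  apply: eq_integral => r _; rewrite chi_pdfE -/I muleA -EFinM.
  by congr (_%:E * _); rewrite mulrCA.
transitivity (cst_gauss%:E * \int[uniform_sphere R k.+1]_v
    (((fine I)^-1)%:E * radial F v)); last first.
  by congr (_ * _); apply: eq_integral => v _; exact/esym/E.
rewrite ge0_integralZl//; first last.
- by rewrite lee_fin invr_ge0 ltW.
- by move=> v _; exact: radial_ge0.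
- exact: measurable_radial.
rewrite integral_uniform_sphere; first last.
- by move=> v; exact: radial_ge0.
- exact: measurable_radial.
rewrite polar_gauss// !muleA -!EFinM.
(* [K] must be finite before it can be cancelled; an infinite value would contradict the finite
   product of [V] and [I] in [ball_chi]. *)
have K_fin : K \is a fin_num.
  rewrite ge0_fin_numE ?ltW// ltNge leye_eq; apply/negP => /eqP Ky.
  have := fin_numM V_fin I_fin.
  by rewrite ball_chi Ky gt0_mulye ?lte_fin.
have V0 : (0 < fine V)%R by rewrite fine_gt0// V_lt_pinfty lt0e V_neq0 measure_ge0.
have e : (fine V * fine I = fine K * cst_gauss)%R.
  by apply: EFin_inj; rewrite !EFinM !fineK// ball_chi.
have {1}-> : K = (fine K)%:E by rewrite fineK.
rewrite -EFinM (_ : (_ * _)%R = 1%R) ?mul1e//.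
apply: (@mulfI _ (fine V * fine I)%R); first by rewrite mulf_neq0// gt_eqF.
rewrite mulr1 [RHS]e; field.
by rewrite !gt_eqF.
Qed.

End uniform_sphere_decomposition.

Section chi_pdf_facts.
Variable R : realType.

Lemma chi_pdf_ge0 k (r : R) : 0 <= r -> 0 <= chi_pdf k.+1 r.
Proof.
move=> r0; rewrite chi_pdfE mulr_ge0 ?invr_ge0 ?fine_ge0 ?ge0_chi_integral//.
by rewrite mulr_ge0 ?expR_ge0// exprn_ge0.
Qed.

Lemma integral_chi_pdf k :
  (\int[lebesgue_measure]_(r in `]0%R, +oo[) (chi_pdf k.+1 r : R)%:E = 1)%E.
Proof.
under eq_integral do rewrite chi_pdfE EFinM.
have I0 := chi_integral_gt0 R k; have If := chi_integral_fin_num R k.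
rewrite ge0_integralZl//; first last.
- by rewrite lee_fin invr_ge0 fine_ge0// ltW.
- move=> r /=; rewrite in_itv /= andbT => r0.
  by rewrite lee_fin mulr_ge0 ?expR_ge0// exprn_ge0// ltW.
- apply: measurable_funTS; apply/measurable_EFinP; apply: measurable_funM.
    exact: measurable_funX.
  apply: measurableT_comp => //; apply: measurableT_comp => //.
  by apply: measurable_funM => //; exact: measurable_funX.
- rewrite -[X in (_ * X)%E](fineK If) -EFinM mulVf// gt_eqF//.
  by rewrite fine_gt0// I0 -ge0_fin_numE// ltW.
Qed.

Lemma integral_chi_pdf0y k :
  (\int[lebesgue_measure]_(r in `[0%R, +oo[) (chi_pdf k.+1 r : R)%:E = 1)%E.
Proof.
rewrite -integral_itv_obnd_cbnd ?integral_chi_pdf//.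
by apply: measurable_funTS; apply/measurable_EFinP; exact: measurable_chi_pdf.
Qed.

End chi_pdf_facts.

(** With S = L L^T the determinant is (det L)^2, and the quadratic form at L w collapses to |w|^2
    because L w = S (L^-T w). *)
Lemma mvnormal_pdf_cholesky (R : realType) k (z : 'cV[R]_k) (L S : 'M[R]_k)
    (w : 'cV[R]_k) : cholesky_factor L S ->
  mvnormal_pdf z S (L *m w + z) =
  (\det L)^-1 * (Num.sqrt (2 * pi) ^+ k)^-1 * gauss_cV w.
Proof.
move=> [trL L0 <-].
have dL : 0 < \det L by rewrite det_trig//; apply: prodr_gt0 => i _.
have uL : L \in unitmx by rewrite unitmxE unitfE gt_eqF.
have uLT : L^T \in unitmx by rewrite unitmx_tr.
have sX j : Num.sqrt ((2 * pi) ^+ j) = Num.sqrt (2 * pi) ^+ j :> R.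
  elim: j => [|j IH]; first by rewrite !expr0 sqrtr1.
  by rewrite !exprS sqrtrM ?mulr_ge0 ?pi_ge0// IH.
rewrite /mvnormal_pdf addrK det_mulmx det_tr; congr (_ * _).
  rewrite -expr2 sqrtrM ?exprn_ge0 ?mulr_ge0 ?pi_ge0// sqrtr_sqr gtr0_norm//.
  by rewrite invfM mulrC sX.
rewrite /gauss_cV; congr (expR (- _)); rewrite mulrC; congr (_ * _).
have uS : L *m L^T \in unitmx by rewrite unitmx_mul uL.
have LwE : L *m w = (L *m L^T) *m (invmx L^T *m w) by rewrite -mulmxA mulKVmx.
rewrite -mulmxA {2}LwE mulKmx// trmx_mul -mulmxA mulKVmx//.
by rewrite norm2_sqr mxE; apply: eq_bigr => i _; rewrite mxE expr2.
Qed.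

(** * Gaussian probabilities as integrals over directions and radii *)

Section spherical_radial_decomposition.
Variables (R : realType) (k : nat).
Local Open Scope ereal_scope.

(** [normalize2] sends every v != 0 to the sphere, and the origin is a null set. *)
Lemma uniform_sphere_sphere2 : uniform_sphere R k.+1 (~` @sphere2 R k.+1) = 0.
Proof.
have mS : measurable (~` @sphere2 R k.+1).
  apply: measurableC; rewrite (_ : @sphere2 R k.+1 =
    setT `&` @norm2 R k.+1 @^-1` [set 1%R]); first exact: measurable_norm2.
  by rewrite setTI.
have mH : measurable_fun setT (fun v => (\1_(~` @sphere2 R k.+1) v : R)%:E).
  exact/measurable_EFinP/measurable_indic.
have H0 v : 0 <= (\1_(~` @sphere2 R k.+1) v : R)%:E by rewrite lee_fin.
transitivity (\int[uniform_sphere R k.+1]_v (\1_(~` @sphere2 R k.+1) v : R)%:E).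
  by rewrite integral_indic// setIT.
rewrite (integral_uniform_sphere mH H0) (ge0_integral_radial_proj_ball mH H0).
rewrite [X in _ * X](_ : _ = 0) ?mule0//.
transitivity (\int[lebesgue_cV R k.+1]_v 0 : \bar R); last by rewrite integral0.
apply: ge0_integral_eq_off0 => //.
- apply: emeasurable_funM.
    by apply/measurable_EFinP/measurable_indic; exact: measurable_ball2.
  by apply: (measurableT_comp mH); exact: measurable_normalize2.
- move=> v v0; rewrite [X in _ * (X%:E)](_ : _ = 0%R) ?mule0//.
  by rewrite indicE memNset//= => /(_ (norm2_normalize2 v0)).
Qed.

Lemma measurable_ray_set (A : set 'cV[R]_k.+1) (w z : 'cV[R]_k.+1) :
  measurable A -> measurable [set r : R | (0 <= r)%R /\ A (r *: w + z)%R].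
Proof.
move=> mA; rewrite (_ : [set _ | _] = `[0%R, +oo[%classic `&`
    (setT `&` (fun r : R => r *: w + z)%R @^-1` A)).
  apply: measurableI; first exact: measurable_itv.
  have : measurable_fun setT (fun r : R => r *: w + z)%R.
    by apply: measurable_addmx => //; exact: measurable_scalemx.
  exact.
by rewrite setTI; apply/seteqP; split=> r /=; rewrite in_itv /= andbT.
Qed.

Lemma spherical_radial_decomposition (A : set 'cV[R]_k.+1)
    (z : 'cV[R]_k.+1) (L S : 'M[R]_k.+1) :
  measurable A -> cholesky_factor L S ->
  \int[lebesgue_cV R k.+1]_(y in A) (mvnormal_pdf z S y)%:E =
  \int[uniform_sphere R k.+1]_v \int[lebesgue_measure]_(r in
    [set r : R | (0 <= r)%R /\ A (r *: (L *m v) + z)%R]) (chi_pdf k.+1 r)%:E.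
Proof.
move=> mA LS; have [trL L0 LLT] := LS.
have dL : (0 < \det L)%R by rewrite det_trig//; apply: prodr_gt0 => i _.
pose c : R := (Num.sqrt (2 * pi) ^+ k.+1)%R.
have c0 : (0 < c)%R by rewrite exprn_gt0// sqrtr_gt0 mulr_gt0// pi_gt0.
have maff : measurable_fun setT (fun w : 'cV[R]_k.+1 => L *m w + z)%R.
  by apply: measurable_addmx => //; exact: measurable_mulmx.
have mAff : measurable_fun setT (fun w : 'cV[R]_k.+1 => \1_A (L *m w + z)%R : R).
  exact: (measurableT_comp (measurable_indic mA)).
(* The density is expressed through L^-1 (y - z), so that substituting y = L w + z leaves a constant
   times the standard Gaussian in w. *)
pose pdf y : \bar R := (\1_A y * (c^-1 * (\det L)^-1 *
    gauss_cV (invmx L *m (y - z))))%:E.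
have uL : L \in unitmx by rewrite unitmxE unitfE gt_eqF.
transitivity (\int[lebesgue_cV R k.+1]_y pdf y).
  rewrite integral_mkcond; apply: eq_integral => y _; rewrite patchE /pdf indicE.
  case: ifPn => _; last by rewrite mul0r.
  rewrite mul1r; congr EFin.
  rewrite -{1}(subrK z y) -{1}(mulKVmx uL (y - z)%R).
  by rewrite (mvnormal_pdf_cholesky _ _ LS) (mulrC (c^-1))%R.
have cd0 : (0 <= c^-1 * (\det L)^-1)%R by rewrite mulr_ge0// invr_ge0 ltW.
rewrite (@ge0_integral_affine_cV _ _ _ L z)//; first last.
- by move=> y; rewrite /pdf lee_fin mulr_ge0// mulr_ge0// expR_ge0.
- apply/measurable_EFinP; apply: measurable_funM; first exact: measurable_indic.
  apply: measurable_funM => //; apply: (measurableT_comp (@measurable_gauss_cV R k.+1)).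
  by apply: measurable_mulmx => //; apply: measurable_addmx.
transitivity ((\det L)%:E * ((c^-1 * (\det L)^-1)%:E * \int[lebesgue_cV R k.+1]_w
    ((gauss_cV w)%:E * (\1_A (L *m w + z)%R)%:E))).
  congr (_ * _); rewrite -ge0_integralZl//; first last.
  - by move=> w _; rewrite -EFinM lee_fin mulr_ge0// expR_ge0.
  - by apply: emeasurable_funM; apply/measurable_EFinP => //; exact: measurable_gauss_cV.
  apply: eq_integral => w _; rewrite /pdf addrK mulKmx// -!EFinM; congr EFin.
  by rewrite mulrC -!mulrA; congr (_ * (_ * _))%R; rewrite mulrC.
rewrite integral_gauss_uniform_sphere//; first last.
- exact/measurable_EFinP.
rewrite !muleA -!EFinM (_ : (_ * _)%R = 1%R) ?mul1e; last first.
  by rewrite -/c; field; rewrite !gt_eqF.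
apply: eq_integral => v _.
transitivity (\int[lebesgue_measure]_(r in `]0%R, +oo[)
    ((chi_pdf k.+1 r)%:E * (\1_A (r *: (L *m v) + z)%R)%:E)).
  rewrite [RHS]integral_mkcond; apply: eq_integral => r _.
  rewrite patchE EFinM -muleA scalemxAr indicE.
  by case: ifPn; rewrite ?mul1e ?mul0e.
(* Polar coordinates use r > 0 while the ray set allows r = 0; the endpoint is a null set. *)
rewrite integral_itv_obnd_cbnd; last first.
  apply: measurable_funTS; apply: emeasurable_funM; apply/measurable_EFinP.
    exact: measurable_chi_pdf.
  apply: (measurableT_comp (measurable_indic mA)).
  by apply: measurable_addmx => //; exact: measurable_scalemx.
rewrite integral_mkcond [RHS]integral_mkcond; apply: eq_integral => r _.
rewrite !patchE indicE.
have [r0|r0] := boolP (r \in `[0%R, +oo[%classic); last first.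
  rewrite memNset// => -[r0' _]; move/negP: r0; apply.
  by rewrite inE /= in_itv /= r0'.
have {}r0 : (0 <= r)%R by move: r0; rewrite inE /= in_itv /= andbT.
have [rA|rA] := boolP ((r *: (L *m v) + z)%R \in A).
  by rewrite mule1 mem_set//; split => //; exact: set_mem.
by rewrite mule0 memNset// => -[_ /mem_set]; apply/negP.
Qed.

End spherical_radial_decomposition.

(** * Differentiation under the integral sign *)

Section frechet_epsilon.
Context {R : realType} {V : normedModType R}.
Implicit Types (f g : V -> R) (x h : V).

Lemma differentiable_eps f x (df : {linear V -> R}) : continuous df ->
  (forall eps, 0 < eps ->
    \forall h \near 0, `|f (h + x) - f x - df h| <= eps * `|h|) ->
  differentiable f x /\ 'd f x = df :> (V -> R).
Proof.
move=> cdf fdf.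
have E : f \o shift x = cst (f x) + df +o_ (0 : V) id.
  apply/eqaddoP => e e0; near=> h.
  rewrite [X in `|X|](_ : _ = f (h + x) - f x - df h); last first.
    by rewrite /= !fctE opprD addrA.
  by near: h; exact: fdf.
have dE := diff_unique cdf E.
by split => //; apply/diff_locallyP; rewrite dE.
Unshelve. all: by end_near. Qed.

Lemma eps_differentiable f x eps : differentiable f x -> 0 < eps ->
  \forall h \near 0, `|f (h + x) - f x - 'd f x h| <= eps * `|h|.
Proof.
move=> /diff_locally /eqaddoP/(_ eps) + e0 => /(_ e0).
by apply: filterS => h; rewrite /= !fctE opprD addrA.
Qed.

Lemma near_eq_diff f g x : (\forall y \near x, f y = g y) ->
  differentiable g x -> differentiable f x /\ 'd f x = 'd g x :> (V -> R).
Proof.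
move=> fg dg; apply: differentiable_eps; first exact: diff_continuous.
move=> eps eps0; have fgx : f x = g x := nbhs_singleton fg.
have cshift : (h + x) @[h --> (0 : V)] --> x.
  by rewrite -[X in _ --> X]add0r; apply: cvgD; [exact: cvg_id|exact: cvg_cst].
have fgh : \forall h \near (0 : V), f (h + x) = g (h + x) by exact: (cshift _ fg).
near=> h; rewrite fgx (_ : f (h + x) = g (h + x)); last by near: h.
by near: h; exact: eps_differentiable.
Unshelve. all: by end_near. Qed.

(* Reduces a neighborhood property to sequences, the form in which dominated
   convergence applies. *)
Lemma near_seq x (U P : set V) : nbhs x U ->
  (forall u : nat -> V, (forall n, U (u n)) -> u n @[n --> \oo] --> x ->
     exists n, P (u n)) ->
  nbhs x P.
Proof.
move=> xU H; apply: contrapT => nP.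
have Hn (n : nat) : exists y, [/\ ball x n.+1%:R^-1 y, U y & ~ P y].
  apply: contrapT => nex; apply: nP.
  have : nbhs x (ball x n.+1%:R^-1 `&` U).
    by apply: filterI => //; apply: nbhsx_ballx; rewrite invr_gt0.
  by apply: filterS => y [yx Uy]; apply: contrapT => nPy; apply: nex; exists y.
pose u n := projT1 (cid (Hn n)).
have uP n : [/\ ball x n.+1%:R^-1 (u n), U (u n) & ~ P (u n)].
  by rewrite /u; case: cid.
have [n Pn] : exists n, P (u n).
  apply: H => [n|]; first by have [] := uP n.
  apply/cvgrPdist_lt => e e0; near=> n.
  have [xu _ _] := uP n; move: xu; rewrite -ball_normE /= => /lt_trans; apply.
  near: n; have := @cvg_harmonic R => /cvgrPdist_lt/(_ _ e0).
  by apply: filterS => n /=; rewrite sub0r normrN gtr0_norm.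
by have [_ _] := uP n; apply.
Unshelve. all: by end_near. Qed.

Lemma diff_comp_line f x h (s : R) : differentiable f (x + s *: h) ->
  is_derive s 1 (fun s : R => f (x + s *: h)) ('d f (x + s *: h) h).
Proof.
move=> df; have := @diff_derivable _ _ _ f _ h df; rewrite -(deriveE h df) /derivable /derive.
rewrite (_ : (fun t : R => t^-1 *: ((f \o shift (x + s *: h)) (t *: h) - _)) =
  (fun t : R => t^-1 *: (((fun s : R => f (x + s *: h)) \o shift s) (t *: 1) -
     f (x + s *: h)))) => [cvf|]; first by apply: DeriveDef.
apply/funext => t /=; congr (_ *: (f _ - _)).
by rewrite addrCA -scalerDl; congr (x + (_ + _) *: h); exact/esym/mulr1.
Qed.

Lemma diff_mean_value f x h :
  (forall s : R, 0 <= s <= 1 -> differentiable f (x + s *: h)) ->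
  exists2 s : R, 0 <= s <= 1 & f (x + h) - f x = 'd f (x + s *: h) h.
Proof.
move=> df.
have dfl (s : R) : 0 <= s <= 1 ->
    is_derive s 1 (fun s : R => f (x + s *: h)) ('d f (x + s *: h) h).
  by move=> s01; apply: diff_comp_line; exact: df.
have [||s] := @MVT_segment R (fun s => f (x + s *: h))
    (fun s => 'd f (x + s *: h) h) 0 1 ler01.
- by move=> s; rewrite in_itv /= => /andP[s0 s1]; apply: dfl; rewrite !ltW.
- apply: derivable_within_continuous => s; rewrite in_itv /= => s01.
  by have [] := dfl s s01.
rewrite in_itv /= => s01; rewrite scale1r scale0r addr0 subr0 mulr1 => ->.
by exists s.
Qed.

Lemma diff_lipschitz_ball f x (r K : R) :
  (forall y, ball x r y -> differentiable f y /\ forall h, `|'d f y h| <= K * `|h|) ->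
  forall h, `|h| < r -> `|f (x + h) - f x| <= K * `|h|.
Proof.
move=> fK h hr.
have xsh (s : R) : 0 <= s <= 1 -> ball x r (x + s *: h).
  move=> /andP[s0 s1]; rewrite -ball_normE /= opprD addNKr normrN normrZ ger0_norm//.
  by rewrite (le_lt_trans _ hr)// ler_piMl.
have [s01|s /xsh/fK[_ +] ->] := @diff_mean_value f x h; last exact.
by move=> /xsh/fK[].
Qed.

End frechet_epsilon.

Section bounded_integrands.
Context d (T : measurableType d) (R : realType).
Variables (mu : {measure set T -> \bar R}) (D : set T).
Hypotheses (mD : measurable D) (muD : (mu D < +oo)%E).

Lemma bounded_integrable (f : T -> R) (M : R) : measurable_fun D f ->
  (forall t, D t -> `|f t| <= M) -> mu.-integrable D (EFin \o f).
Proof.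
move=> mf fM; apply: measurable_bounded_integrable => //.
exists M; split; first exact: num_real.
by move=> x Mx t Dt; rewrite /= (le_trans (fM t Dt))// ltW.
Qed.

Lemma bounded_cvg_Rintegral (f_ : nat -> T -> R) (f : T -> R) (M : R) :
  (forall n, measurable_fun D (f_ n)) ->
  (forall n t, D t -> `|f_ n t| <= M) ->
  (forall t, D t -> f_ n t @[n --> \oo] --> f t) ->
  \int[mu]_(t in D) f_ n t @[n --> \oo] --> \int[mu]_(t in D) f t.
Proof.
move=> mf fM cf.
have mf0 : measurable_fun D f by exact: measurable_fun_cvg cf.
have iM : mu.-integrable D (EFin \o cst M).
  apply: (@bounded_integrable _ `|M|); first exact: measurable_cst.
  by move=> t _.
have [|||||intf _ cI] := @dominated_convergence _ _ _ mu D mD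
  (fun n => EFin \o f_ n) (EFin \o f) (EFin \o cst M).
- by move=> n; exact/measurable_EFinP.
- exact/measurable_EFinP.
- by apply: aeW => t Dt; apply: cvg_EFin; [exact: nearW|exact: cf].
- exact: iM.
- by apply: aeW => t n Dt; rewrite /= lee_fin fM.
apply: fine_cvg; rewrite fineK//.
exact: integrable_fin_num.
Qed.

End bounded_integrands.

Section differentiation_under_integral.
Context d (T : measurableType d) (R : realType) (V : normedModType R).
Variables (mu : {measure set T -> \bar R}) (D : set T).
Hypotheses (mD : measurable D) (muD : (mu D < +oo)%E).
Variables (A : set V) (f : V -> T -> R) (M K : R).
Hypothesis oA : open A.
Hypothesis mf : forall x, measurable_fun D (f x).
Hypothesis fM : forall x t, A x -> D t -> `|f x t| <= M.
Hypothesis fC1 : forall t, D t -> C1_on A (f ^~ t).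
Hypothesis fK : forall x t h, A x -> D t -> `|'d (f ^~ t) x h| <= K * `|h|.

Let F x := \int[mu]_(t in D) f x t.
Let dF x h := \int[mu]_(t in D) 'd (f ^~ t) x h.

(** The derivative is the pointwise limit of difference quotients with steps h / (n + 1), each of
    them measurable in t. *)
Lemma measurable_diff_param x h : A x ->
  measurable_fun D (fun t => 'd (f ^~ t) x h).
Proof.
move=> Ax; apply: (@measurable_fun_cvg _ _ _ D
  (fun n t => n.+1%:R * (f (n.+1%:R^-1 *: h + x) t - f x t))) => [n|t Dt].
  by apply: measurable_funM => //; exact: measurable_funB.
have dfx := (fC1 Dt Ax).1.
have := @diff_derivable _ _ _ (f ^~ t) _ h dfx.
rewrite -(deriveE h dfx) /derivable /derive => /cvgr_dnbhsP.
move=> /(_ (fun n => n.+1%:R^-1)).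
move=> /(_ (conj _ (@cvg_harmonic R))) /=.
rewrite (_ : (fun n => _ *: _) =
  (fun n => n.+1%:R * (f (n.+1%:R^-1 *: h + x) t - f x t))); last first.
  by apply/funext => n; rewrite invrK.
by apply => n; rewrite invr_eq0 pnatr_eq0.
Qed.

Lemma integrable_diff_param x h : A x ->
  mu.-integrable D (EFin \o (fun t => 'd (f ^~ t) x h)).
Proof.
move=> Ax; apply: (bounded_integrable mD muD (M := K * `|h|)).
  exact: measurable_diff_param.
by move=> t Dt; exact: fK.
Qed.

Let dF_linear x : A x -> linear (dF x).
Proof.
move=> Ax a u v.
transitivity (a * dF x u + dF x v); last by [].
rewrite /dF.
rewrite -RintegralZl//; last exact: integrable_diff_param.
rewrite -RintegralD//; last exact: integrable_diff_param; last first.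
  exact: (integrableZl mD a (integrable_diff_param u Ax)).
by apply: eq_Rintegral => t _; rewrite linearP.
Qed.

Lemma diff_integral x : A x ->
  differentiable F x /\ forall h, 'd F x h = dF x h.
Proof.
move=> Ax.
pose dFx : {linear V -> R} :=
  HB.pack (dF x) (GRing.isLinear.Build _ _ _ _ (dF x) (dF_linear Ax)).
have dFb h : `|dF x h| <= K * fine (mu D) * `|h|.
  apply: (le_trans (le_normr_Rintegral mD (integrable_diff_param h Ax))).
  rewrite mulrAC -(Rintegral_cst _ mD); apply: le_Rintegral => //.
  - exact: (integrable_norm (integrable_diff_param h Ax)).
  - apply: (bounded_integrable mD muD (M := `|K * `|h| |)) => //.
  - by move=> t Dt; exact: fK.
have cdF : continuous dFx.
  move=> y; apply/cvgrPdist_lt => e e0; near=> z.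
  rewrite -linearB; apply: (le_lt_trans (dFb _)).
  apply: (@le_lt_trans _ _ ((`|K * fine (mu D)| + 1) * `|y - z|)).
    by rewrite ler_wpM2r// (le_trans (ler_norm _))// lerDl.
  rewrite -ltr_pdivlMl ?ltr_wpDl//.
  by near: z; apply: cvgr_dist_lt => //; rewrite mulr_gt0// invr_gt0 ltr_wpDl.
have [] := @differentiable_eps _ _ F x dFx cdF; last by move=> ? ->.
move=> eps eps0.
have [r /= r0 xrA] : exists2 r : R, 0 < r & ball x r `<=` A.
  by have /nbhs_ballP := open_nbhs_nbhs (conj oA Ax).
apply: (@near_seq _ _ _ (ball 0 r)); first exact: nbhsx_ballx.
move=> u uU cu.
(* The remainder relative to |u n|, equal to 0 when u n = 0. The mean value theorem on the ball
   keeps it below 2 |K|, and it tends to 0 for each t, so dominated convergence applies. *)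
pose q n t := `|u n|^-1 * (f (u n + x) t - f x t - 'd (f ^~ t) x (u n)).
have unr n : `|u n| < r by have := uU n; rewrite -ball_normE /= sub0r normrN.
have unA n : A (u n + x).
  by apply: xrA; rewrite -ball_normE /= opprD addrCA subrr addr0 normrN.
have ixA y : A y -> mu.-integrable D (EFin \o f y).
  by move=> Ay; apply: (bounded_integrable mD muD (M := M)) => // t; exact: fM.
have iq n : mu.-integrable D (EFin \o (fun t => f (u n + x) t - f x t)).
  exact: (integrableB mD (ixA _ (unA n)) (ixA _ Ax)).
have qE n : `|u n|^-1 * (F (u n + x) - F x - dF x (u n)) = \int[mu]_(t in D) q n t.
  rewrite /F /dF -RintegralB//; [|exact: ixA..].
  rewrite -RintegralB//; last exact: integrable_diff_param.
  rewrite -RintegralZl//.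
  exact: (integrableB mD (iq n) (integrable_diff_param (u n) Ax)).
have fxA t y : D t -> ball x r y -> differentiable (f ^~ t) y /\
    forall h, `|'d (f ^~ t) y h| <= K * `|h|.
  move=> Dt /xrA Ay; split; first by have [] := fC1 Dt Ay.
  by move=> h; exact: fK.
have cq : \int[mu]_(t in D) q n t @[n --> \oo] --> \int[mu]_(t in D) 0.
  apply: (@bounded_cvg_Rintegral _ _ _ mu D mD muD q (fun=> 0) (`|K| + `|K|)).
  - move=> n; apply: measurable_funM => //; apply: measurable_funB.
      exact: measurable_funB.
    exact: measurable_diff_param.
  - move=> n t Dt; rewrite /q normrM normfV normr_id.
    have [->|un0] := eqVneq (u n) 0; first by rewrite normr0 invr0 mul0r addr_ge0.
    rewrite ler_pdivrMl ?normr_gt0// mulrC mulrDl.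
    apply: (le_trans (ler_normB _ _)); apply: lerD.
      have := diff_lipschitz_ball (fun y => @fxA t y Dt) (unr n).
      by rewrite [x + _]addrC => /le_trans; apply; rewrite ler_wpM2r// ler_norm.
    by apply: (le_trans (fK _ Ax Dt)); rewrite ler_wpM2r// ler_norm.
  - move=> t Dt; apply/cvgr0Pnorm_le => e e0; near=> n.
    rewrite /q normrM normfV normr_id.
    have [->|un0] := eqVneq (u n) 0; first by rewrite normr0 invr0 mul0r ltW.
    rewrite ler_pdivrMl ?normr_gt0// mulrC.
    by near: n; exact: (cu _ (eps_differentiable (fC1 Dt Ax).1 e0)).
rewrite Rintegral_cst// mul0r in cq.
have /cvgr0Pnorm_le/(_ _ eps0)[n _ /(_ n (leqnn n))] := cq.
rewrite -qE => /= nP; exists n.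
have [un0|un0] := eqVneq (u n) 0.
  have d0 : dF x 0 = 0 := linear0 dFx.
  by rewrite un0 add0r subrr sub0r /= d0 oppr0 !normr0 mulr0.
move: nP; rewrite normrM normfV normr_id ler_pdivrMl ?normr_gt0//.
by rewrite mulrC.
Unshelve. all: by end_near. Qed.

Lemma C1_on_integral : C1_on A F.
Proof.
move=> x Ax; split; first by have [] := diff_integral Ax.
move=> h; apply/cvgrPdist_lt => e e0.
have xA : nbhs x A by exact: open_nbhs_nbhs.
apply: (near_seq xA) => u uA cu.
rewrite (diff_integral Ax).2.
have : dF (u n) h @[n --> \oo] --> dF x h.
  apply: (@bounded_cvg_Rintegral _ _ _ mu D mD muD
    (fun n t => 'd (f ^~ t) (u n) h) _ (K * `|h|)).
  - by move=> n; exact: measurable_diff_param.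
  - by move=> n t Dt; exact: fK.
  - move=> t Dt; have [_ /(_ h)] := fC1 Dt Ax.
    exact: (cvg_comp _ _ cu).
move=> /cvgrPdist_lt/(_ _ e0)[n _ /(_ n (leqnn n))] /= nP.
by exists n; rewrite (diff_integral (uA n)).2.
Qed.

End differentiation_under_integral.

(** * The radial probability function along one ray *)

Section chi_cdf.
Variables (R : realType) (k : nat).

Definition chi_cdf (s : R) : R :=
  \int[lebesgue_measure]_(r in `[0, s]) chi_pdf k.+1 r.

Lemma continuous_chi_pdf : continuous (@chi_pdf R k.+1).
Proof.
move=> r; rewrite /chi_pdf.
apply: (@continuousM _ R^o (fun r => _ * r ^+ k.+1.-1)
  (fun r => expR (- (r ^+ 2 / 2)))).
  apply: (@continuousM _ R^o (fun=> _) (fun r => r ^+ k)); first exact: cvg_cst.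
  exact: exprn_continuous.
apply: (@continuous_comp _ _ _ (fun r : R => - (r ^+ 2 / 2)) expR); last first.
  exact: continuous_expR.
apply: (@continuousN _ R^o _ (fun r : R => r ^+ 2 / 2)).
apply: (@continuousM _ R^o (fun r => r ^+ 2) (fun=> 2^-1)); last exact: cvg_cst.
exact: exprn_continuous.
Qed.

Lemma integrable_chi_pdf (D : set R) : measurable D -> D `<=` `[0, +oo[ ->
  lebesgue_measure.-integrable D (EFin \o @chi_pdf R k.+1).
Proof.
move=> mD D0.
apply: (@integrableS _ _ _ lebesgue_measure `[0, +oo[%classic D
  (EFin \o @chi_pdf R k.+1) _ mD D0) => //.
apply/integrableP; split.
  by apply: measurable_funTS; apply/measurable_EFinP; exact: measurable_chi_pdf.
apply: (@le_lt_trans _ _ 1%E); last exact: ltry.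
rewrite -(integral_chi_pdf0y R k) le_eqVlt; apply/orP; left; apply/eqP.
apply: eq_integral => r; rewrite inE /= in_itv /= andbT => r0.
by rewrite ger0_norm// chi_pdf_ge0.
Qed.

Lemma is_derive_chi_cdf (s : R) : 0 < s -> is_derive s 1 chi_cdf (chi_pdf k.+1 s).
Proof.
move=> s0.
have [] := @continuous_FTC1_closed R (@chi_pdf R k.+1) 0 s (s + 1).
- by rewrite ltrDl.
- by apply: integrable_chi_pdf => // r /=; rewrite !in_itv /= => /andP[->].
- by [].
- exact: continuous_chi_pdf.
by move=> ds /= <-; rewrite derive1E; exact: derivableP.
Qed.

Lemma chi_cdf_tail (s : R) : 0 <= s ->
  1 - chi_cdf s = \int[lebesgue_measure]_(r in `]s, +oo[) chi_pdf k.+1 r.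
Proof.
move=> s0.
have : \int[lebesgue_measure]_(r in `[0%R, +oo[) chi_pdf k.+1 r = 1 :> R.
  by rewrite /Rintegral integral_chi_pdf0y.
have -> : `[0%R, +oo[%classic = `[0%R, s]%classic `|` `]s, +oo[%classic :> set R.
  rewrite -itv_bndbnd_setU ?bnd_simp//.
rewrite Rintegral_setU//.
- by move=> <-; rewrite /chi_cdf addrC addKr.
- apply: integrable_chi_pdf; first exact: measurableU.
  move=> r [] /=; rewrite !in_itv /= ?andbT; first by move=> /andP[->].
  by move=> /ltW; exact: le_trans.
- rewrite disj_set2E; apply/eqP; rewrite -subset0 => r [] /=.
  by rewrite !in_itv /= andbT => /andP[_ rs]; rewrite ltNge rs.
Qed.

(** Both rates are dictated by the ray argument, where exp (- b rho) is of order |h|. The derivative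
    of e carries a factor rho exp (b rho) and must keep one exp (- b rho) in order to tend to 0; the
    tail must keep two in order to be o(|h|). The Gaussian pays for both. *)
Lemma chi_bounds (b : R) : 0 <= b -> exists C : R, [/\ 0 <= C,
  forall s, 0 <= s -> s * chi_pdf k.+1 s * expR (b * s) <= C * expR (- (b * s)) &
  forall s, 0 <= s -> 1 - chi_cdf s <= C * expR (- (2 * b * s))].
Proof.
move=> b0; pose I := fine (\int[lebesgue_measure]_(r in `]0%R, +oo[)
     (r ^+ k * expR (- (r ^+ 2 / 2)) : R)%:E)%E.
pose J := (\int[lebesgue_measure]_(r in `]0%R, +oo[)
     (r ^+ k * expR (- (r ^+ 2 / 2)) * expR (2 * b * r) : R)%:E)%E.
have I0 : 0 <= I^-1 by rewrite invr_ge0 fine_ge0// ge0_chi_integral.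
have f0 (r : R) : `]0%R, +oo[%classic r ->
    (0 <= (r ^+ k * expR (- (r ^+ 2 / 2)) * expR (2 * b * r))%:E)%E.
  rewrite /= in_itv /= andbT => r0.
  by rewrite lee_fin !mulr_ge0 ?expR_ge0// exprn_ge0// ltW.
have J0 : (0 <= J)%E by apply: integral_ge0.
have Jfin : J \is a fin_num by rewrite ge0_fin_numE// chi_integral_lt_pinfty.
pose M := expR ((k.+1%:R + 2 * b) ^+ 2 / 2) : R.
have M0 : 0 <= M by exact: expR_ge0.
have J0' : 0 <= fine J by exact: fine_ge0.
exists (I^-1 * M + I^-1 * fine J); split.
- by rewrite addr_ge0// mulr_ge0.
- move=> s s0; apply: (@le_trans _ _ (I^-1 * M * expR (- (b * s)))); last first.
    by rewrite ler_wpM2r ?expR_ge0// lerDl mulr_ge0.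
  have -> : s * chi_pdf k.+1 s * expR (b * s) =
      I^-1 * (s ^+ k.+1 * expR (- (s ^+ 2 / 2)) * expR (b * s)).
    by rewrite chi_pdfE -/I (exprS s k); ring.
  rewrite -[leRHS]mulrA ler_wpM2l//.
  apply: (le_trans (ler_wpM2r (expR_ge0 _) (pow_gauss_le k.+1 (2 * b) s0))).
  by rewrite -/M -[leLHS]mulrA -expRD ler_wpM2l// ler_expR; lra.
- move=> s s0; rewrite chi_cdf_tail//.
  apply: (@le_trans _ _ (I^-1 * fine J * expR (- (2 * b * s)))); last first.
    by rewrite ler_wpM2r ?expR_ge0// lerDr mulr_ge0.
  have mf : measurable_fun setT (fun r : R =>
      (r ^+ k * expR (- (r ^+ 2 / 2)) * expR (2 * b * r))%:E).
    apply/measurable_EFinP; apply: measurable_funM; last first.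
      by apply: measurableT_comp => //; exact: measurable_funM.
    apply: measurable_funM; first exact: measurable_funX.
    apply: measurableT_comp => //; apply: measurableT_comp => //.
    by apply: measurable_funM => //; exact: measurable_funX.
  rewrite -lee_fin /Rintegral fineK; last first.
    apply: integrable_fin_num => //; apply: integrable_chi_pdf => // r /=.
    by rewrite !in_itv /= !andbT => /ltW; exact: le_trans.
  rewrite mulrC mulrA EFinM fineK//.
  apply: (@le_trans _ _ ((expR (- (2 * b * s)) * I^-1)%:E *
    \int[lebesgue_measure]_(r in `]s, +oo[)
       (r ^+ k * expR (- (r ^+ 2 / 2)) * expR (2 * b * r))%:E)%E); last first.
    rewrite lee_wpmul2l//; first by rewrite lee_fin mulr_ge0// expR_ge0.
    apply: ge0_subset_integral => //; first exact: measurable_funTS.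
    by move=> r /=; rewrite !in_itv /= !andbT; exact: le_lt_trans.
  have sr (r : R) : `]s, +oo[%classic r -> `]0%R, +oo[%classic r.
    by rewrite /= !in_itv /= !andbT; exact: le_lt_trans.
  rewrite -ge0_integralZl//; first last.
  - by rewrite lee_fin mulr_ge0// expR_ge0.
  - by move=> r /sr; exact: f0.
  - exact: measurable_funTS.
  apply: ge0_le_integral => //.
  - move=> r /sr; rewrite /= in_itv /= andbT => r0.
    by rewrite lee_fin chi_pdf_ge0// ltW.
  - by apply: measurable_funTS; apply/measurable_EFinP; exact: measurable_chi_pdf.
  - by apply: measurable_funTS; exact: measurable_funeM.
  move=> r; rewrite /= in_itv /= andbT => sr'; rewrite -EFinM lee_fin chi_pdfE -/I.
  have r0 : 0 < r by exact: le_lt_trans sr'.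
  set X := I^-1 * (r ^+ k * expR (- (r ^+ 2 / 2))).
  have X0 : 0 <= X by rewrite mulr_ge0// mulr_ge0 ?expR_ge0// exprn_ge0// ltW.
  (* Chernoff's argument: exp (2 b (r - s)) >= 1 for r >= s. *)
  have -> : expR (- (2 * b * s)) / I *
      (r ^+ k * expR (- (r ^+ 2 / 2)) * expR (2 * b * r)) =
      X * expR (2 * b * (r - s)).
    by rewrite mulrBr expRD /X; ring.
  rewrite ler_peMr// -[leLHS]expR0 ler_expR.
  by rewrite mulr_ge0 ?subr_ge0 ?mulr_ge0// ltW.
Qed.

End chi_cdf.

(** * Differentiability of a continuous implicit function *)

Section implicit_function.
Context {R : realType} {V : normedModType R}.

(* No existence or regularity is assumed beyond continuity of [rho] at one point;
   the expansion of [G] at [(x0, rho x0)] then forces the expansion of [rho]. *)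
Lemma implicit_differentiable (G : V * R -> R) (rho : V -> R) (x0 : V) :
  differentiable G (x0, rho x0) -> 'd G (x0, rho x0) (0, 1) != 0 ->
  {for x0, continuous rho} ->
  (\forall x \near x0, G (x, rho x) = G (x0, rho x0)) ->
  differentiable rho x0 /\
  forall h, 'd rho x0 h =
    - ('d G (x0, rho x0) (0, 1))^-1 * 'd G (x0, rho x0) (h, 0).
Proof.
set p0 := (x0, rho x0); set D := 'd G p0 (0, 1) => dG D0 crho Grho.
have cdG : continuous ('d G p0) by exact: diff_continuous.
have [C C0 dGC] := linear_lipschitz cdG.
pose l h := - D^-1 * 'd G p0 (h, 0).
have l_linear : linear l.
  move=> a u v; rewrite /l (_ : (a *: u + v, 0) = a *: (u, 0) + (v, 0) :> V * R).
    by rewrite linearP mulrDr; congr (_ + _); rewrite /= mulrCA.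
  by congr (_, _); rewrite /= scaler0 addr0.
pose ll : {linear V -> R} := HB.pack l (GRing.isLinear.Build _ _ _ _ l l_linear).
have cl : continuous ll.
  move=> h; apply: (@continuousM _ V (fun=> - D^-1) (fun h => 'd G p0 (h, 0))).
    exact: cvg_cst.
  apply: (@continuous_comp _ _ _ (fun h : V => (h, 0) : V * R) ('d G p0)).
    exact: (@cvg_pair _ _ _ (nbhs h) (nbhs h) (nbhs (0 : R)) _ _ _ id (fun=> 0)
      cvg_id (cvg_cst _)).
  exact: cdG.
have [] := @differentiable_eps _ _ rho x0 ll cl; last by move=> ? ->.
move=> eps eps0.
have nD0 : 0 < `|D| by rewrite normr_gt0.
(* [k] is the Lipschitz constant that the expansion forces on rho: once eta <= |D| / 2, half of |D|
   |delta| is absorbed on the left and |delta| <= k |h| remains. The second term of [eta] then makes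
   eta (1 + k) / |D| at most eps. *)
pose k : R := 2 * C / `|D| + 1.
have k0 : 0 < k by rewrite ltr_wpDl// divr_ge0// mulr_ge0// ltW.
pose eta := Num.min (`|D| / 2) (eps * `|D| / (1 + k)).
have eta0 : 0 < eta.
  by rewrite lt_min !divr_gt0// ?mulr_gt0// addr_gt0.
have cshift : (h + x0) @[h --> (0 : V)] --> x0.
  by rewrite -[X in _ --> X]add0r; apply: cvgD; [exact: cvg_id|exact: cvg_cst].
have cdelta : (h, rho (h + x0) - rho x0) @[h --> (0 : V)] --> ((0 : V), (0 : R)).
  apply: (@cvg_pair _ _ _ (nbhs (0 : V)) (nbhs (0 : V)) (nbhs (0 : R)) _ _ _
    id (fun h => rho (h + x0) - rho x0)); first exact: cvg_id.
  rewrite -(subrr (rho x0)); apply: cvgB; last exact: cvg_cst.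
  exact: (cvg_comp _ _ cshift crho).
have Gh : \forall h \near (0 : V), G (h + x0, rho (h + x0)) = G p0.
  exact: (cshift _ Grho).
near=> h.
set delta := rho (h + x0) - rho x0.
have dE : 'd G p0 (h, delta) = 'd G p0 (h, 0) + D * delta.
  rewrite (_ : (h, delta) = (h, 0) + delta *: (0, 1) :> V * R).
    by rewrite linearD linearZ mulrC.
  by congr (_, _); rewrite /= ?scaler0 ?addr0 ?add0r// [RHS]mulr1.
have main : `|'d G p0 (h, 0) + D * delta| <= eta * (`|h| + `|delta|).
  have : `|G ((h, delta) + p0) - G p0 - 'd G p0 (h, delta)| <=
      eta * `|(h, delta) : V * R|.
    by rewrite /delta; near: h; exact: (cdelta _ (eps_differentiable dG eta0)).
  have -> : (h, delta) + p0 = (h + x0, rho (h + x0)) :> V * R.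
    by congr (_, _); rewrite /= /delta subrK.
  have -> : G (h + x0, rho (h + x0)) = G p0 by near: h.
  rewrite subrr sub0r normrN dE => /le_trans; apply.
  rewrite ler_wpM2l ?(ltW eta0)// prod_normE ge_max.
  by rewrite lerDl lerDr !normr_ge0.
have dG0 : `|'d G p0 (h, 0)| <= C * `|h|.
  apply: (le_trans (dGC _)); rewrite ler_wpM2l ?(ltW C0)// prod_normE ge_max /=.
  by rewrite lexx normr0 normr_ge0.
have eta1 : eta <= `|D| / 2 by rewrite /eta ge_min lexx.
have eta2 : eta * (1 + k) <= eps * `|D|.
  have k1 : 0 < 1 + k by rewrite addr_gt0.
  by rewrite -(ler_pdivlMr _ _ k1) /eta ge_min lexx orbT.
have nh := normr_ge0 h; have nd := normr_ge0 delta.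
have deltak : `|delta| <= k * `|h|.
  have : `|D| * `|delta| <= eta * (`|h| + `|delta|) + C * `|h|.
    rewrite -normrM; apply: (le_trans _ (lerD main dG0)).
    rewrite -[in leLHS](addKr ('d G p0 (h, 0)) (D * delta)).
    by rewrite addrC (le_trans (ler_normD _ _))// normrN addrC.
  rewrite mulrDr => H.
  have H1 : eta * `|h| <= `|D| / 2 * `|h| by rewrite ler_wpM2r.
  have H2 : eta * `|delta| <= `|D| / 2 * `|delta| by rewrite ler_wpM2r.
  have kD : `|D| * k = `|D| + 2 * C by rewrite /k; field; rewrite normr_eq0.
  rewrite -(ler_pM2l nD0) mulrA kD.
  by move: H H1 H2; lra.
rewrite /= /l -/delta mulNr opprK.
rewrite -(ler_pM2l nD0) -normrM mulrDr mulrA mulfV// mul1r addrC.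
apply: (le_trans main).
apply: (@le_trans _ _ (eta * (1 + k) * `|h|)).
  by rewrite -mulrA ler_wpM2l ?(ltW eta0)// mulrDl mul1r lerD2l.
by rewrite mulrA (mulrC `|D|) ler_wpM2r.
Unshelve. all: by end_near. Qed.

End implicit_function.

(** * The exit radius and the probability carried by one ray *)

Section radial_function.
Context {R : realType} {V : normedModType R}.
Variables (k : nat) (G : V * R -> R) (xbar : V) (r0 gam a b C : R).
Let A := ball xbar r0.
Hypothesis G_C1 : C1_on setT G.
Hypothesis gam0 : 0 < gam.
Hypothesis a0 : 0 < a.
Hypothesis b0 : 0 <= b.
Hypothesis G_convex : forall (x : V) (s t : R), A x -> 0 <= s -> 0 <= t <= 1 ->
  G (x, t * s) <= t * G (x, s) + (1 - t) * G (x, 0).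
Hypothesis G_slater : forall x, A x -> G (x, 0) <= - gam.
Hypothesis G_growth : forall (x : V) (s : R) (h : V), A x -> 0 <= s ->
  `|'d G (x, s) (h, 0)| <= a * expR (b * s) * `|h|.
Hypothesis C0 : 0 <= C.
Hypothesis C_pdf : forall s : R, 0 <= s ->
  s * chi_pdf k.+1 s * expR (b * s) <= C * expR (- (b * s)).
Hypothesis C_tail : forall s : R, 0 <= s ->
  1 - chi_cdf k s <= C * expR (- (2 * b * s)).

Let e (x : V) : R := \int[lebesgue_measure]_(s in [set s : R | 0 <= s /\ G (x, s) <= 0])
  chi_pdf k.+1 s.

Let exits (x : V) := exists s : R, 0 <= s /\ 0 < G (x, s).

(* Unspecified where the ray does not exit. *)
Let rho (x : V) : R := get [set s : R | 0 < s /\ G (x, s) = 0].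

Let dG p : differentiable G p. Proof. by have [] := @G_C1 p I. Qed.

Let cG : continuous G.
Proof. by move=> p; apply: differentiable_continuous; exact: dG. Qed.

Let cG1 (s : R) : continuous (fun x : V => G (x, s)).
Proof.
move=> x; apply: (@continuous_comp _ _ _ (fun x : V => (x, s)) G); last exact: cG.
exact: (@cvg_pair _ _ _ (nbhs x) (nbhs x) (nbhs s) _ _ _ id (fun=> s)
  cvg_id (cvg_cst _)).
Qed.

Let cG2 (x : V) : continuous (fun s : R => G (x, s)).
Proof.
move=> s; apply: (@continuous_comp _ _ _ (fun s : R => (x, s)) G); last exact: cG.
exact: (@cvg_pair _ _ _ (nbhs s) (nbhs x) (nbhs s) _ _ _ (fun=> x) id
  (cvg_cst _) cvg_id).
Qed.

(* Convexity on [0, s'] together with the Slater bound at 0. *)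
Let G_star x (s s' : R) : A x -> 0 <= s -> s <= s' ->
  s' * G (x, s) <= s * G (x, s') - (s' - s) * gam.
Proof.
move=> Ax s0 ss'; have := le_trans s0 ss'; rewrite le_eqVlt => /orP[/eqP s'0|s'0].
  have -> : s = 0 by apply/eqP; rewrite eq_le s0 andbT s'0.
  by rewrite -s'0 !mul0r subrr mul0r subr0.
have t01 : 0 <= s / s' <= 1 by rewrite divr_ge0 ?(ltW s'0)//= ler_pdivrMr// mul1r.
have := G_convex Ax (ltW s'0) t01; rewrite divfK ?gt_eqF// => H.
have t1 : 0 <= 1 - s / s' by rewrite subr_ge0; case/andP: t01.
have {}H : G (x, s) <= s / s' * G (x, s') - (1 - s / s') * gam.
  apply: (le_trans H); rewrite lerD2l -[leRHS]mulrN ler_wpM2l//; exact: G_slater.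
have -> : s * G (x, s') - (s' - s) * gam =
    s' * (s / s' * G (x, s') - (1 - s / s') * gam).
  by field; rewrite gt_eqF.
by rewrite ler_wpM2l// ltW.
Qed.

Let rhoP x : A x -> exits x -> 0 < rho x /\ G (x, rho x) = 0.
Proof.
move=> Ax [s [s0 Gs]].
apply: (@getPex _ [set s : R | 0 < s /\ G (x, s) = 0]).
have Gx0 : G (x, 0) < 0 by rewrite (le_lt_trans (G_slater Ax))// oppr_lt0.
have [||c] := @IVT R (fun s => G (x, s)) 0 s 0 s0.
- exact: continuous_subspaceT.
- by rewrite ge_min le_max (ltW Gx0) (ltW Gs) orbT.
rewrite in_itv /= => /andP[c0 cs] Gc; exists c; split => //.
by rewrite lt_neqAle c0 andbT; apply: contraTneq Gx0 => c0'; rewrite [X in (_, X)]c0' Gc ltxx.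
Qed.

Let G_lt0 x (s : R) : A x -> exits x -> 0 <= s -> s < rho x -> G (x, s) < 0.
Proof.
move=> Ax ex s0 sr; have [r_gt0 Gr] := rhoP Ax ex.
have := G_star Ax s0 (ltW sr); rewrite Gr mulr0 sub0r => H.
rewrite -(pmulr_rlt0 _ r_gt0) (le_lt_trans H)// oppr_lt0 mulr_gt0// subr_gt0//.
Qed.

Let G_ge x (s : R) : A x -> exits x -> rho x <= s -> (s - rho x) * gam <= rho x * G (x, s).
Proof.
move=> Ax ex rs; have [r_gt0 Gr] := rhoP Ax ex.
by have := G_star Ax (ltW r_gt0) rs; rewrite Gr mulr0 subr_ge0.
Qed.

Let G_gt0 x (s : R) : A x -> exits x -> rho x < s -> 0 < G (x, s).
Proof.
move=> Ax ex rs; have [r_gt0 Gr] := rhoP Ax ex.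
rewrite -(pmulr_rgt0 _ r_gt0) (lt_le_trans _ (G_ge Ax ex (ltW rs)))//.
by rewrite mulr_gt0// subr_gt0.
Qed.

(** [G_ge] at s = rho + 1 / (n + 1) bounds the difference quotients of G below by gam / rho, and the
    bound passes to the limit. This quantitative transversality makes the implicit function
    differentiable and controls the inverse slope. *)
Let slope_ge x : A x -> exits x -> gam <= rho x * 'd G (x, rho x) (0, 1).
Proof.
move=> Ax ex; have [r_gt0 Gr] := rhoP Ax ex.
have dGr := dG (x, rho x).
pose e01 : V * R := (0, 1).
have := @diff_derivable _ _ _ G (x, rho x) e01 dGr.
rewrite -(@deriveE _ _ _ G (x, rho x) e01 dGr) /derivable /derive => /cvgr_dnbhsP.
move=> /(_ (fun n => n.+1%:R^-1)) H.
have {}H : n.+1%:R * G (x, n.+1%:R^-1 + rho x) @[n --> \oo] --> 'D_e01 G (x, rho x).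
  rewrite (_ : (fun n => _ * _) = (fun n => n.+1%:R^-1^-1 *:
    ((G \o shift (x, rho x)) (n.+1%:R^-1 *: e01) - G (x, rho x)))).
    by apply: H; split => [n|]; [rewrite invr_eq0 pnatr_eq0|exact: cvg_harmonic].
  apply/funext => n; rewrite invrK Gr subr0; congr (_ * G (_, _)) => /=.
    by rewrite scaler0 add0r.
  by congr (_ + _); exact/esym/mulr1.
rewrite -(ler_pdivrMl _ _ r_gt0) -/(derive _ _ _) -(cvg_lim _ H)//.
apply: limr_ge; first by apply/cvg_ex; exists ('D_e01 G (x, rho x)).
apply: nearW => n; rewrite mulrC ler_pdivrMr//.
have n0 : 0 < n.+1%:R :> R by [].
have := @G_ge x (n.+1%:R^-1 + rho x) Ax ex.
rewrite lerDr invr_ge0 ler0n addrK => /(_ isT) H1.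
rewrite mulrAC -mulrA -ler_pdivrMl//.
Qed.

Let nbhs_A x : A x -> nbhs x A.
Proof. by move=> Ax; apply: open_nbhs_nbhs; split => //; exact: ball_open. Qed.

Let exits_near x : A x -> exits x -> \forall y \near x, A y /\ exits y.
Proof.
move=> Ax [s [s0 Gs]]; near=> y; split; first by near: y; exact: nbhs_A.
exists s; split => //; near: y; exact: (cvgr_gt _ (@cG1 s x)).
Unshelve. all: by end_near. Qed.

(** The signs of G at radii rho x - d and rho x + d persist for y near x and trap rho y between
    them. The cap d <= rho x / 2 keeps the lower radius nonnegative. *)
Let rho_continuous x : A x -> exits x -> {for x, continuous rho}.
Proof.
move=> Ax ex; have [r_gt0 Gr] := rhoP Ax ex.
apply/cvgrPdist_lt => eps eps0.
pose d := Num.min eps (rho x / 2).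
have d0 : 0 < d by rewrite lt_min eps0 divr_gt0.
have dr : d < rho x.
  by rewrite gt_min; apply/orP; right; rewrite ltr_pdivrMr// ltr_pMr// ltr1n.
have deps : d <= eps by rewrite ge_min lexx.
have G1 : G (x, rho x - d) < 0.
  by apply: G_lt0 => //; [rewrite subr_ge0 ltW|rewrite ltrBlDr ltrDl].
have G2 : 0 < G (x, rho x + d) by apply: G_gt0 => //; rewrite ltrDl.
near=> y.
have [Ay ey] : A y /\ exits y by near: y; exact: exits_near.
have Gy1 : G (y, rho x - d) < 0 by near: y; exact: (cvgr_lt _ (@cG1 _ x)).
have Gy2 : 0 < G (y, rho x + d) by near: y; exact: (cvgr_gt _ (@cG1 _ x)).
apply: (lt_le_trans _ deps); rewrite ltr_norml; apply/andP; split.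
  rewrite ltrBrDl -ltrBrDr opprK.
  rewrite ltNge; apply/negP => H; move: H; rewrite le_eqVlt => /orP[/eqP H|H].
    by move: Gy2; rewrite H (rhoP Ay ey).2 ltxx.
  have : G (y, rho x + d) < 0 by apply: G_lt0 => //; rewrite addr_ge0 ?ltW.
  by rewrite ltNge (ltW Gy2).
rewrite ltrBlDl -ltrBlDr ltNge; apply/negP; rewrite le_eqVlt => /orP[/eqP H|H].
  by move: Gy1; rewrite -H (rhoP Ay ey).2 ltxx.
have : 0 < G (y, rho x - d) by exact: G_gt0.
by rewrite ltNge (ltW Gy1).
Unshelve. all: by end_near. Qed.

Let e_exits x : A x -> exits x -> e x = chi_cdf k (rho x).
Proof.
move=> Ax ex; have [r_gt0 Gr] := rhoP Ax ex.
rewrite /e /chi_cdf; congr (Rintegral _ _ _); apply/seteqP; split => s /=.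
  move=> [s0 Gs]; rewrite in_itv /= s0 leNgt; apply/negP => rs.
  by have := G_gt0 Ax ex rs; rewrite ltNge Gs.
rewrite in_itv /= => /andP[s0]; rewrite le_eqVlt => /orP[/eqP ->|sr].
  by split; [exact: ltW|rewrite Gr].
by split => //; apply: ltW; exact: G_lt0.
Qed.

Let e_stays x : ~ exits x -> e x = 1.
Proof.
move=> nex; rewrite /e (_ : [set _ | _] = `[0, +oo[%classic).
  by rewrite /Rintegral integral_chi_pdf0y.
apply/seteqP; split => s /=; rewrite in_itv /= andbT; first by case.
move=> s0; split => //; rewrite leNgt; apply/negP => Gs; apply: nex.
by exists s.
Qed.

(** Chain rule for [chi_cdf] composed with [rho], with the implicit derivative of [rho] inserted. *)
Let de x h := - ('d G (x, rho x) (0, 1))^-1 * 'd G (x, rho x) (h, 0) *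
   chi_pdf k.+1 (rho x).

Let slope_gt0 x : A x -> exits x -> 0 < 'd G (x, rho x) (0, 1).
Proof.
move=> Ax ex; have [r_gt0 Gr] := rhoP Ax ex.
by rewrite -(pmulr_rgt0 _ r_gt0) (lt_le_trans gam0)// slope_ge.
Qed.

Let diff_e_exits x : A x -> exits x ->
  differentiable e x /\ forall h, 'd e x h = de x h.
Proof.
move=> Ax ex; have [r_gt0 Gr] := rhoP Ax ex.
have [||||drho rhoE] := @implicit_differentiable _ _ G rho x.
- exact: dG.
- by rewrite gt_eqF// slope_gt0.
- exact: rho_continuous.
- near=> y; rewrite Gr.
  have [Ay ey] : A y /\ exits y by near: y; exact: exits_near.
  exact: (rhoP Ay ey).2.
have dcdf := is_derive_chi_cdf k r_gt0.
have dcdf' : differentiable (chi_cdf k) (rho x).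
  by apply/derivable1_diffP; case: dcdf.
have dcomp := differentiable_comp drho dcdf'.
have dcompE := diff_comp drho dcdf'.
have eE : \forall y \near x, e y = (chi_cdf k \o rho) y.
  near=> y; have [Ay ey] : A y /\ exits y by near: y; exact: exits_near.
  exact: e_exits.
have [de_ deE] := near_eq_diff eE dcomp; split => // h.
rewrite deE dcompE /= rhoE (diff1E dcdf') derive1E.
by have [_ ->] := dcdf.
Unshelve. all: by end_near. Qed.

(** Three bounds multiply: the inverse slope is at most rho / gam, the x-derivative grows at most
    like a exp (b rho), and [C_pdf] absorbs rho exp (b rho) and still leaves exp (- b rho). *)
Let de_le x h : A x -> exits x ->
  `|de x h| <= a / gam * C * expR (- (b * rho x)) * `|h|.
Proof.
move=> Ax ex; have [r_gt0 Gr] := rhoP Ax ex.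
have D0 := slope_gt0 Ax ex; have Dge := slope_ge Ax ex.
have Di0 : 0 < ('d G (x, rho x) (0, 1))^-1 by rewrite invr_gt0.
rewrite /de mulNr mulNr normrN 2!normrM (gtr0_norm Di0).
rewrite (ger0_norm (chi_pdf_ge0 k (ltW r_gt0))).
set D := 'd G _ _ in Di0 D0 Dge *.
have Dinv : D^-1 <= rho x / gam.
  by rewrite -(ler_pM2l D0) mulfV ?gt_eqF// mulrA ler_pdivlMr// mul1r mulrC.
have h0 := normr_ge0 h; have chi0 := chi_pdf_ge0 k (ltW r_gt0).
apply: (@le_trans _ _ (rho x / gam * (a * expR (b * rho x) * `|h|) *
    chi_pdf k.+1 (rho x))).
  rewrite ler_wpM2r// ler_pM ?invr_ge0 ?normr_ge0 ?(ltW D0)//.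
  by apply: G_growth => //; exact: ltW.
have -> : rho x / gam * (a * expR (b * rho x) * `|h|) * chi_pdf k.+1 (rho x) =
    a / gam * `|h| * (rho x * chi_pdf k.+1 (rho x) * expR (b * rho x)) by ring.
have -> : a / gam * C * expR (- (b * rho x)) * `|h| =
    a / gam * `|h| * (C * expR (- (b * rho x))) by ring.
rewrite ler_wpM2l ?C_pdf ?(ltW r_gt0)//.
by rewrite mulr_ge0// divr_ge0// ltW.
Qed.

Let A_segment x y (t : R) : A x -> A y -> 0 <= t <= 1 -> A (x + t *: (y - x)).
Proof.
rewrite /A -ball_normE /= => Ax Ay /andP[t0 t1].
have -> : xbar - (x + t *: (y - x)) = (1 - t) *: (xbar - x) + t *: (xbar - y).
  rewrite opprD addrA scalerBl scale1r -[RHS]addrA; congr (_ + _).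
  rewrite [RHS]addrC -scalerBr -scalerN; congr (_ *: _).
  by rewrite !opprB [RHS]addrC addrA subrK.
apply: (le_lt_trans (ler_normD _ _)); rewrite !normrZ !ger0_norm ?subr_ge0//.
have [->|tn0] := eqVneq t 0; first by rewrite subr0 mul1r mul0r addr0.
have t_gt0 : 0 < t by rewrite lt_neqAle eq_sym tn0.
have H1 : (1 - t) * `|xbar - x| <= (1 - t) * r0 by rewrite ler_wpM2l ?subr_ge0// ltW.
have H2 : t * `|xbar - y| < t * r0 by rewrite ltr_pM2l.
by rewrite (lt_le_trans (ler_ltD H1 H2))// -mulrDl subrK mul1r.
Qed.

(* If the ray of x never exits then G (x, s) <= - gam / 2 at s = rho y, by convexity
   between 0 and 2 s, while G (y, s) = 0; the growth bound limits this increase. *)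
Let separation x y : A x -> ~ exits x -> A y -> exits y ->
  expR (- (b * rho y)) <= 2 * a / gam * `|y - x|.
Proof.
move=> Ax nx Ay ey; have [r_gt0 Gr] := rhoP Ay ey.
set s := rho y in r_gt0 Gr *.
have Gxs : G (x, s) <= - (gam / 2).
  have Gx2s : G (x, 2 * s) <= 0.
    rewrite leNgt; apply/negP => G2s; apply: nx; exists (2 * s); split => //.
    by rewrite mulr_ge0// ltW.
  have := @G_star x s (2 * s) Ax (ltW r_gt0).
  rewrite ler_peMl ?(ltW r_gt0) ?ler1n// => /(_ isT) H.
  have {}H : 2 * s * G (x, s) <= - (s * gam).
    apply: (le_trans H); rewrite (_ : 2 * s - s = s); last by ring.
    by rewrite -[leRHS]add0r lerD2r mulr_ge0_le0// ltW.
  rewrite -(ler_pM2l (mulr_gt0 (ltr0Sn R 1) r_gt0)) (le_trans H)//.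
  by rewrite le_eqVlt; apply/orP; left; apply/eqP; field.
have [t t01|t t01 E] := @diff_mean_value R (V * R)%type G (x, s) (y - x, 0).
  exact: dG.
have xyE : (x, s) + (y - x, 0) = (y, s) :> V * R.
  by congr (_, _); rewrite /= ?addr0// addrC subrK.
rewrite xyE Gr sub0r in E.
have tE : (x, s) + t *: (y - x, 0) = (x + t *: (y - x), s) :> V * R.
  by congr (_, _) => /=; rewrite ?scaler0 ?addr0.
rewrite tE in E.
have := @G_growth (x + t *: (y - x)) s (y - x) (A_segment Ax Ay t01) (ltW r_gt0).
rewrite -E => H.
have {}H : gam / 2 <= a * expR (b * s) * `|y - x|.
  by apply: (le_trans _ H); apply: (le_trans _ (ler_norm _)); rewrite lerNr.
rewrite expRN -(ler_pM2l (expR_gt0 (b * s))) mulfV ?gt_eqF ?expR_gt0//.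
have -> : expR (b * s) * (2 * a / gam * `|y - x|) =
    2 / gam * (a * expR (b * s) * `|y - x|) by ring.
apply: (@le_trans _ _ (2 / gam * (gam / 2))); last first.
  by rewrite ler_wpM2l// divr_ge0// ltW.
by rewrite le_eqVlt; apply/orP; left; apply/eqP; field; rewrite gt_eqF.
Qed.

Let e_le1 x : A x -> exits x -> 0 <= 1 - e x.
Proof.
move=> Ax ex; have [r_gt0 Gr] := rhoP Ax ex.
rewrite e_exits// (chi_cdf_tail _ (ltW r_gt0)); apply: Rintegral_ge0 => s /=.
rewrite in_itv /= andbT => rs; apply: chi_pdf_ge0.
exact/ltW/(lt_trans r_gt0).
Qed.

(** At an exiting point x + h the loss 1 - e is at most C exp (- b rho)^2, which [separation] turns
    into c |h|^2; at a point that does not exit the loss is 0. *)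
Let diff_e_stays x : A x -> ~ exits x ->
  differentiable e x /\ forall h, 'd e x h = 0.
Proof.
move=> Ax nx.
have c0 : continuous (\0 : V -> R) by exact: cst_continuous.
have [] := @differentiable_eps _ _ e x (\0 : {linear V -> R}) c0; last first.
  by move=> ? ->.
move=> eps eps0; pose c := C * (2 * a / gam) ^+ 2.
have c_ge0 : 0 <= c by rewrite mulr_ge0// sqr_ge0.
have cshift : (h + x) @[h --> (0 : V)] --> x.
  by rewrite -[X in _ --> X]add0r; apply: cvgD; [exact: cvg_id|exact: cvg_cst].
near=> h; rewrite (e_stays nx) subr0.
have Ahx : A (h + x) by near: h; exact: (cshift _ (nbhs_A Ax)).
have [ex|nex] := pselect (exits (h + x)); last first.
  by rewrite (e_stays nex) subrr normr0 mulr_ge0// ltW.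
have [r_gt0 Gr] := rhoP Ahx ex.
rewrite distrC ger0_norm ?e_le1// (e_exits Ahx ex).
apply: (le_trans (C_tail (ltW r_gt0))).
have := separation Ax nx Ahx ex; rewrite addrK => S.
have -> : expR (- (2 * b * rho (h + x))) = expR (- (b * rho (h + x))) ^+ 2.
  by rewrite -expRM_natl; congr expR; ring.
apply: (@le_trans _ _ (c * `|h| * `|h|)).
  have -> : c * `|h| * `|h| = C * (2 * a / gam * `|h|) ^+ 2 by rewrite /c; ring.
  rewrite ler_wpM2l//; apply: lerXn2r; rewrite ?nnegrE ?expR_ge0//.
  by rewrite (le_trans _ S)// expR_ge0.
rewrite ler_wpM2r//.
have H : `|h| <= eps / (c + 1).
  near: h; near=> h.
  have : `|0 - h| <= eps / (c + 1).
    by near: h; apply: cvgr_dist_le => //; rewrite divr_gt0// ltr_wpDl.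
  by rewrite sub0r normrN.
apply: (le_trans (ler_wpM2l c_ge0 H)).
rewrite mulrA ler_pdivrMr ?ltr_wpDl//.
by rewrite mulrC ler_wpM2l ?(ltW eps0)// lerDl.
Unshelve. all: by end_near. Qed.

Lemma radial_C1 : C1_on A e.
Proof.
move=> x Ax; have [ex|nx] := pselect (exits x).
  have [r_gt0 Gr] := rhoP Ax ex; have [de_ deE] := diff_e_exits Ax ex.
  split => // v.
  suff : 'd e y v @[y --> x] --> 'd e x v by [].
  rewrite deE.
  have crho := rho_continuous Ax ex.
  have cpair : (y, rho y) @[y --> x] --> (x, rho x).
    exact: (@cvg_pair _ _ _ (nbhs x) (nbhs x) (nbhs (rho x)) _ _ _ id rho
      cvg_id crho).
  have cde : de y v @[y --> x] --> de x v.
    rewrite /de; apply: cvgM; last first.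
      exact: (cvg_comp _ _ crho (@continuous_chi_pdf R k (rho x))).
    apply: cvgM; last first.
      exact: (cvg_comp _ _ cpair ((@G_C1 (x, rho x) I).2 (v, 0))).
    apply: cvgN; apply: cvgV; first by rewrite gt_eqF// slope_gt0.
    exact: (cvg_comp _ _ cpair ((@G_C1 (x, rho x) I).2 (0, 1))).
  apply: (cvg_trans _ cde); apply: near_eq_cvg; near=> y.
  have [Ay ey] : A y /\ exits y by near: y; exact: exits_near.
  by rewrite (diff_e_exits Ay ey).2.
have [de_ deE] := diff_e_stays Ax nx; split => // v.
apply/cvgrPdist_le => eps eps0 /=; rewrite deE.
(* The factor exp (- b rho y) kept by [de_le] is replaced, through [separation], by 2 a / gam |y -
   x|; hence the differential is at most c |y - x|. *)
pose c := a / gam * C * (2 * a / gam) * `|v|.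
have c_ge0 : 0 <= c by rewrite !mulr_ge0// ?invr_ge0 ?mulr_ge0// ltW.
near=> y; rewrite sub0r normrN.
have Ay : A y by near: y; exact: nbhs_A.
have [ey|ny] := pselect (exits y); last first.
  by rewrite (diff_e_stays Ay ny).2 normr0 ltW.
rewrite (diff_e_exits Ay ey).2; apply: (le_trans (de_le v Ay ey)).
apply: (@le_trans _ _ (c * `|y - x|)).
  rewrite /c (mulrAC _ `|v|) ler_wpM2r// -[leRHS]mulrA ler_wpM2l//.
    by rewrite !mulr_ge0// ?invr_ge0 ltW.
  exact: separation.
have H : `|y - x| <= eps / (c + 1).
  near: y; near=> y; rewrite distrC.
  by near: y; apply: cvgr_dist_le => //; rewrite divr_gt0// ltr_wpDl.
apply: (le_trans (ler_wpM2l c_ge0 H)).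
rewrite mulrA ler_pdivrMr ?ltr_wpDl//.
by rewrite mulrC ler_wpM2l ?(ltW eps0)// lerDl.
Unshelve. all: by end_near. Qed.

(** Dropping exp (- b rho) <= 1 from [de_le] leaves a constant free of x and of the exit radius,
    which serves as dominating function. *)
Lemma radial_diff_le x h : A x -> `|'d e x h| <= a / gam * C * `|h|.
Proof.
move=> Ax; have [ex|nex] := pselect (exits x); last first.
  rewrite (diff_e_stays Ax nex).2 normr0 !mulr_ge0// ?invr_ge0 ltW//.
rewrite (diff_e_exits Ax ex).2 (le_trans (de_le h Ax ex))//.
have [r_gt0 Gr] := rhoP Ax ex.
rewrite ler_wpM2r// ler_piMr//; last first.
  by rewrite -[leRHS]expR0 ler_expR lerNl oppr0 mulr_ge0// ltW.
by rewrite !mulr_ge0// ?invr_ge0 ltW.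
Qed.

End radial_function.

Section affine_composition.
Context {R : realType} {V W : normedModType R}.

Lemma diff_comp_affine (f : W -> R) (l : {linear V -> W}) (w0 : W) (p : V) :
  continuous l -> differentiable f (l p + w0) ->
  differentiable (fun q => f (l q + w0)) p /\
  forall h, 'd (fun q => f (l q + w0)) p h = 'd f (l p + w0) (l h).
Proof.
move=> cl df; pose dl : {linear V -> R} := 'd f (l p + w0) \o l.
have cdl : continuous dl.
  by move=> h; apply: continuous_comp; [exact: cl|exact: diff_continuous].
have [] := @differentiable_eps _ _ (fun q => f (l q + w0)) p dl cdl; last first.
  by move=> ? ->.
move=> eps eps0; have [c c0 lc] := linear_lipschitz cl.
have l0 : l h @[h --> (0 : V)] --> (0 : W).
  by have := cl 0; rewrite /continuous_at linear0.
have nl := l0 _ (eps_differentiable df (divr_gt0 eps0 c0)).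
near=> h; rewrite linearD -[l h + l p + w0]addrA.
apply: (@le_trans _ _ (eps / c * `|l h|)); first by near: h; exact: nl.
by rewrite mulrAC ler_pdivrMr// -mulrA ler_wpM2l ?(ltW eps0)// mulrC.
Unshelve. all: by end_near. Qed.

Lemma C1_comp_affine (f : W -> R) (l : {linear V -> W}) (w0 : W) :
  continuous l -> C1_on setT f -> C1_on setT (fun q => f (l q + w0)).
Proof.
move=> cl fC1 p _; have df w : differentiable f w by have [] := fC1 w I.
have [dp dpE] := diff_comp_affine cl (df (l p + w0)).
split => // v.
suff : 'd (fun q => f (l q + w0)) q v @[q --> p] -->
       'd (fun q => f (l q + w0)) p v by [].
under eq_fun do rewrite (diff_comp_affine cl (df (l _ + w0))).2.
rewrite dpE.
have cpl : (l q + w0) @[q --> p] --> l p + w0.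
  by apply: cvgD; [exact: cl|exact: cvg_cst].
exact: (cvg_comp _ _ cpl ((fC1 (l p + w0) I).2 (l v))).
Qed.

End affine_composition.

(** * Comparison of the Euclidean, operator and sup norms *)

Section norm2_bounds.
Variable R : realType.

Lemma ler_coord_norm2 k (v : 'cV[R]_k) i : `|v i 0| <= norm2 v.
Proof.
rewrite -sqrtr_sqr ler_wsqrtr// (bigD1 i)//= lerDl.
by apply: sumr_ge0 => j _; exact: sqr_ge0.
Qed.

Lemma norm2_le_sum k (v : 'cV[R]_k) : norm2 v <= \sum_i `|v i 0|.
Proof.
have S0 : 0 <= \sum_i `|v i 0| by apply: sumr_ge0.
rewrite -[leRHS]ger0_norm// -sqrtr_sqr ler_wsqrtr// expr2 mulr_suml.
apply: ler_sum => i _; rewrite -real_normK ?num_real// expr2 ler_wpM2l//.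
by rewrite (bigD1 i)//= lerDl; apply: sumr_ge0.
Qed.

Lemma norm2_le_opnorm2 k l (M : 'M[R]_(k, l)) (v : 'cV[R]_l) : norm2 v <= 1 ->
  norm2 (M *m v) <= opnorm2 M.
Proof.
move=> v1; apply: sup_upper_bound; last by exists v.
split; first by exists (norm2 (M *m v)); exists v.
(* [sup] dominates the elements only of a set that has an upper bound; the sum of the absolute
   entries is one. *)
exists (\sum_i \sum_j `|M i j|) => _ [u /= u1 <-].
apply: (le_trans (norm2_le_sum _)); apply: ler_sum => i _; rewrite mxE.
apply: (le_trans (ler_norm_sum _ _ _)); apply: ler_sum => j _.
by rewrite normrM ler_piMr// (le_trans (ler_coord_norm2 u j)).
Qed.

Lemma opnorm2_ge0 k l (M : 'M[R]_(k, l)) : 0 <= opnorm2 M.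
Proof.
have n0 : norm2 (0 : 'cV[R]_l) = 0 by apply/eqP; rewrite norm2_eq0.
by apply: le_trans (norm2_ge0 _) (norm2_le_opnorm2 M (v := 0) _); rewrite n0.
Qed.

(** The factor k is the price of a coordinatewise estimate; it ends up in the exponential rate of
    the ray. *)
Lemma norm2_lin_le k (w u : 'cV[R]_k) (s : R) : 0 <= s ->
  norm2 (s *: w + u) <= k%:R * (s * norm2 w + norm2 u).
Proof.
move=> s0; apply: (le_trans (norm2_le_sum _)).
have <- : \sum_(i < k) (s * norm2 w + norm2 u) = k%:R * (s * norm2 w + norm2 u).
  by rewrite sumr_const card_ord mulr_natl.
apply: ler_sum => i _; rewrite !mxE (le_trans (ler_normD _ _))// lerD ?ler_coord_norm2//.
by rewrite normrM ger0_norm// ler_wpM2l// ler_coord_norm2.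
Qed.

Lemma ler_coord_mx_norm k (v : 'cV[R]_k) i : `|v i 0| <= `|v|.
Proof.
rewrite [leRHS]mx_normrE.
exact: (@le_bigmax _ _ _ _ (fun ij => `|v ij.1 ij.2|) (i, 0)).
Qed.

Lemma norm2_le_mx_norm k (v : 'cV[R]_k) : norm2 v <= k%:R * `|v|.
Proof.
apply: (le_trans (norm2_le_sum _)).
have <- : \sum_(i < k) `|v| = k%:R * `|v| by rewrite sumr_const card_ord mulr_natl.
by apply: ler_sum => i _; exact: ler_coord_mx_norm.
Qed.

(** The growth condition bounds the Euclidean norm of the gradient, whereas increments are measured
    in the sup norm; summing over coordinates costs a factor n. *)
Lemma diff_le_grad n (f : 'cV[R]_n -> R) x h : differentiable f x ->
  `|'d f x h| <= n%:R * norm2 (grad f x) * `|h|.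
Proof.
move=> df; have hE : h = \sum_i h i 0 *: delta_mx i 0.
  rewrite [LHS]matrix_sum_delta; apply: eq_bigr => i _.
  by rewrite big_ord1.
rewrite [in leLHS]hE linear_sum (le_trans (ler_norm_sum _ _ _))//.
have <- : \sum_(i < n) (norm2 (grad f x) * `|h|) = n%:R * norm2 (grad f x) * `|h|.
  by rewrite sumr_const card_ord -mulrA mulr_natl.
apply: ler_sum => i _.
rewrite linearZ normrM mulrC ler_pM//.
  have := ler_coord_norm2 (grad f x) i; rewrite /grad.
  by case: asboolP => // _; rewrite mxE.
exact: ler_coord_mx_norm.
Qed.

End norm2_bounds.

(** * From rays to the probability function *)

Section integral_off_null_set.
Context d (T : measurableType d) (R : realType).
Variable mu : {measure set T -> \bar R}.
Local Open Scope ereal_scope.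

Import HBNNSimple.

(** The integral of a nonnegative function, measurable or not, is a supremum over simple functions
    below it. Multiplying such a simple function by the indicator of the complement of N puts it
    below g everywhere and preserves its integral. *)
Let ge0_integral_null_le (N : set T) (f g : T -> \bar R) :
  measurable N -> mu N = 0 -> (forall t, 0 <= f t) -> (forall t, 0 <= g t) ->
  (forall t, ~ N t -> f t = g t) ->
  \int[mu]_t f t <= \int[mu]_t g t.
Proof.
move=> mN N0 f0 g0 fg; rewrite !ge0_integralTE//.
apply: ge_ereal_sup => _ /= [h hf <-].
apply: ereal_sup_ubound; exists (proj_nnsfun h (measurableC mN)) => /=.
  move=> t; rewrite mindicE.
  have [tN|_] := boolP (t \in ~` N); last by rewrite mulr0.
  by rewrite mulr1 -fg//; exact: set_mem tN.
rewrite -!integralT_nnsfun; apply: ge0_ae_eq_integral => //.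
- exact/measurable_EFinP/measurable_funP.
- exact/measurable_EFinP/measurable_funP.
- by move=> t _; rewrite lee_fin.
- by move=> t _; rewrite lee_fin.
- exists N; split => // t /= nht; apply: contrapT => Nt; apply: nht => _.
  by rewrite mindicE mem_set// mulr1.
Qed.

(* f and g may be nonmeasurable: nothing is known about the gradient of the radial
   probability function on the exceptional null set. *)
Lemma integral_null_arbitrary (D N : set T) (f g : T -> \bar R) :
  measurable N -> mu N = 0 -> (forall t, D t -> ~ N t -> f t = g t) ->
  \int[mu]_(t in D) f t = \int[mu]_(t in D) g t.
Proof.
move=> mN N0 fg; rewrite integral_mkcond [RHS]integral_mkcond integralE [RHS]integralE.
have fgD t : ~ N t -> (f \_ D) t = (g \_ D) t.
  by move=> Nt; rewrite !patchE; case: ifPn => // /set_mem Dt; exact: fg.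
by congr (_ - _); apply/eqP; rewrite eq_le; apply/andP; split;
  apply: (ge0_integral_null_le mN N0) => // t /fgD; rewrite ?funeposE ?funenegE => ->.
Qed.

End integral_off_null_set.

(** * The restriction of g to a ray as an instance of the radial argument *)

Section ray_functions.
Variables (R : realType) (n k : nat) (g : 'cV[R]_n * 'cV[R]_k.+1 -> R).
Hypothesis g_C1 : C1_on setT g.
Hypothesis g_convex : convex_snd g.

Let dg p : differentiable g p. Proof. by have [] := @g_C1 p I. Qed.

Lemma diff_fst (x h : 'cV[R]_n) (y : 'cV[R]_k.+1) :
  differentiable (fun x' => g (x', y)) x /\
  'd (fun x' => g (x', y)) x h = 'd g (x, y) (h, 0).
Proof.
pose l0 (h : 'cV[R]_n) : 'cV[R]_n * 'cV[R]_k.+1 := (h, 0).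
have l0_linear : linear l0.
  by move=> c u v; rewrite /l0; congr (_, _); rewrite /= scaler0 addr0.
pose l : {linear 'cV[R]_n -> ('cV[R]_n * 'cV[R]_k.+1)%type} :=
  HB.pack l0 (GRing.isLinear.Build R _ _ _ l0 l0_linear).
have cl : continuous l.
  move=> u; exact: (@cvg_pair _ _ _ (nbhs u) (nbhs u) (nbhs (0 : 'cV[R]_k.+1)) _ _ _
    id (fun=> 0) cvg_id (cvg_cst _)).
have lE x' : l x' + (0, y) = (x', y) by congr (_, _); rewrite /= ?addr0 ?add0r.
have [] := @diff_comp_affine R _ _ g l (0, y) x cl (dg _).
under eq_fun do rewrite lE.
by rewrite lE => df dE; split => //; exact: dE.
Qed.

Section ray.
Variables w z : 'cV[R]_k.+1.

Let G (p : 'cV[R]_n * R) := g (p.1, p.2 *: w + z).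

Let l0 (p : 'cV[R]_n * R) : 'cV[R]_n * 'cV[R]_k.+1 := (p.1, p.2 *: w).

Let l0_linear : linear l0.
Proof.
by move=> c u v; rewrite /l0; congr (_, _); rewrite /= scalerDl scalerA.
Qed.

Let l : {linear ('cV[R]_n * R)%type -> ('cV[R]_n * 'cV[R]_k.+1)%type} :=
  HB.pack l0 (GRing.isLinear.Build R _ _ _ l0 l0_linear).

Let cl : continuous l.
Proof.
move=> u; apply: (@cvg_pair _ _ _ (nbhs u) (nbhs u.1) (nbhs (u.2 *: w)) _ _ _
    fst (fun p => p.2 *: w)); first exact: cvg_fst.
by apply: cvgZr_tmp; exact: cvg_snd.
Qed.

Let lE p : l p + (0, z) = (p.1, p.2 *: w + z).
Proof. by congr (_, _); rewrite /= ?addr0. Qed.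

Lemma C1_ray : C1_on setT G.
Proof.
have := @C1_comp_affine R _ _ g l (0, z) cl g_C1.
by under eq_fun do rewrite lE.
Qed.

Lemma diff_ray x s h : 'd G (x, s) (h, 0) =
  'd (fun x' => g (x', s *: w + z)) x h.
Proof.
have [_] := @diff_comp_affine R _ _ g l (0, z) (x, s) cl (dg _).
under eq_fun do rewrite lE.
move=> /(_ (h, 0)) ->; rewrite lE (diff_fst x h _).2 /= /l0 /=.
by rewrite scale0r.
Qed.

Lemma convex_ray x s t : 0 <= t -> t <= 1 ->
  G (x, t * s) <= t * G (x, s) + (1 - t) * G (x, 0).
Proof.
move=> t0 t1.
have := g_convex x (Itv01 t0 t1) (in_setT (s *: w + z)) (in_setT z).
have E : t *: (s *: w + z) + (1 - t) *: z = (t * s) *: w + z.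
  by rewrite scalerDr scalerA -addrA -scalerDl [t + _]addrC subrK scale1r.
by rewrite /G /= -E scale0r add0r; exact.
Qed.

Variables (xbar : 'cV[R]_n) (r0 gam a b eta C : R).
Let A := ball xbar r0.
(** On the ray |s w + z| <= (k + 1) (s eta + eta), so the growth exponent is at most b' s + b'; the
    part free of s moves into [a']. *)
Let b' := b * (k.+1%:R * eta).
(* n.+1 rather than n keeps a' positive when n = 0. *)
Let a' := n.+1%:R * (a * expR b').
Hypotheses (gam0 : 0 < gam) (a0 : 0 < a) (b0 : 0 < b) (eta0 : 0 <= eta).
Hypotheses (w_eta : norm2 w <= eta) (z_eta : norm2 z <= eta).
Hypothesis growth : forall x y, A x ->
  norm2 (grad (fun x' => g (x', y)) x) <= a * expR (b * norm2 y).
Hypothesis slater : forall x, A x -> g (x, z) <= - gam.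
Hypothesis C0 : 0 <= C.
Hypothesis C_pdf : forall s : R, 0 <= s ->
  s * chi_pdf k.+1 s * expR (b' * s) <= C * expR (- (b' * s)).
Hypothesis C_tail : forall s : R, 0 <= s ->
  1 - chi_cdf k s <= C * expR (- (2 * b' * s)).

Let a'0 : 0 < a'. Proof. by rewrite mulr_gt0// mulr_gt0// expR_gt0. Qed.

Let b'0 : 0 <= b'. Proof. by rewrite mulr_ge0 ?(ltW b0)// mulr_ge0. Qed.

Let growth_ray x (s : R) h : A x -> 0 <= s ->
  `|'d G (x, s) (h, 0)| <= a' * expR (b' * s) * `|h|.
Proof.
move=> Ax s0; rewrite diff_ray.
apply: (le_trans (diff_le_grad _ (diff_fst x 0 _).1)); rewrite ler_wpM2r//.
apply: (@le_trans _ _ (n.+1%:R * (a * expR (b * norm2 (s *: w + z))))).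
  by apply: ler_pM => //; [exact: norm2_ge0|rewrite ler_nat|exact: growth].
have -> : a' * expR (b' * s) = n.+1%:R * (a * expR (b' + b' * s)).
  by rewrite /a' expRD; ring.
rewrite ler_wpM2l// ler_wpM2l ?(ltW a0)// ler_expR.
have -> : b' + b' * s = b * (k.+1%:R * (s * eta + eta)) by rewrite /b'; ring.
rewrite ler_wpM2l ?(ltW b0)//; apply: (le_trans (norm2_lin_le _ _ s0)).
by rewrite ler_wpM2l// lerD// ler_wpM2l.
Qed.

Let G_slater x : A x -> G (x, 0) <= - gam.
Proof. by rewrite /G /= scale0r add0r; exact: slater. Qed.

Let G_convex x s t : A x -> 0 <= s -> 0 <= t <= 1 ->
  G (x, t * s) <= t * G (x, s) + (1 - t) * G (x, 0).
Proof. by move=> _ _ /andP[t0 t1]; exact: convex_ray. Qed.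

Lemma C1_ray_prob : C1_on A (fun x => \int[lebesgue_measure]_(r in
  [set r : R | 0 <= r /\ g (x, r *: w + z) <= 0]) chi_pdf k.+1 r).
Proof.
exact: (radial_C1 C1_ray gam0 a'0 G_convex G_slater growth_ray C0 C_pdf C_tail).
Qed.

Lemma diff_ray_prob_le x h : A x -> `|'d (fun x => \int[lebesgue_measure]_(r in
  [set r : R | 0 <= r /\ g (x, r *: w + z) <= 0]) chi_pdf k.+1 r) x h| <=
  a' / gam * C * `|h|.
Proof.
exact: (radial_diff_le C1_ray gam0 a'0 b'0 G_convex G_slater growth_ray C0 C_pdf C_tail).
Qed.

End ray.

End ray_functions.

Section countable_slater.
Variables (R : realType) (n : nat).

(** [z] and [L] are measurable on C only; extended by 0 they give integrands on the whole product,
    where Tonelli applies. *)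
Lemma measurable_fun_patch0 d (T : measurableType d) m q (C : set T)
    (f : T -> 'M[R]_(m, q)) : measurable C -> measurable_fun C f ->
  measurable_fun setT (fun c => if c \in C then f c else 0).
Proof.
move=> mC mf; apply: measurable_fun_mx => i j.
rewrite (_ : (fun _ => _) = (fun c => f c i j) \_ C).
  by apply/(measurable_restrictT _ mC); exact: (measurableT_comp (measurable_coord i j) mf).
by apply/funext => c; rewrite patchE; case: ifPn => //; rewrite mxE.
Qed.

(* The exceptional set of the hypothesis depends on x; rational points x suffice,
   at the price of a large inequality. *)
Lemma ae_continuous_le d (T : measurableType d) (P : {measure set T -> \bar R})
    (U : set 'cV[R]_n) (C : set T) (f : 'cV[R]_n -> T -> R) (r : R) :
  open U -> (forall t, continuous (f ^~ t)) ->
  (forall x, U x -> {ae P, forall t, C t -> f x t < r}) ->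
  {ae P, forall t, C t -> forall x, U x -> f x t <= r}.
Proof.
move=> oU cf H.
(* Rational matrices are enumerated by [unpickle]; an index that decodes to nothing, or to a point
   outside U, contributes the empty set. *)
pose B (i : nat) : set T := [set t | exists q : 'M[rat]_(n, 1),
  [/\ unpickle i = Some q, U (map_mx ratr q) , C t & ~ f (map_mx ratr q) t < r]].
have : P.-negligible (\bigcup_i B i).
  apply: negligible_bigcup => i.
  case E : (unpickle i : option 'M[rat]_(n, 1)) => [q|]; last first.
    rewrite (_ : B i = set0); first exact: negligible_set0.
    by apply/seteqP; split => t // -[q []]; rewrite E.
  have [Uq|nUq] := pselect (U (map_mx ratr q)); last first.
    rewrite (_ : B i = set0); first exact: negligible_set0.
    by apply/seteqP; split => t // -[q' []]; rewrite E => -[<-].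
  apply: negligibleS (H _ Uq) => t [q' []]; rewrite E => -[<-] _ Ct nf /= Hf.
  exact/nf/Hf.
apply: negligibleS => t /= nH; apply: contrapT => nB; apply: nH => Ct x Ux.
rewrite leNgt; apply/negP => rf.
have oUf : open (U `&` [set y | r < f y t]).
  apply: openI => //; apply: (@open_comp _ _ (f ^~ t) [set s | r < s]).
    by move=> y _; exact: cf.
  exact: open_gt.
have [[q e] /= [qx qU]] := mx_rat_ball oUf (conj Ux rf).
have [Uq rq] : (U `&` [set y | r < f y t]) (map_mx ratr q).
  apply: qU; apply: ballxx; by case: qx.
apply: nB; exists (pickle q) => //; exists q; split => //; first exact: pickleK.
by apply/negP; rewrite -leNgt ltW.
Qed.

End countable_slater.

Section probability_function_decomposition.
Variables (R : realType) (n k p : nat) (g : 'cV[R]_n * 'cV[R]_k.+1 -> R).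
Variables (C : set 'cV[R]_p) (P : probability 'cV[R]_p R).
Variables (z : 'cV[R]_p -> 'cV[R]_k.+1) (Sigma L : 'cV[R]_p -> 'M[R]_k.+1).
Hypotheses (mC : measurable C) (mz : measurable_fun C z) (mL : measurable_fun C L).
Hypothesis L_cholesky : forall c, C c -> cholesky_factor (L c) (Sigma c).
Hypothesis mg : forall x, measurable [set y | g (x, y) <= 0].

Let zetaP := (uniform_sphere R k.+1 \x P)%E.

Let z' c := if c \in C then z c else 0.
Let L' c := if c \in C then L c else 0.

Let mz' : measurable_fun setT z'. Proof. exact: measurable_fun_patch0. Qed.
Let mL' : measurable_fun setT L'. Proof. exact: measurable_fun_patch0. Qed.

Let e x (vc : 'cV[R]_k.+1 * 'cV[R]_p) : \bar R := \int[lebesgue_measure]_(r in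
  [set r : R | (0 <= r)%R /\ g (x, r *: (L' vc.2 *m vc.1) + z' vc.2)%R <= 0%R])
  (chi_pdf k.+1 r)%:E.

(** Moving the dependence on (v, c) from the domain of integration into the integrand gives access
    to joint measurability and hence to Tonelli. *)
Let e_indic x vc : e x vc = (\int[lebesgue_measure]_r
  ((\1_`[0%R, +oo[ r * chi_pdf k.+1 r)%:E *
   (\1_[set y | g (x, y) <= 0%R] (r *: (L' vc.2 *m vc.1) + z' vc.2)%R)%:E))%E.
Proof.
rewrite /e integral_mkcond; apply: eq_integral => r _.
rewrite patchE !indicE -EFinM.
have [r0|r0] := boolP (r \in `[0%R, +oo[%classic); last first.
  rewrite !mul0r memNset// => -[r0' _]; move/negP: r0; apply.
  by rewrite inE /= in_itv /= r0'.
have {}r0 : (0 <= r)%R by move: r0; rewrite inE /= in_itv /= andbT.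
set y := (_ + _)%R; have [gy|gy] := boolP (y \in _).
  by rewrite mul1r mulr1 mem_set//; split => //; exact: set_mem gy.
by rewrite mulr0 memNset// => -[_ /mem_set]; apply/negP.
Qed.

Let measurable_e x : measurable_fun setT (e x).
Proof.
rewrite (funext (e_indic x)).
pose h (q : ('cV[R]_k.+1 * 'cV[R]_p) * R) : \bar R :=
  ((\1_`[0%R, +oo[ q.2 * chi_pdf k.+1 q.2)%:E *
   (\1_[set y | g (x, y) <= 0%R] (q.2 *: (L' q.1.2 *m q.1.1) + z' q.1.2)%R)%:E)%E.
have mh : measurable_fun setT h.
  have m2 : measurable_fun setT (fun q : ('cV[R]_k.+1 * 'cV[R]_p) * R => q.1.2).
    by apply: measurableT_comp; [exact: measurable_snd|exact: measurable_fst].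
  have m1 : measurable_fun setT (fun q : ('cV[R]_k.+1 * 'cV[R]_p) * R => q.1.1).
    by apply: measurableT_comp; [exact: measurable_fst|exact: measurable_fst].
  apply: emeasurable_funM; apply/measurable_EFinP.
    apply: measurable_funM.
      apply: (measurableT_comp (measurable_indic (measurable_itv `[0, +oo[))).
      exact: measurable_snd.
    by apply: (measurableT_comp (@measurable_chi_pdf R k.+1)); exact: measurable_snd.
  apply: (measurableT_comp (measurable_indic (mg x))).
  apply: measurable_addmx; last exact: (measurableT_comp mz').
  apply: measurable_scalemx; first exact: measurable_snd.
  by apply: measurable_mulmx => //; exact: (measurableT_comp mL').
apply: (@measurable_fun_fubini_tonelli_F _ _ _ _ _ lebesgue_measure _ mh).
move=> [vc r]; rewrite /h /= -EFinM lee_fin mulr_ge0//.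
rewrite indicE; have [|_] := boolP (r \in _); last by rewrite mul0r.
by rewrite inE /= in_itv /= andbT => r0; rewrite mul1r chi_pdf_ge0.
Qed.

Let e_ge0 x vc : (0 <= e x vc)%E.
Proof. by apply: integral_ge0 => r [r0 _]; rewrite lee_fin chi_pdf_ge0. Qed.

Let e_le1 x vc : (e x vc <= 1)%E.
Proof.
rewrite -(integral_chi_pdf0y R k); apply: ge0_subset_integral => //.
- exact: (@measurable_ray_set _ _ [set y | g (x, y) <= 0]).
- by apply: measurable_funTS; apply/measurable_EFinP; exact: measurable_chi_pdf.
- by move=> r /=; rewrite in_itv /= andbT => r0; rewrite lee_fin chi_pdf_ge0.
- by move=> r /= [r0 _]; rewrite in_itv /= r0.
Qed.

Let e_fin x vc : e x vc \is a fin_num.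
Proof. by rewrite ge0_fin_numE// (le_lt_trans (e_le1 x vc)) ?ltry. Qed.

Let radial_prob_funE c x v : C c -> radial_prob_fun g z L c x v = fine (e x (v, c)).
Proof.
by move=> Cc; rewrite /radial_prob_fun /Rintegral /e /L' /z' /= (mem_set Cc).
Qed.

Lemma radial_prob_fun_bounded c x v : C c -> 0 <= radial_prob_fun g z L c x v <= 1.
Proof.
move=> Cc; rewrite radial_prob_funE// fine_ge0//=.
by rewrite -lee_fin fineK.
Qed.

Lemma measurable_radial_prob_fun (D : set ('cV[R]_k.+1 * 'cV[R]_p)) x :
  measurable D -> D `<=` [set vc | C vc.2] ->
  measurable_fun D (fun vc => radial_prob_fun g z L vc.2 x vc.1).
Proof.
move=> mD DC; apply: (@eq_measurable_fun _ _ _ _ D (fun vc => fine (e x vc))).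
  by move=> vc; rewrite inE => /DC Cc; rewrite radial_prob_funE//; case: vc Cc.
by apply: measurable_funTS; exact: (measurableT_comp (@fine_measurable R setT _)).
Qed.

Let sphere_e x c := (\int[uniform_sphere R k.+1]_v e x (v, c))%E.

Let sphere_e_ge0 x c : (0 <= sphere_e x c)%E.
Proof. by apply: integral_ge0. Qed.

Let sphere_e_fin x c : sphere_e x c \is a fin_num.
Proof.
rewrite ge0_fin_numE//.
apply: (@le_lt_trans _ _ (\int[uniform_sphere R k.+1]_v 1)%E).
  apply: ge0_le_integral => //.
  by apply: (measurableT_comp (measurable_e x)); exact: pair2_measurable.
rewrite integral_cst// mul1e.
by rewrite [X in (X < _)%E](@probability_setT _ _ _ (uniform_sphere R k.+1)) ltry.
Qed.

Let cond_prob_funE c x : C c -> cond_prob_fun g z Sigma c x = fine (sphere_e x c).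
Proof.
move=> Cc; rewrite /cond_prob_fun /Rintegral.
rewrite (spherical_radial_decomposition _ (mg x) (L_cholesky Cc)) /sphere_e.
apply: (congr1 fine); apply: eq_integral => v _.
by rewrite /e /L' /z' /= (mem_set Cc).
Qed.

(** [D] is left free so that points violating the ray hypotheses can be cut away. Tonelli is applied
    on the whole product with the indicator of C as a factor, and the null complement of D is
    removed afterwards. *)
Lemma prob_funE (D : set ('cV[R]_k.+1 * 'cV[R]_p)) x :
  measurable D -> D `<=` [set vc | C vc.2] -> zetaP (~` D) = 0%E ->
  prob_fun g C P z Sigma x =
  \int[zetaP]_(vc in D) radial_prob_fun g z L vc.2 x vc.1.
Proof.
move=> mD DC D0; rewrite /prob_fun /Rintegral; congr fine.
pose psi vc : \bar R := ((\1_C vc.2)%:E * e x vc)%E.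
have mpsi : measurable_fun setT psi.
  apply: emeasurable_funM => //; apply/measurable_EFinP.
  by apply: (measurableT_comp (measurable_indic mC)); exact: measurable_snd.
have psi0 vc : (0 <= psi vc)%E by apply: mule_ge0.
transitivity (\int[zetaP]_vc psi vc)%E.
  rewrite fubini_tonelli2// integral_mkcond; apply: eq_integral => c _.
  rewrite patchE /psi; case: ifPn => [|/negP] cC.
    rewrite (cond_prob_funE x (set_mem cC)) fineK//; apply: eq_integral => v _.
    by rewrite indicE cC mul1e.
  apply/esym/integral0_eq => v _; rewrite indicE memNset ?mul0e//.
  by move=> Cc; apply: cC; exact: mem_set.
rewrite (@ge0_negligible_integral _ _ _ zetaP setT (~` D))//; last exact: measurableC.
rewrite setTD setCK; apply: eq_integral => vc; rewrite inE => /DC Cc.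
rewrite radial_prob_funE// fineK// /psi indicE mem_set// mul1e.
by case: vc Cc.
Qed.

End probability_function_decomposition.

Theorem theorem1 (R : realType) (n m p : nat) (m_gt0 : (0 < m)%N)
  (C : set 'cV[R]_p) (mC : measurable C)
  (P : probability 'cV[R]_p R) (PC : P C = 1%E)
  (z : 'cV[R]_p -> 'cV[R]_m) (mz : measurable_fun C z)
  (Sigma L : 'cV[R]_p -> 'M[R]_m) (mL : measurable_fun C L)
  (Sigma_posdef : forall c, C c -> posdef (Sigma c))
  (L_cholesky : forall c, C c -> cholesky_factor (L c) (Sigma c))
  (eta0 : R) (eta0_gt0 : 0 < eta0)
  (zL_bounded : forall c, C c -> norm2 (z c) + opnorm2 (L c) <= eta0)
  (g : 'cV[R]_n * 'cV[R]_m -> R) (g_C1 : C1_on setT g)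
  (xbar : 'cV[R]_n)
  (g_growth : exponential_growth g xbar)
  (g_convex : convex_snd g)
  (xbar_slater : uniform_slater_point g C P z xbar) :
  let Phi := prob_fun g C P z Sigma in
  let e := radial_prob_fun g z L in
  let zetaP := (uniform_sphere R m \x P)%E in
  let SC := [set vc | sphere2 vc.1 /\ C vc.2] in
  exists U' : set 'cV[R]_n,
    [/\ open U', U' xbar, C1_on U' Phi &
      forall x, U' x ->
        [/\ {ae zetaP, forall vc, SC vc ->
               differentiable (fun x' => e vc.2 x' vc.1) x},
            ae_integrable_cV zetaP SC
              (fun vc => grad (fun x' => e vc.2 x' vc.1) x) &
            grad Phi x =
              int_cV zetaP SC (fun vc => grad (fun x' => e vc.2 x' vc.1) x)]].
Proof.
case: m m_gt0 z mz Sigma L mL Sigma_posdef L_cholesky zL_bounded g g_C1 g_growth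
  g_convex xbar_slater => [//|k] _ z mz Sigma L mL _ L_cholesky zL_bounded g g_C1
  g_growth g_convex xbar_slater Phi e zetaP SC.
have [U [gam [oU Uxbar gam0 slater]]] := xbar_slater.
have [eps [a [b [eps0 a0 b0 growth]]]] := g_growth.
have dg q : differentiable g q by have [] := g_C1 q I.
have cg : continuous g by move=> q; apply: differentiable_continuous; exact: dg.
have cg1 y : continuous (fun x => g (x, y)).
  move=> x; apply: (@continuous_comp _ _ _ (fun x => (x, y)) g); last exact: cg.
  exact: (@cvg_pair _ _ _ (nbhs x) (nbhs x) (nbhs y) _ _ _ id (fun=> y)
    cvg_id (cvg_cst _)).
have cg2 x : continuous (fun y => g (x, y)).
  move=> y; apply: (@continuous_comp _ _ _ (fun y => (x, y)) g); last exact: cg.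
  exact: (@cvg_pair _ _ _ (nbhs y) (nbhs x) (nbhs y) _ _ _ (fun=> x) id
    (cvg_cst _) cvg_id).
have mg x : measurable [set y | g (x, y) <= 0].
  rewrite (_ : [set _ | _] = setT `&` (fun y => g (x, y)) @^-1` `]-oo, 0%R]).
    by apply: (continuous_measurable_fun_mx (cg2 x)) => //; exact: measurable_itv.
  by rewrite setTI; apply/seteqP; split => y /=; rewrite in_itv.
have [r r0 rU] : exists2 r : R, 0 < r & ball xbar r `<=`
    U `&` [set x | norm2 (x - xbar) < eps].
  have /nbhs_ballP[r1 /= r10 r1U] : nbhs xbar U by exact: open_nbhs_nbhs.
  (* Balls are taken in the sup norm; the division by n + 1 places this one inside the Euclidean
     ball of radius eps, also when n = 0. *)
  exists (Num.min r1 (eps / n.+1%:R)).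
    by rewrite lt_min r10 divr_gt0.
  move=> x xr; split; first by apply: r1U; apply: le_ball xr; rewrite ge_min lexx.
  rewrite /=; apply: (le_lt_trans (norm2_le_mx_norm _)).
  move: xr; rewrite -ball_normE /= lt_min distrC => /andP[_].
  rewrite ltr_pdivlMr//; apply: le_lt_trans.
  by rewrite mulrC ler_wpM2l// ler_nat.
pose A := ball xbar r.
have [N [mN N0 NP]] := ae_continuous_le (C := C) (f := fun x c => g (x, z c)) oU
  (fun c => cg1 (z c)) slater.
have slaterN c x : C c -> ~ N c -> A x -> g (x, z c) <= - gam.
  move=> Cc Nc Ax; apply: contrapT => H; apply: Nc; apply: NP => /= HH.
  by apply: H; apply: HH => //; have [] := rU _ Ax.
have mS : measurable (@sphere2 R k.+1).
  rewrite (_ : @sphere2 R k.+1 = setT `&` @norm2 R k.+1 @^-1` [set 1%R]).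
    exact: measurable_norm2.
  by rewrite setTI.
(* On D all hypotheses of the ray lemmas hold for every x in A at once, so a single null set,
   independent of x, is discarded before differentiating. Unit length of v turns the bound on
   [opnorm2 (L c)] into one on L c v. *)
pose D : set ('cV[R]_k.+1 * 'cV[R]_p) := @sphere2 R k.+1 `*` (C `\` N).
have mD : measurable D by apply: measurableX => //; exact: measurableD.
have DC : D `<=` [set vc | C vc.2] by move=> vc [_ []].
have DSC : D `<=` SC by move=> vc [? []].
have zetaD : zetaP (~` D) = 0%E.
  have mS' : measurable (~` @sphere2 R k.+1) by exact: measurableC.
  have mCN : measurable (~` C `|` N) by apply: measurableU => //; exact: measurableC.
  have CN0 : P (~` C `|` N) = 0%E.
    have PC0 : P (~` C) = 0%E by rewrite probability_setC// PC subee.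
    by rewrite measureU0//; exact: measurableC.
  have sub : ~` D `<=` (~` @sphere2 R k.+1) `*` setT `|` setT `*` (~` C `|` N).
    move=> [v c] /= nD; have [v1|] := pselect (@sphere2 R k.+1 v); last by left.
    right; split=> //; have [Cc|] := pselect (C c); last by left.
    by right; apply: contrapT => Nc; apply: nD.
  apply/eqP; rewrite -measure_le0.
  have m1 : measurable ((~` @sphere2 R k.+1) `*` [set: 'cV[R]_p]) by exact: measurableX.
  have m2 : measurable ([set: 'cV[R]_k.+1] `*` (~` C `|` N)) by exact: measurableX.
  apply: (@le_trans _ _ (zetaP ((~` @sphere2 R k.+1) `*` setT `|` setT `*` (~` C `|` N)))).
    by apply: le_measure => //; rewrite inE; [exact: measurableC|exact: measurableU].
  apply: (le_trans (measureU2 _ m1 m2)).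
  have E1 : zetaP ((~` @sphere2 R k.+1) `*` setT) = 0%E.
    apply: (etrans (product_measure1E (uniform_sphere R k.+1) P mS' measurableT)).
    exact: (etrans (congr1 (fun u => u * P setT)%E (uniform_sphere_sphere2 R k)) (mul0e _)).
  have E2 : zetaP (setT `*` (~` C `|` N)) = 0%E.
    apply: (etrans (product_measure1E (uniform_sphere R k.+1) P measurableT mCN)).
    exact: (etrans (congr1 (fun u => uniform_sphere R k.+1 setT * u)%E CN0) (mule0 _)).
  by rewrite -[leRHS](adde0 0%E); apply: leeD; [rewrite -E1|rewrite -E2].
have zetaT : (zetaP D < +oo)%E.
  have mCN : measurable (C `\` N) by exact: measurableD.
  rewrite [X in (X < _)%E](product_measure1E (uniform_sphere R k.+1) P mS mCN).
  apply: lte_mul_pinfty => //.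
    by rewrite ge0_fin_numE// (le_lt_trans (probability_le1 _ mS))// ltry.
  by rewrite (le_lt_trans (probability_le1 _ mCN))// ltry.
have mSC : measurable SC by exact: measurableX.
(* The rate of the ray lemmas, with [eta0] bounding both L c v and z c. The constant [K] below
   depends on this rate and on k only, so [fK] is uniform in (v, c). *)
pose b' := b * (k.+1%:R * eta0).
have b'0 : 0 <= b' by rewrite !mulr_ge0// ltW.
have [K [K0 K_pdf K_tail]] := chi_bounds k b'0.
have growthA x y : A x -> norm2 (grad (fun x' => g (x', y)) x) <= a * expR (b * norm2 y).
  by move=> Ax; apply: growth; have [] := rU _ Ax.
have eta_z c : C c -> norm2 (z c) <= eta0.
  by move=> Cc; apply: le_trans (zL_bounded c Cc); rewrite lerDl opnorm2_ge0.
have eta_w v c : sphere2 v -> C c -> norm2 (L c *m v) <= eta0.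
  move=> v1 Cc; apply: le_trans (zL_bounded c Cc).
  apply: (@le_trans _ _ (opnorm2 (L c))); last by rewrite lerDr norm2_ge0.
  by apply: norm2_le_opnorm2; rewrite v1.
pose f x (vc : 'cV[R]_k.+1 * 'cV[R]_p) := e vc.2 x vc.1.
have fC1 vc : D vc -> C1_on A (f ^~ vc).
  move=> [v1 [Cc Nc]].
  exact: (C1_ray_prob g_C1 g_convex gam0 a0 b0 (eta_w _ _ v1 Cc) (eta_z _ Cc) growthA
    (fun x Ax => slaterN _ _ Cc Nc Ax) K0 K_pdf K_tail).
have fK x vc h : A x -> D vc -> `|'d (f ^~ vc) x h| <=
    n.+1%:R * (a * expR b') / gam * K * `|h|.
  move=> Ax [v1 [Cc Nc]].
  exact: (diff_ray_prob_le g_C1 g_convex gam0 a0 b0 (ltW eta0_gt0)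
    (eta_w _ _ v1 Cc) (eta_z _ Cc) growthA (fun x Ax => slaterN _ _ Cc Nc Ax) K0 K_pdf K_tail h Ax).
have mf x : measurable_fun D (f x).
  exact: (measurable_radial_prob_fun mC mz mL mg).
have f1 x vc : A x -> D vc -> `|f x vc| <= 1.
  move=> _ /DC Cc; have /andP[f0 f1] := radial_prob_fun_bounded z L mg x vc.1 Cc.
  by rewrite ger0_norm.
have PhiE : Phi = fun x => \int[zetaP]_(vc in D) f x vc.
  by apply/funext => x; exact: (prob_funE mC mz mL L_cholesky mg).
have oA : open A by exact: ball_open.
exists A; split => //; first exact: ballxx.
  by rewrite PhiE; exact: (C1_on_integral mD zetaT oA mf f1 fC1 fK).
move=> x Ax.
have gradE vc i : D vc ->
    grad (fun x' => e vc.2 x' vc.1) x i 0 = 'd (f ^~ vc) x (delta_mx i 0).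
  by move=> Dvc; rewrite /grad asboolT ?mxE//; exact: (fC1 _ Dvc _ Ax).1.
split.
- exists (~` D); split => //; first exact: measurableC.
  by move=> vc H Dvc; apply: H => _; exact: (fC1 _ Dvc _ Ax).1.
(* A measurable representative: 0 off D, where nothing is known about the gradient. *)
- pose G vc := if vc \in D then grad (fun x' => e vc.2 x' vc.1) x else 0.
  exists G; split.
    move=> i; have := integrable_diff_param mD zetaT mf fC1 fK (delta_mx i 0) Ax.
    rewrite (integrable_mkcond _ mD) => /(integrableS measurableT mSC (@subsetT _ _)).
    apply: eq_integrable => // vc _; rewrite /G patchE.
    case: ifPn => [/set_mem Dvc|_]; last by rewrite mxE.
    by rewrite gradE.
  exists (~` D); split => //; first exact: measurableC.
  by move=> vc H Dvc; apply: H => _; rewrite /G mem_set.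
- have [dPhi PhiD] := diff_integral mD zetaT oA mf f1 fC1 fK Ax.
  apply/matrixP => i j; rewrite ord1 PhiE {1}/grad asboolT// !mxE PhiD.
  (* The differential of [Phi] is an integral over D, the claim one over [SC]; on the difference the
     gradient may fail to be measurable, which [integral_null_arbitrary] tolerates. *)
  apply: (congr1 fine); rewrite integral_mkcond [RHS]integral_mkcond.
  apply: (integral_null_arbitrary (measurableC mD) zetaD) => vc _ /contrapT Dvc.
  by rewrite !patchE (mem_set Dvc) (mem_set (DSC _ Dvc)) gradE.
Qed.
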